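(* Let $T:I\to I$ and $r:I\to\mathbb{R}_+$ satisfy all the assumptions listed in the context, including UNI. Then for every $0<\alpha<1$ there exist $t_0>0$ and $\epsilon>0$ such that for every real $t$ with $|t|>t_0$ and every real $\sigma$ with $|\sigma|<\epsilon$, setting $s=\sigma+it$, the operator $\mathrm{Id}-L_s$ is invertible on $C^1(I)$ and $$\|(\mathrm{Id}-L_s)^{-1}\|_{1,t}\le|t|^\alpha .$$
   Context: Let $0<c_1<\dots<c_m<c_{m+1}<\dots<1$ be points defining a finite or countable partition of $I=[0,1]$ into subintervals; every subinterval of the partition (including those with endpoint $0$ or $1$) is denoted generically $(c_m,c_{m+1})$. Let $T:I\to I$ be such that each $T|_{(c_m,c_{m+1})}$ is $C^2$ and extends to a homeomorphism from $[c_m,c_{m+1}]$ onto $I$. Let $\mathcal{H}_n$ be the set of inverse branches $h:I\to h(I)$ of $T^n$ and $\mathcal{H}=\mathcal{H}_1$ the set of inverse branches $h:I\to[c_m,c_{m+1}]$ of $T$ (inverses of these homeomorphisms; $\mathcal{H}_n$ consists of the $n$-fold compositions of elements of $\mathcal{H}$). Assumptions on $T$: (expansion) there are $C\ge1$ and $\hat\rho<1$ with $|h(x)-h(y)|\le C\hat\rho^n|x-y|$ for all $n\ge 1$, all $h\in\mathcal{H}_n$ and all $x,y\in I$; (Renyi's condition) there is $K>0$ such that $|h''|\le K|h'|$ for every $h\in\mathcal{H}$. Assumptions on $r:I\to\mathbb{R}_+$: each $r|_{(c_m,c_{m+1})}$ is $C^1$; $\inf r>0$; there is $\sigma_0<0$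 such that $\sum_{h\in\mathcal{H}}\sup\big(\exp(-\sigma(r\circ h))\,|h'|\big)<\infty$ for all $\sigma>\sigma_0$; and $|r'\circ h|\cdot|h'|\le K$ for all $h\in\mathcal{H}$. Functions such as $h'$ and $r\circ h$ are understood as extended to the whole of $I$, with $r\circ h\in C^1(I)$. For $n\ge1$, $r^{(n)}(x)=\sum_{k=0}^{n-1}r(T^k(x))$, with the same convention for $r^{(n)}\circ h$, $h\in\mathcal{H}_n$. UNI (for the pair $(T,r)$): there exist $D>0$ and $n_0\ge1$ such that for every integer $n\ge n_0$ there are two elements $h,k\in\mathcal{H}_n$ for which the function $\psi_{h,k}(x)=r^{(n)}(h(x))-r^{(n)}(k(x))$ on $I$ satisfies $\inf_I|\psi_{h,k}'|\ge D$. Transfer operators: for $s=\sigma+it$ with $\sigma>\sigma_0$, $t\in\mathbb{R}$, $$L_sf(x)=\sum_{h\in\mathcal{H}}e^{-s\,r(h(x))}\,|h'(x)|\,f(h(x)),$$ acting on the space $C^1(I)$ of complex-valued $C^1$ functions. For $t\neq0$, $\|f\|_{1,t}=\sup|f|+\frac{\sup|f'|}{|t|}$ on $C^1(I)$, and $\|\cdot\|_{1,t}$ also denotes the associated operator norm. *)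

(* Defs.v *)
From mathcomp Require Import all_boot all_order all_algebra.
From mathcomp Require Import all_classical all_reals all_analysis.
From mathcomp Require Import complex.

Set Implicit Arguments.
Unset Strict Implicit.
Unset Printing Implicit Defensive.

Import Order.TTheory GRing.Theory Num.Theory.
Import numFieldNormedType.Exports.

Local Open Scope classical_set_scope.
Local Open Scope ring_scope.
Local Open Scope complex_scope.

Section C1_on_the_unit_interval.
Variable R : realType.

(* A function on I is a function on R of which only the values on I matter. *)
Definition I01 : set R := `[0, 1].

(* Extension by continuity: the limit of g y as y tends to x inside A.  For g
   continuous on an open A this is g x at every x in A. *)
Definition ext (A : set R) (g : R -> R) (x : R) : R :=
  lim (g y @[y --> within A (nbhs x)]).

Definition slope (f : R -> R) (x y : R) : R := (f y - f x) / (y - x).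

(* Derivative relative to I: one-sided at 0 and at 1. *)
Definition derivI (f : R -> R) (x : R) : R :=
  lim (slope f x y @[y --> within I01 x^']).

Definition isC1 (f : R -> R) : Prop :=
  (forall x, I01 x -> cvg (slope f x y @[y --> within I01 x^'])) /\
  {within I01, continuous (derivI f)}.

(* The space C^1(I) of complex-valued functions.  Requiring f = 0 off I makes
   equality in this space coincide with equality on I. *)
Definition C1I : set (R -> R[i]) :=
  [set f | [/\ isC1 (fun x => complex.Re (f x)),
               isC1 (fun x => complex.Im (f x)) &
               forall x, ~ I01 x -> f x = 0]].

Definition derivC (f : R -> R[i]) (x : R) : R[i] :=
  derivI (fun y => complex.Re (f y)) x +i*
  derivI (fun y => complex.Im (f y)) x.

Definition supnorm (f : R -> R[i]) : R := sup [set Normc.normc (f x) | x in I01].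

Definition norm1 (t : R) (f : R -> R[i]) : R :=
  supnorm f + supnorm (derivC f) / `|t|.

Definition opnorm1 (t : R) (A : (R -> R[i]) -> (R -> R[i])) : \bar R :=
  ereal_sup [set (norm1 t (A f))%:E | f in C1I `&` [set f | norm1 t f <= 1]].

Definition inverse_on_C1I (A B : (R -> R[i]) -> (R -> R[i])) : Prop :=
  [/\ forall f, C1I f -> C1I (A f), forall f, C1I f -> C1I (B f),
      forall f, C1I f -> B (A f) = f & forall f, C1I f -> A (B f) = f].

Definition expc (z : R[i]) : R[i] :=
  (expR (complex.Re z))%:C * (cos (complex.Im z) +i* sin (complex.Im z)).

Definition limC (u : nat -> R[i]) : R[i] :=
  limn (fun n => complex.Re (u n)) +i* limn (fun n => complex.Im (u n)).

End C1_on_the_unit_interval.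

Arguments I01 {R}.
Arguments C1I {R}.

Section expanding_maps_and_roofs.
Variable R : realType.

(* The subintervals of the partition are ]a i, b i[ for i in J, a finite or
   infinite set of naturals; the numbering need not follow the order of I.
   The cut points, together with 0, 1 and their accumulation points (such as
   the limit of an infinite increasing sequence of cut points), form the
   countable set of points of I lying in no subinterval. *)
Record is_partition (J : set nat) (a b : nat -> R) : Prop := IsPartition {
  part_bounds : forall i, J i -> [/\ 0 <= a i, a i < b i & b i <= 1];
  part_disjoint : trivIset J (fun i => `]a i, b i[%classic);
  part_cover : countable (I01 `\` \bigcup_(i in J) `]a i, b i[%classic) }.

(* h is the inverse of the homeomorphism [a, b] -> I extending T|]a, b[. *)
Record inverse_branch (T : R -> R) (a b : R) (h : R -> R) : Prop :=
  InverseBranch {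
  branch_ext_cont : {within `[a, b], continuous (ext `]a, b[ T)};
  branch_ext_bij : set_bij `[a, b] I01 (ext `]a, b[ T);
  branch_inv : forall x, I01 x -> `[a, b]%classic (h x) /\ ext `]a, b[ T (h x) = x;
  branch_inv_cont : {within I01, continuous h} }.

(* isC1 h and isC1 (derivI h) express that the extension of h' to I is C^1, as
   the action of the transfer operators on C^1(I) requires. *)
Record is_markov_map (J : set nat) (a b : nat -> R) (T : R -> R)
    (h : nat -> R -> R) : Prop := IsMarkovMap {
  map_partition : is_partition J a b;
  map_self : forall x, I01 x -> I01 (T x);
  map_C2 : forall i x, J i -> `]a i, b i[%classic x ->
    [/\ derivable T x 1, derivable (derive1 T) x 1 & {for x, continuous (derive1 (derive1 T))}];
  map_branch : forall i, J i -> inverse_branch T (a i) (b i) (h i);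
  map_branch_C2 : forall i, J i -> isC1 (h i) /\ isC1 (derivI (h i)) }.

(* The inverse branches of T^n: the n-fold compositions of inverse branches
   of T. *)
Definition branches (J : set nat) (h : nat -> R -> R) (n : nat) :
    set (R -> R) :=
  [set foldr (fun i g => h i \o g) id w |
    w in [set w : seq nat | size w = n /\ forall i, i \in w -> J i]].

Definition expanding (J : set nat) (h : nat -> R -> R) : Prop :=
  exists C rho : R, [/\ 1 <= C, rho < 1 &
    forall n g x y, (1 <= n)%N -> branches J h n g -> I01 x -> I01 y ->
      `|g x - g y| <= C * rho ^+ n * `|x - y|].

Definition renyi (J : set nat) (h : nat -> R -> R) (K : R) : Prop :=
  forall i x, J i -> I01 x ->
    `|derivI (derivI (h i)) x| <= K * `|derivI (h i) x|.

(* u \o g, extended to I. *)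
Definition compI (u g : R -> R) : R -> R := ext `]0, 1[ (u \o g).

Definition weight (r : R -> R) (g : R -> R) (sigma x : R) : R :=
  expR (- (sigma * compI r g x)) * `|derivI g x|.

(* In roof_deriv_le the extension of (r' \o h) * h' to I satisfies the bound
   on I as soon as it holds on ]0, 1[. *)
Record is_roof (J : set nat) (a b : nat -> R) (h : nat -> R -> R)
    (r : R -> R) (K sigma0 : R) : Prop := IsRoof {
  roof_ge0 : forall x, I01 x -> 0 <= r x;
  roof_C1 : forall i x, J i -> `]a i, b i[%classic x ->
    derivable r x 1 /\ {for x, continuous (derive1 r)};
  roof_inf : 0 < inf [set r x | x in I01];
  roof_sigma0 : sigma0 < 0;
  roof_summable : forall sigma, sigma0 < sigma ->
    (\sum_(i <oo | i \in J)
       ereal_sup [set (weight r (h i) sigma x)%:E | x in I01] < +oo)%E;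
  roof_comp_C1 : forall i, J i -> isC1 (compI r (h i));
  roof_deriv_le : forall i x, J i -> `]0, 1[%classic x ->
    `|derive1 r (h i x)| * `|derivI (h i) x| <= K }.

Definition birkhoff (T r : R -> R) (n : nat) (x : R) : R :=
  \sum_(k < n) r (iter k T x).

Definition psi (T r : R -> R) (n : nat) (g k : R -> R) (x : R) : R :=
  compI (birkhoff T r n) g x - compI (birkhoff T r n) k x.

Definition UNI (J : set nat) (h : nat -> R -> R) (T r : R -> R) : Prop :=
  exists D : R, exists n0 : nat, [/\ 0 < D, (1 <= n0)%N &
    forall n, (n0 <= n)%N -> exists g k,
      [/\ branches J h n g, branches J h n k &
          D <= inf [set `|derivI (psi T r n g k) x| | x in I01]]].

Definition transfer (J : set nat) (h : nat -> R -> R) (r : R -> R) (s : R[i])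
    (f : R -> R[i]) (x : R) : R[i] :=
  if x \in I01 then
    limC (fun n => \sum_(i < n | (i : nat) \in J)
      expc (- (s * (compI r (h i) x)%:C)) * (`|derivI (h i) x|)%:C * f (h i x))
  else 0.

End expanding_maps_and_roofs.

(* Main.v *)
(* If |L_s^n| <= C l^n for all n, with l > 1 as close to 1 as desired, and
   |L_s^M| <= 1/2 for some M of order log |t|, the Neumann series of L_s^M gives
   |(1 - L_s)^-1| <= 2 C M l^M <= |t|^alpha.

   To halve the norm, take f >= 1 with L_(2 sigma) f <= l f and |f'| <= 2 K1 f,
   and follow the energies of v and of v', where the energy of v is the integral
   of |v|^2 / f.  Cauchy-Schwarz, and the fact that the images of the branches do
   not overlap, show that L_s multiplies the energy by at most l, while a
   Lasota-Yorke inequality contracts the energy of v' up to a multiple of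
   t^2 times the energy of v.  When the energy of v' is at most a multiple of t^2
   times that of v, UNI provides two words of fixed length N whose phases rotate
   against each other at speed at least D |t|, so over distances of order 1/|t|
   the corresponding two terms of L_s^N v cannot stay aligned.  This leaves a
   defect in Cauchy-Schwarz, and the energy decreases by a definite factor;
   otherwise Lasota-Yorke leads back to this case.  After O(log |t|) iterations
   the energy beats every power of |t| needed to return to the supremum norm.

   All constants are uniform over the finite sets of branches containing the two
   words, and the full operator is a limit of such truncations. *)
Require Import Defs.
From mathcomp Require Import all_boot all_order all_algebra.
From mathcomp Require Import all_classical all_reals all_analysis.
From mathcomp Require Import complex.
From mathcomp Require Import ring lra zify.

Import Order.TTheory GRing.Theory Num.Theory.
Import numFieldNormedType.Exports.

Local Open Scope classical_set_scope.
Local Open Scope ring_scope.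
Local Open Scope complex_scope.

Set Implicit Arguments.
Unset Strict Implicit.
Unset Printing Implicit Defensive.

Local Notation normc := Normc.normc.

(** * Calculus on the unit interval *)

Section unit_interval_calculus.
Variable R : realType.
Implicit Types (f g df dg F G : R -> R) (x y : R).

(** The supersolution stands in for an eigenfunction of the operator at [2 * sigma]: a finite sum of
    iterates of 1 is enough, so no spectral theory enters and the bounds do not depend on the
    alphabet. The doubled parameter arises because Cauchy-Schwarz splits each weight at sigma into a
    weight at [2 * sigma], absorbed by the supersolution, and a bare Jacobian, absorbed by
    integration. The price is a possible growth l per step, and this dictates the order of the
    choices. The length N and the loss c are fixed first and serve every l >= 1 with l^N <= 2; then
    l is taken so close to 1 that it spoils neither the loss over 2N steps nor the exponent alpha;
    the range of sigma and the threshold on t come last. What is propagated is a pair of integral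
    bounds, G for v and a multiple of t^2 G for v', a form preserved whether or not cancellation
    takes place. Integrals are differences of primitives and are compared by monotonicity. *)

Definition inI (x : R) : bool := (0 <= x) && (x <= 1).

Lemma inIP x : reflect (0 <= x /\ x <= 1) (inI x).
Proof. exact: andP. Qed.

Lemma I01E x : I01 x <-> inI x.
Proof. by rewrite /I01 /= in_itv. Qed.

Lemma inI0 : inI 0.
Proof. by rewrite /inI lexx ler01. Qed.

Lemma inI1 : inI 1.
Proof. by rewrite /inI lexx ler01. Qed.

(** Derivatives are two-sided at every point of I, endpoints included: functions are replaced by
    extensions beyond I, so that the usual rules of calculus apply without one-sided variants.
    [isC1_Der] provides these extensions. *)
Definition Der f df := forall x, inI x -> is_derive x 1 f (df x).
Definition cI f := forall x, inI x -> {for x, continuous f}.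

Lemma Der_ext f df dg : Der f df -> (forall x, inI x -> df x = dg x) -> Der f dg.
Proof. by move=> fdf e x xI; rewrite -e//; exact: fdf. Qed.

Lemma Der_cst (c : R) : Der (fun=> c) (fun=> 0).
Proof. by move=> x _; exact: is_derive_cst. Qed.

Lemma Der_id : Der id (fun=> 1).
Proof. by move=> x _; exact: is_derive_id. Qed.

Lemma DerD f g df dg : Der f df -> Der g dg ->
  Der (fun x => f x + g x) (fun x => df x + dg x).
Proof. by move=> fd gd x xI; apply: is_deriveD; [exact: fd|exact: gd]. Qed.

Lemma DerN f df : Der f df -> Der (fun x => - f x) (fun x => - df x).
Proof. by move=> fd x xI; apply: is_deriveN; exact: fd. Qed.

Lemma DerB f g df dg : Der f df -> Der g dg ->
  Der (fun x => f x - g x) (fun x => df x - dg x).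
Proof. by move=> fd gd; apply: DerD => //; exact: DerN. Qed.

Lemma DerM f g df dg : Der f df -> Der g dg ->
  Der (fun x => f x * g x) (fun x => df x * g x + f x * dg x).
Proof.
move=> fd gd x xI.
have h : is_derive x 1 (f * g) (f x *: dg x + g x *: df x).
  by apply: is_deriveM; [exact: fd|exact: gd].
by apply: is_derive_eq h _; rewrite /GRing.scale /= addrC [g x * _]mulrC.
Qed.

Lemma DerZ (c : R) f df : Der f df -> Der (fun x => c * f x) (fun x => c * df x).
Proof.
move=> fd; apply: (Der_ext (DerM (Der_cst c) fd)) => x _.
by rewrite mul0r add0r.
Qed.

Lemma DerV f df : (forall x, inI x -> f x != 0) -> Der f df ->
  Der (fun x => (f x)^-1) (fun x => - df x / f x ^+ 2).
Proof.
move=> f0 fd x xI.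
have h := is_deriveV (f0 x xI) (fd x xI).
by apply: is_derive_eq h _; rewrite /GRing.scale /= !mulNr mulrC.
Qed.

Lemma Der_comp f g df dg : Der f df -> Der g dg ->
  (forall x, inI x -> inI (g x)) ->
  Der (fun x => f (g x)) (fun x => df (g x) * dg x).
Proof.
move=> fd gd gI x xI.
exact: is_derive1_comp (fd (g x) (gI x xI)) (gd x xI).
Qed.

Lemma Der_compT f g df dg : (forall x, is_derive x 1 f (df x)) -> Der g dg ->
  Der (fun x => f (g x)) (fun x => df (g x) * dg x).
Proof. by move=> fd gd x xI; exact: is_derive1_comp (fd (g x)) (gd x xI). Qed.

Lemma Der_exp f df : Der f df -> Der (fun x => expR (f x)) (fun x => expR (f x) * df x).
Proof. by apply: Der_compT => x; exact: is_derive_expR. Qed.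

Lemma Der_cos f df : Der f df -> Der (fun x => cos (f x)) (fun x => - sin (f x) * df x).
Proof. by apply: (@Der_compT _ _ (fun x => - sin x)) => x; exact: is_derive_cos. Qed.

Lemma Der_sin f df : Der f df -> Der (fun x => sin (f x)) (fun x => cos (f x) * df x).
Proof. by apply: Der_compT => x; exact: is_derive_sin. Qed.

Lemma Der_sum (T : Type) (s : seq T) (f df : T -> R -> R) :
  (forall i, Der (f i) (df i)) ->
  Der (fun x => \sum_(i <- s) f i x) (fun x => \sum_(i <- s) df i x).
Proof.
move=> fd; elim: s => [|i s IH].
  move=> x xI; rewrite big_nil (_ : (fun x => _) = cst 0).
    exact: is_derive_cst.
  by rewrite funeqE => y; rewrite big_nil.
move=> x xI; rewrite big_cons.
rewrite (_ : (fun x => _) = (fun x => f i x + \sum_(j <- s) f j x)).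
  by apply: (DerD (fd i) IH xI).
by rewrite funeqE => y; rewrite big_cons.
Qed.

Lemma Der_sum_in (T : eqType) (s : seq T) (f df : T -> R -> R) :
  (forall i, i \in s -> Der (f i) (df i)) ->
  Der (fun x => \sum_(i <- s) f i x) (fun x => \sum_(i <- s) df i x).
Proof.
move=> fd.
have h : Der (fun x => \sum_(i <- s) (if i \in s then f i x else 0))
             (fun x => \sum_(i <- s) (if i \in s then df i x else 0)).
  apply: (@Der_sum _ s (fun i x => if i \in s then f i x else 0)
                       (fun i x => if i \in s then df i x else 0)) => i.
  by case is_: (i \in s); [exact: fd|exact: Der_cst].
rewrite (_ : (fun x => \sum_(i <- s) f i x)
  = (fun x => \sum_(i <- s) (if i \in s then f i x else 0))); last first.
  by rewrite funeqE => x; apply: eq_big_seq => i ->.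
apply: (Der_ext h) => x _.
by apply: eq_big_seq => i ->.
Qed.

Lemma Der_cI f df : Der f df -> cI f.
Proof.
move=> fd x xI; apply/differentiable_continuous/derivable1_diffP.
by case: (fd x xI).
Qed.

Lemma cI_cst (c : R) : cI (fun=> c).
Proof. by move=> x _; exact: cst_continuous. Qed.
Arguments cI_cst c : clear implicits.

Lemma cID f g : cI f -> cI g -> cI (fun x => f x + g x).
Proof. by move=> fc gc x xI; apply: continuousD; [exact: fc|exact: gc]. Qed.

Lemma cIN f : cI f -> cI (fun x => - f x).
Proof. by move=> fc x xI; apply: continuousN; exact: fc. Qed.

Lemma cIB f g : cI f -> cI g -> cI (fun x => f x - g x).
Proof. by move=> fc gc; apply: cID => //; exact: cIN. Qed.

Lemma cIM f g : cI f -> cI g -> cI (fun x => f x * g x).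
Proof. by move=> fc gc x xI; apply: continuousM; [exact: fc|exact: gc]. Qed.

Lemma cIZ (c : R) f : cI f -> cI (fun x => c * f x).
Proof. by move=> fc; have := cIM (cI_cst c) fc. Qed.
Arguments cIZ c [f].

Lemma cIX f n : cI f -> cI (fun x => f x ^+ n).
Proof.
move=> fc; elim: n => [|n IH]; first exact: cI_cst.
rewrite (_ : (fun x => _) = (fun x => f x * f x ^+ n)); first exact: cIM.
by rewrite funeqE => x; rewrite exprS.
Qed.

Lemma cIV f : (forall x, inI x -> f x != 0) -> cI f -> cI (fun x => (f x)^-1).
Proof. by move=> f0 fc x xI; apply: continuousV; [exact: f0|exact: fc]. Qed.

Lemma cI_comp f g : cI f -> cI g -> (forall x, inI x -> inI (g x)) ->
  cI (fun x => f (g x)).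
Proof.
by move=> fc gc gI x xI; apply: continuous_comp; [exact: gc|exact/fc/gI].
Qed.

Lemma cI_compT f g : continuous f -> cI g -> cI (fun x => f (g x)).
Proof. by move=> fc gc x xI; apply: continuous_comp; [exact: gc|exact/fc]. Qed.

Lemma cI_exp f : cI f -> cI (fun x => expR (f x)).
Proof. exact/cI_compT/continuous_expR. Qed.

Lemma cI_cos f : cI f -> cI (fun x => cos (f x)).
Proof. exact/cI_compT/continuous_cos. Qed.

Lemma cI_sin f : cI f -> cI (fun x => sin (f x)).
Proof. exact/cI_compT/continuous_sin. Qed.

Lemma cI_sum_in (T : eqType) (s : seq T) (f : T -> R -> R) :
  (forall i, i \in s -> cI (f i)) -> cI (fun x => \sum_(i <- s) f i x).
Proof.
elim: s => [|i s IH] fc.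
  rewrite (_ : (fun x => _) = fun=> 0); first exact: cI_cst.
  by rewrite funeqE => x; rewrite big_nil.
rewrite (_ : (fun x => _) = (fun x => f i x + \sum_(j <- s) f j x)).
  apply: cID; first by apply: fc; rewrite inE eqxx.
  by apply: IH => j js; apply: fc; rewrite inE js orbT.
by rewrite funeqE => x; rewrite big_cons.
Qed.

Lemma cI_within f x y : cI f -> inI x -> inI y -> {within `[x, y], continuous f}.
Proof.
move=> fc /andP[x0 x1] /andP[y0 y1]; apply: continuous_in_subspaceT => z.
rewrite inE /= in_itv /= => /andP[xz zy]; apply: fc.
by rewrite /inI (le_trans x0 xz) (le_trans zy y1).
Qed.

Lemma Der_MVT f df x y : Der f df -> inI x -> inI y -> x <= y ->
  exists c, [/\ inI c, x <= c, c <= y & f y - f x = df c * (y - x)].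
Proof.
move=> fd xI yI xy.
have [||c] := @MVT_segment _ f df x y xy.
- move=> z; rewrite in_itv /= => /andP[xz zy]; apply: fd.
  case/andP: xI yI => x0 x1 /andP[y0 y1].
  by rewrite /inI (le_trans x0 (ltW xz)) (le_trans (ltW zy) y1).
- exact: cI_within (Der_cI fd) xI yI.
rewrite in_itv /= => /andP[xc cy] e; exists c; split => //.
case/andP: xI yI => x0 x1 /andP[y0 y1].
by rewrite /inI (le_trans x0 xc) (le_trans cy y1).
Qed.

Lemma Der_nondecreasing f df x y : Der f df -> (forall z, inI z -> 0 <= df z) ->
  inI x -> inI y -> x <= y -> f x <= f y.
Proof.
move=> fd d0 xI yI xy; have [c [cI' _ _ e]] := Der_MVT fd xI yI xy.
by rewrite -subr_ge0 e mulr_ge0 ?d0 ?subr_ge0.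
Qed.

Lemma Der_lipschitz f df (B x y : R) : Der f df -> (forall z, inI z -> `|df z| <= B) ->
  inI x -> inI y -> `|f x - f y| <= B * `|x - y|.
Proof.
move=> fd dB; wlog xy : x y / x <= y => [wl xI yI|xI yI].
  have [xy|/ltW yx] := leP x y; first exact: wl.
  by rewrite distrC [`|x - y|]distrC; exact: wl.
have [c [cI' _ _ e]] := Der_MVT fd xI yI xy.
by rewrite distrC e normrM [`|x - y|]distrC ler_wpM2r ?dB.
Qed.

Lemma cI_bounded f : cI f -> exists2 B, 0 < B & forall x, inI x -> `|f x| <= B.
Proof.
move=> fc; have nc : cI (fun x => `|f x|).
  by apply: cI_compT fc => y; exact: norm_continuous.
have [c _ H] := EVT_max ler01 (cI_within nc inI0 inI1).
exists (`|f c| + 1) => [|x xI]; first by rewrite ltr_wpDl.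
by rewrite ler_wpDr// H// in_itv.
Qed.

Lemma cI_pos_min f : cI f -> (forall x, inI x -> 0 < f x) ->
  exists2 c, 0 < c & forall x, inI x -> c <= f x.
Proof.
move=> fc f0; have [|B B0 HB] := cI_bounded (cIV _ fc).
  by move=> x xI; rewrite gt_eqF ?f0.
exists B^-1 => [|x xI]; first by rewrite invr_gt0.
have := HB x xI; rewrite normfV gtr0_norm ?f0// => h.
by rewrite -[f x]invrK lef_pV2 ?posrE ?invr_gt0 ?f0.
Qed.

(* The nearest point of [0, 1]. *)
Definition clamp (x : R) : R := (`|x| - `|x - 1| + 1) / 2.

Lemma clampI x : inI (clamp x).
Proof.
by apply/inIP; rewrite /clamp; split; case: (ger0P x); case: (ger0P (x - 1)); lra.
Qed.

Lemma clamp_id x : inI x -> clamp x = x.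
Proof.
case/inIP => x0 x1; rewrite /clamp ger0_norm// ler0_norm ?subr_le0//; lra.
Qed.

Lemma continuous_clamp : continuous clamp.
Proof.
move=> x; apply: cvgMl; apply: cvgD; last exact: cvg_cst.
apply: cvgB; first exact: norm_continuous.
by apply: cvg_norm; apply: cvgB; [exact: cvg_id|exact: cvg_cst].
Qed.

Lemma Der_primitive f : cI f -> exists F, Der F f.
Proof.
move=> fc; pose g x := f (clamp x).
have gc : continuous g.
  move=> x; apply: continuous_comp; first exact: continuous_clamp.
  by apply: fc; exact: clampI.
(* The base point -1 and the right end 2 put every point of I in the interior of the interval of
   integration, where the fundamental theorem gives a two-sided derivative. *)
exists (fun x => (\int[lebesgue_measure]_(t in [set` `[-1, x]]) (g t))%R) => x xI.
have [||||d e] := @continuous_FTC1_closed _ g (-1) x 2.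
- by case/andP: xI => _ /le_lt_trans; apply; rewrite ltr1n.
- apply: continuous_compact_integrable; first exact: segment_compact.
  exact: continuous_subspaceT.
- by case/andP: xI => x0 _; apply: lt_le_trans x0; rewrite ltrN10.
- exact: gc.
by split=> //; rewrite -derive1E e /g clamp_id.
Qed.

Definition prim f : R -> R := xget (fun=> 0) [set F | Der F f].

Lemma Der_prim f : cI f -> Der (prim f) f.
Proof. by move=> /Der_primitive h; exact: (xgetPex (fun=> 0) h). Qed.

(** The integral over I. By [itg_prim] the choice made in [prim] does not matter, and linearity and
    monotonicity are read off from primitives. *)
Definition itg f : R := prim f 1 - prim f 0.

Lemma itg_prim f F : Der F f -> cI f -> itg f = F 1 - F 0.
Proof.
move=> hF fc; have hd := DerB (Der_prim fc) hF.
have /(_ 1 0) := @Der_lipschitz _ _ 0 _ _ hd.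
rewrite mul0r inI0 inI1 => /(_ _ isT isT) h.
have /h : forall z, inI z -> `|f z - f z| <= 0 by move=> z _; rewrite subrr normr0.
rewrite normr_le0 subr_eq0 => /eqP e.
by rewrite /itg; lra.
Qed.

Lemma itg_le f g : cI f -> cI g -> (forall x, inI x -> f x <= g x) -> itg f <= itg g.
Proof.
move=> fc gc fg.
have := Der_nondecreasing (DerB (Der_prim gc) (Der_prim fc)) _ inI0 inI1 ler01.
have h z : inI z -> 0 <= g z - f z by move=> zI; rewrite subr_ge0 fg.
by move=> /(_ h); rewrite /itg; lra.
Qed.

Lemma itgD f g : cI f -> cI g -> itg (fun x => f x + g x) = itg f + itg g.
Proof.
move=> fc gc; rewrite (itg_prim (DerD (Der_prim fc) (Der_prim gc)) (cID fc gc)).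
by rewrite /itg; ring.
Qed.

Lemma itgZ (c : R) f : cI f -> itg (fun x => c * f x) = c * itg f.
Proof.
move=> fc; rewrite (itg_prim (DerZ c (Der_prim fc)) (cIZ c fc)) /itg; ring.
Qed.

Lemma itg_cst (c : R) : itg (fun=> c) = c.
Proof.
have h : Der (fun x => c * x) (fun=> c).
  by apply: (Der_ext (DerZ c Der_id)) => x _; rewrite mulr1.
by rewrite (itg_prim h (cI_cst c)) mulr1 mulr0 subr0.
Qed.

Lemma itg_ge0 f : cI f -> (forall x, inI x -> 0 <= f x) -> 0 <= itg f.
Proof.
move=> fc f0; have := itg_le (cI_cst 0) fc f0.
by rewrite itg_cst.
Qed.

Lemma itg_mean f : cI f -> exists2 c, inI c & f c = itg f.
Proof.
move=> fc; have [c [cI' _ _]] := Der_MVT (Der_prim fc) inI0 inI1 ler01.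
by rewrite subr0 mulr1 => e; exists c.
Qed.

Lemma itg_le_lin2 f g1 g2 (a b : R) : cI f -> cI g1 -> cI g2 ->
  (forall x, inI x -> f x <= a * g1 x + b * g2 x) ->
  itg f <= a * itg g1 + b * itg g2.
Proof.
move=> fc c1 c2 H; have c1' := cIZ a c1; have c2' := cIZ b c2.
rewrite -!itgZ// -itgD//; apply: itg_le => //; exact: cID.
Qed.

Lemma itg_le_lin f g (a : R) : cI f -> cI g ->
  (forall x, inI x -> f x <= a * g x) -> itg f <= a * itg g.
Proof.
move=> fc c1 H; rewrite -itgZ//; apply: itg_le => //; exact: cIZ.
Qed.

End unit_interval_calculus.

Arguments cI_cst {R} c.
Arguments cIZ {R} c [f].

(** * Complex-valued functions and oscillating phases *)

Section complex_calculus.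
Variable R : realType.
Implicit Types (f g df dg F G : R -> R) (x y : R) (z w : R[i]) (v dv u du : R -> R[i]).

Notation Re := complex.Re.
Notation Im := complex.Im.

(** The squared modulus: a polynomial in the real and imaginary parts, hence differentiable along
    with them. *)
Definition csq z : R := Re z ^+ 2 + Im z ^+ 2.

Lemma csq_ge0 z : 0 <= csq z.
Proof. by rewrite /csq addr_ge0 ?sqr_ge0. Qed.

Lemma csqM z w : csq (z * w) = csq z * csq w.
Proof. by case: z w => [a b] [c d]; rewrite /csq /=; ring. Qed.

Lemma csqN z : csq (- z) = csq z.
Proof. by case: z => [a b]; rewrite /csq /= !sqrrN. Qed.

Lemma csq_real (c : R) : csq c%:C = c ^+ 2.
Proof. by rewrite /csq /= expr0n addr0. Qed.

Lemma csqD_le z w : csq (z + w) <= 2 * csq z + 2 * csq w.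
Proof.
case: z w => [a b] [c d]; rewrite /csq /=.
have := sqr_ge0 (a - c); have := sqr_ge0 (b - d); rewrite !expr2; lra.
Qed.

Lemma csqD4_le z1 z2 z3 z4 :
  csq (z1 + z2 + z3 + z4) <= 4 * (csq z1 + csq z2 + csq z3 + csq z4).
Proof.
have := csqD_le (z1 + z2) (z3 + z4); rewrite addrA.
have := csqD_le z1 z2; have := csqD_le z3 z4; lra.
Qed.

Lemma normc_csq z : normc z ^+ 2 = csq z.
Proof. by case: z => [a b]; rewrite /normc sqr_sqrtr // addr_ge0 ?sqr_ge0. Qed.

Lemma normc_ge0' z : 0 <= normc z.
Proof. by case: z => [a b]; rewrite /normc sqrtr_ge0. Qed.

Lemma normc_le z (c : R) : 0 <= c -> (normc z <= c) = (csq z <= c ^+ 2).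
Proof. by move=> c0; rewrite -normc_csq ler_pXn2r// nnegrE normc_ge0'. Qed.

Definition cis (t : R) : R[i] := cos t +i* sin t.

Lemma csq_cis (t : R) : csq (cis t) = 1.
Proof. exact: cos2Dsin2. Qed.

Lemma cisD (a b : R) : cis (a + b) = cis a * cis b.
Proof. by rewrite /cis cosD sinD; simpc; congr (_ +i* _); ring. Qed.

Lemma expcE z : expc z = (expR (Re z))%:C * cis (Im z).
Proof. by []. Qed.

Lemma expcD z w : expc (z + w) = expc z * expc w.
Proof.
case: z w => [a b] [c d]; rewrite !expcE /= expRD cisD rmorphM /=; ring.
Qed.

Lemma csq_expc z : csq (expc z) = expR (Re z) ^+ 2.
Proof. by rewrite expcE csqM csq_real csq_cis mulr1. Qed.

Lemma sin_ge_half (x : R) : 0 <= x -> x <= 1 -> x / 2 <= sin x.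
Proof.
have sin_le y : 0 <= y -> `|sin y| <= y.
  move=> y0; have [|z _] := @MVT_segment _ (@sin R) (@cos R) 0 y y0.
    by apply: continuous_subspaceT; exact: continuous_sin.
  rewrite sin0 !subr0 => ->; rewrite normrM (ger0_norm y0) -[leRHS]mul1r.
  by rewrite ler_wpM2r// ler_norml cos_geN1 cos_le1.
have cosE y : cos (y : R) = 1 - 2 * sin (y / 2) ^+ 2.
  have {1}-> : y = y / 2 + y / 2 by field.
  rewrite cosD; have := cos2Dsin2 (y / 2); rewrite !expr2; lra.
have cos_ge y : 0 <= y -> y <= 1 -> 1 / 2 <= cos y.
  move=> y0 y1; rewrite cosE; have := @sin_le (y / 2); set s := sin _.
  move=> /(_ ltac:(lra)); rewrite ler_norml => /andP[s1 s2]; nra.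
move=> x0 x1; have [|z zi] := @MVT_segment _ (@sin R) (@cos R) 0 x x0.
  by apply: continuous_subspaceT; exact: continuous_sin.
rewrite sin0 !subr0 => ->.
move: zi; rewrite in_itv /= => /andP[z0 z1].
have := @cos_ge z z0 ltac:(lra); nra.
Qed.

(** By [csq_cisB], 2 - 2 cos u is the squared distance from [cis u] to 1. It equals 4 sin(u/2)^2,
    and sin y >= y/2 on [0, 1]. *)
Lemma cos_gap (u : R) : `|u| <= 1 -> u ^+ 2 / 4 <= 2 - 2 * cos u.
Proof.
have key : forall y : R, 0 <= y -> y <= 1 -> y ^+ 2 / 4 <= 2 - 2 * cos y.
  move=> y y0 y1; have -> : cos y = 1 - 2 * sin (y / 2) ^+ 2.
    have {1}-> : y = y / 2 + y / 2 by field.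
    rewrite cosD; have := cos2Dsin2 (y / 2); rewrite !expr2; lra.
  have := @sin_ge_half (y / 2); set s := sin _.
  move=> /(_ ltac:(lra) ltac:(lra)); nra.
have [u0|u0] := ger0P u; first exact: key.
by move=> u1; have := key (- u); rewrite cosN sqrrN; apply=> //; lra.
Qed.

Lemma csq_cisB (s t : R) z :
  csq (cis s * z - cis t * z) = (2 - 2 * cos (s - t)) * csq z.
Proof.
rewrite -mulrBl csqM; congr (_ * _); rewrite /csq /cis /= cosB.
have := cos2Dsin2 s; have := cos2Dsin2 t; rewrite !expr2; nra.
Qed.

Definition DerC v dv := Der (fun x => Re (v x)) (fun x => Re (dv x)) /\
  Der (fun x => Im (v x)) (fun x => Im (dv x)).
Definition cIC v := cI (fun x => Re (v x)) /\ cI (fun x => Im (v x)).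

Lemma DerC_ext v dv du : DerC v dv -> (forall x, inI x -> dv x = du x) -> DerC v du.
Proof. by move=> [h1 h2] e; split; [apply: Der_ext h1 _|apply: Der_ext h2 _] => x /e ->. Qed.

Lemma DerC_cIC v dv : DerC v dv -> cIC v.
Proof. by move=> [/Der_cI h1 /Der_cI h2]. Qed.

Lemma cReD z w : Re (z + w) = Re z + Re w. Proof. by case: z w => [? ?] [? ?]. Qed.
Lemma cImD z w : Im (z + w) = Im z + Im w. Proof. by case: z w => [? ?] [? ?]. Qed.
Lemma cReN z : Re (- z) = - Re z. Proof. by case: z. Qed.
Lemma cImN z : Im (- z) = - Im z. Proof. by case: z. Qed.
Lemma cReM z w : Re (z * w) = Re z * Re w - Im z * Im w.
Proof. by case: z w => [? ?] [? ?]. Qed.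
Lemma cImM z w : Im (z * w) = Re z * Im w + Im z * Re w.
Proof. by case: z w => [? ?] [? ?]. Qed.

Lemma DerCD v u dv du : DerC v dv -> DerC u du ->
  DerC (fun x => v x + u x) (fun x => dv x + du x).
Proof.
move=> [h1 h2] [h3 h4]; split.
  under eq_fun do rewrite cReD.
  by apply: (Der_ext (DerD h1 h3)) => x _; rewrite cReD.
under eq_fun do rewrite cImD.
by apply: (Der_ext (DerD h2 h4)) => x _; rewrite cImD.
Qed.

Lemma DerCM v u dv du : DerC v dv -> DerC u du ->
  DerC (fun x => v x * u x) (fun x => dv x * u x + v x * du x).
Proof.
move=> [h1 h2] [h3 h4]; split.
  under eq_fun do rewrite cReM.
  apply: (Der_ext (DerB (DerM h1 h3) (DerM h2 h4))) => x _.
  by rewrite cReD !cReM; ring.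
under eq_fun do rewrite cImM.
apply: (Der_ext (DerD (DerM h1 h4) (DerM h2 h3))) => x _.
by rewrite cImD !cImM; ring.
Qed.

Lemma DerC_real f df : Der f df -> DerC (fun x => (f x)%:C) (fun x => (df x)%:C).
Proof. by move=> h; split=> //=; exact: Der_cst. Qed.

Lemma DerC_comp v dv g dg : DerC v dv -> Der g dg -> (forall x, inI x -> inI (g x)) ->
  DerC (fun x => v (g x)) (fun x => (dg x)%:C * dv (g x)).
Proof.
move=> [h1 h2] gd gI; split.
  by apply: (Der_ext (Der_comp h1 gd gI)) => x _; rewrite cReM /=; ring.
by apply: (Der_ext (Der_comp h2 gd gI)) => x _; rewrite cImM /=; ring.
Qed.

Lemma DerC_expc v dv : DerC v dv ->
  DerC (fun x => expc (v x)) (fun x => expc (v x) * dv x).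
Proof.
move=> [h1 h2]; split.
  under eq_fun do rewrite expcE cReM /= mul0r subr0.
  apply: (Der_ext (DerM (Der_exp h1) (Der_cos h2))) => x _.
  by rewrite expcE !cReM cImM /=; ring.
under eq_fun do rewrite expcE cImM /= mul0r addr0.
apply: (Der_ext (DerM (Der_exp h1) (Der_sin h2))) => x _.
by rewrite expcE !cImM cReM /=; ring.
Qed.

Lemma DerC_sum_in (T : eqType) (s : seq T) (f df : T -> R -> R[i]) :
  (forall i, i \in s -> DerC (f i) (df i)) ->
  DerC (fun x => \sum_(i <- s) f i x) (fun x => \sum_(i <- s) df i x).
Proof.
have rs (h : T -> R[i]) : Re (\sum_(i <- s) h i) = \sum_(i <- s) Re (h i).
  by elim: (s) => [|i s' IH]; rewrite ?big_nil// !big_cons cReD IH.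
have is_ (h : T -> R[i]) : Im (\sum_(i <- s) h i) = \sum_(i <- s) Im (h i).
  by elim: (s) => [|i s' IH]; rewrite ?big_nil// !big_cons cImD IH.
move=> fd; split.
  under eq_fun do rewrite rs.
  apply: (@Der_ext _ _ (fun x => \sum_(i <- s) Re (df i x))) => [|x _]; last by rewrite rs.
  by apply: Der_sum_in => i /fd[].
under eq_fun do rewrite is_.
apply: (@Der_ext _ _ (fun x => \sum_(i <- s) Im (df i x))) => [|x _]; last by rewrite is_.
by apply: Der_sum_in => i /fd[].
Qed.

Lemma cICD v u : cIC v -> cIC u -> cIC (fun x => v x + u x).
Proof.
by move=> [h1 h2] [h3 h4]; split; (under eq_fun do rewrite (cReD, cImD)); exact: cID.
Qed.

Lemma cICM v u : cIC v -> cIC u -> cIC (fun x => v x * u x).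
Proof.
move=> [h1 h2] [h3 h4]; split; (under eq_fun do rewrite (cReM, cImM)).
  by apply: cIB; exact: cIM.
by apply: cID; exact: cIM.
Qed.

Lemma cICN v : cIC v -> cIC (fun x => - v x).
Proof. by move=> [h1 h2]; split; (under eq_fun do rewrite (cReN, cImN)); exact: cIN. Qed.

Lemma cIC_real f : cI f -> cIC (fun x => (f x)%:C).
Proof. by move=> h; split => //=; exact: cI_cst. Qed.

Lemma cIC_comp v g : cIC v -> cI g -> (forall x, inI x -> inI (g x)) ->
  cIC (fun x => v (g x)).
Proof.
move=> [h1 h2] gc gI; split.
  exact: (cI_comp h1 gc gI).
exact: (cI_comp h2 gc gI).
Qed.

Lemma cIC_cis f : cI f -> cIC (fun x => cis (f x)).
Proof. by move=> h; split => /=; [exact: cI_cos|exact: cI_sin]. Qed.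

Lemma cIC_expc v : cIC v -> cIC (fun x => expc (v x)).
Proof.
move=> [h1 h2]; apply: (@cICM (fun x => (expR (Re (v x)))%:C) (fun x => cis (Im (v x)))).
  exact/cIC_real/cI_exp.
exact: cIC_cis.
Qed.

Lemma cIC_sum_in (T : eqType) (s : seq T) (f : T -> R -> R[i]) :
  (forall i, i \in s -> cIC (f i)) -> cIC (fun x => \sum_(i <- s) f i x).
Proof.
elim: s => [|i s IH] fc.
  by under eq_fun do rewrite big_nil; split; exact: cI_cst.
under eq_fun do rewrite big_cons.
apply: cICD; first by apply: fc; rewrite inE eqxx.
by apply: IH => j js; apply: fc; rewrite inE js orbT.
Qed.

Lemma cI_csq v : cIC v -> cI (fun x => csq (v x)).
Proof. by move=> [h1 h2]; apply: cID; exact: cIX. Qed.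

(** Only the derivative on [p, q] is required: a shifted function [f (x + s)] is under control only
    while [x + s] stays in I, so [Der_nondecreasing] does not apply to it. *)
Lemma nondecreasing_segment (H dH : R -> R) (p q : R) : p <= q ->
  (forall x, p <= x -> x <= q -> is_derive x 1 H (dH x)) ->
  (forall x, p <= x -> x <= q -> 0 <= dH x) -> H p <= H q.
Proof.
move=> pq Hd d0; have [||c] := @MVT_segment _ H dH p q pq.
- by move=> z; rewrite in_itv /= => /andP[pz zq]; apply: Hd; exact: ltW.
- apply: continuous_in_subspaceT => z; rewrite inE /= in_itv /= => /andP[pz zq].
  by apply/differentiable_continuous/derivable1_diffP; case: (Hd z pz zq).
rewrite in_itv /= => /andP[pc cq] e.
by rewrite -subr_ge0 e mulr_ge0 ?d0 ?subr_ge0.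
Qed.

(* Cauchy-Schwarz: the integral over [x, y] of |dv - (v y - v x) / (y - x)|^2
   is nonnegative. *)
Lemma csq_increment v dv G x y : DerC v dv -> Der G (fun x => csq (dv x)) ->
  inI x -> inI y -> csq (v y - v x) <= (y - x) * (G y - G x).
Proof.
move=> vd Gd; wlog xy : x y / x <= y => [wl xI yI|xI yI].
  have [xy|/ltW yx] := leP x y; first exact: wl.
  by rewrite -csqN opprB; apply: le_trans (wl _ _ yx yI xI) _; rewrite -mulrNN !opprB.
have [->|nxy] := eqVneq x y; first by rewrite !subrr mul0r /csq /= expr0n addr0.
have d0 : 0 < y - x by rewrite subr_gt0 lt_neqAle nxy.
set d := y - x in d0 *; set z := v y - v x.
have [v1 v2] := vd.
pose a := Re z / d; pose b := Im z / d.
pose H (s : R) := G s - 2 * a * Re (v s) - 2 * b * Im (v s) + (a ^+ 2 + b ^+ 2) * s.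
have Hd := DerD (DerB (DerB Gd (DerZ (2 * a) v1)) (DerZ (2 * b) v2))
  (DerZ (a ^+ 2 + b ^+ 2) (@Der_id R)).
have : H x <= H y.
  apply: (Der_nondecreasing Hd) => // s sI; rewrite /csq.
  by have := sqr_ge0 (Re (dv s) - a); have := sqr_ge0 (Im (dv s) - b); rewrite !expr2; lra.
have e1 : Re (v y) - Re (v x) = a * d.
  by rewrite /a divfK ?gt_eqF// /z cReD cReN.
have e2 : Im (v y) - Im (v x) = b * d.
  by rewrite /b divfK ?gt_eqF// /z cImD cImN.
have -> : csq z = (a * d) ^+ 2 + (b * d) ^+ 2.
  by rewrite /csq -e1 -e2 /z cReD cImD cReN cImN.
rewrite /H => {Hd} h; clear H; clearbody a b; rewrite !exprMn -mulrDl expr2 mulrA mulrC ler_pM2l//.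
have : (a ^+ 2 + b ^+ 2) * d = (a ^+ 2 + b ^+ 2) * y - (a ^+ 2 + b ^+ 2) * x.
  by rewrite /d; ring.
move: h e1 e2; rewrite !expr2 => h e1 e2.
have : 2 * a * Re (v y) - 2 * a * Re (v x) = 2 * (a * a * d).
  by rewrite -mulrBr e1; ring.
have : 2 * b * Im (v y) - 2 * b * Im (v x) = 2 * (b * b * d).
  by rewrite -mulrBr e2; ring.
rewrite mulrDl; lra.
Qed.

Lemma Der_MVT_any f df x y : Der f df -> inI x -> inI y ->
  exists2 c, inI c & f y - f x = df c * (y - x).
Proof.
move=> fd xI yI; have [xy|/ltW yx] := leP x y.
  by have [c [? _ _ ?]] := Der_MVT fd xI yI xy; exists c.
have [c [? _ _ e]] := Der_MVT fd yI xI yx; exists c => //.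
by rewrite -opprB e -mulrN opprB.
Qed.

Lemma prim_increment f x y : cI f -> (forall s, inI s -> 0 <= f s) ->
  inI x -> inI y -> prim f y - prim f x <= itg f.
Proof.
move=> fc f0 xI yI; rewrite /itg; apply: lerB.
  by apply: (Der_nondecreasing (Der_prim fc)) => //; [exact: inI1|case/andP: yI].
by apply: (Der_nondecreasing (Der_prim fc)) => //; [exact: inI0|case/andP: xI].
Qed.

(** By the mean value theorem each increment of [prim (prim f)] is s times a value of [prim f], and
    two such values differ by at most [itg f]. The left side is the integral, for u from x to y, of
    s times the increment of [prim f] between u and u + s. *)
Lemma second_increment f x y (s : R) : cI f -> (forall s, inI s -> 0 <= f s) ->
  inI x -> inI y -> inI (x + s) -> inI (y + s) ->
  s * ((prim (prim f) (y + s) - prim (prim f) y)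
     - (prim (prim f) (x + s) - prim (prim f) x)) <= s ^+ 2 * itg f.
Proof.
move=> fc f0 xI yI xsI ysI.
have hd := Der_prim (Der_cI (Der_prim fc)).
have [c cI1 ->] := Der_MVT_any hd yI ysI.
have [d dI ->] := Der_MVT_any hd xI xsI.
rewrite [y + s]addrC addrK [x + s]addrC addrK -mulrBl mulrCA mulrC -expr2.
by rewrite ler_wpM2l ?sqr_ge0// prim_increment.
Qed.

Lemma is_derive_shifted f df x (s : R) : is_derive (x + s) 1 f (df (x + s)) ->
  is_derive x 1 (fun y => f (y + s)) (df (x + s)).
Proof.
move=> h; have hs : is_derive x 1 (fun y : R => y + s) 1.
  by have := is_deriveD (is_derive_id x 1) (is_derive_cst s x 1); rewrite addr0.
by have := @is_derive1_comp R f (fun y => y + s) x _ _ h hs; rewrite mulr1.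
Qed.

Section oscillation.
Variables (a da b db : R -> R[i]) (th dth : R -> R) (D B : R).
Hypotheses (ad : DerC a da) (bd : DerC b db) (dac : cIC da) (dbc : cIC db).
Hypotheses (thd : Der th dth) (D0 : 0 < D).
Hypothesis dthB : forall x, inI x -> D <= `|dth x| <= B.

Let F x := a x - cis (th x) * b x.

Let Fc : cIC F.
Proof.
apply: cICD; first exact: DerC_cIC ad.
by apply: cICN; apply: cICM; [exact: cIC_cis (Der_cI thd)|exact: DerC_cIC bd].
Qed.

(* The phase moves by an amount of order D |s| between x and x + s, so a and
   cis th * b cannot be close at both points unless b is small or one of a, b
   varies. *)
Let osc_pointwise x (s : R) : B * `|s| <= 1 -> inI x -> inI (x + s) ->
  (D * s) ^+ 2 / 4 * csq (b x) <=
  4 * (csq (F x) + csq (F (x + s)) + csq (a (x + s) - a x) + csq (b (x + s) - b x)).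
Proof.
move=> Bs xI xsI.
set y := x + s; have [c cI' e] := Der_MVT_any thd xI xsI.
have {}e : th y - th x = dth c * s by rewrite e [x + s]addrC addrK.
have /andP[d1 d2] := dthB cI'.
have u1 : `|th y - th x| <= 1.
  by rewrite e normrM (le_trans _ Bs)// ler_wpM2r.
have u2 : (D * s) ^+ 2 <= (th y - th x) ^+ 2.
  rewrite e !exprMn ler_wpM2r ?sqr_ge0// -[leRHS]real_normK ?num_real//.
  by rewrite ler_pXn2r// nnegrE ltW// (lt_le_trans D0).
have h1 : (D * s) ^+ 2 / 4 * csq (b x) <= csq (cis (th y) * b x - cis (th x) * b x).
  rewrite csq_cisB ler_wpM2r ?csq_ge0//.
  by apply: le_trans (cos_gap u1); lra.
apply: le_trans h1 _.
have -> : cis (th y) * b x - cis (th x) * b x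
  = F x + (- F y) + (a y - a x) + (- (cis (th y) * (b y - b x))).
  by rewrite /F; ring.
apply: le_trans (csqD4_le _ _ _ _) _.
by rewrite !csqN csqM csq_cis mul1r.
Qed.

(** Integration of [osc_pointwise] over [p, q], carried out on primitives: once the increments of a
    and b are bounded by [csq_increment], the difference of the two sides is the derivative of [H],
    and the monotonicity of [H] is the integrated inequality. *)
Let osc_half p q (s : R) : B * `|s| <= 1 -> p <= q -> inI p -> inI q ->
  inI (p + s) -> inI (q + s) ->
  (D * s) ^+ 2 / 4 * (prim (fun x => csq (b x)) q - prim (fun x => csq (b x)) p) <=
  8 * itg (fun x => csq (F x))
  + 4 * s ^+ 2 * (itg (fun x => csq (da x)) + itg (fun x => csq (db x))).
Proof.
move=> Bs pq pI qI psI qsI.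
set f := fun x => csq (F x); set fb := fun x => csq (b x).
set fa := fun x => csq (da x); set fb' := fun x => csq (db x).
have fc : cI f by exact: cI_csq.
have fbc : cI fb by apply/cI_csq/(DerC_cIC bd).
have fac : cI fa by exact: cI_csq.
have fbc' : cI fb' by exact: cI_csq.
pose H x := 4 * (prim f x + prim f (x + s)
  + s * (prim (prim fa) (x + s) - prim (prim fa) x)
  + s * (prim (prim fb') (x + s) - prim (prim fb') x))
  - (D * s) ^+ 2 / 4 * prim fb x.
pose dH x := 4 * (f x + f (x + s)
  + s * (prim fa (x + s) - prim fa x) + s * (prim fb' (x + s) - prim fb' x))
  - (D * s) ^+ 2 / 4 * fb x.
have inI_pq x : p <= x -> x <= q -> inI x.
  by case/inIP: pI => ? ?; case/inIP: qI => ? ?; move=> *; apply/inIP; lra.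
have inI_pqs x : p <= x -> x <= q -> inI (x + s).
  by case/inIP: psI => ? ?; case/inIP: qsI => ? ?; move=> *; apply/inIP; lra.
have shiftd g dg x : Der g dg -> p <= x -> x <= q ->
    is_derive x 1 (fun y => g (y + s)) (dg (x + s)).
  by move=> gd px xq; apply: is_derive_shifted; apply: gd; exact: inI_pqs.
have scaled (c : R) (g : R -> R) (d x : R) : is_derive x 1 g d ->
    is_derive x 1 (fun y => c * g y) (c * d).
  by move=> h; have := is_deriveZ c h.
have dd g : cI g -> forall x, p <= x -> x <= q ->
    is_derive x 1 (fun y => s * (prim (prim g) (y + s) - prim (prim g) y))
      (s * (prim g (x + s) - prim g x)).
  move=> gc x px xq; apply: scaled; apply: is_deriveB.
    exact: shiftd (Der_prim (Der_cI (Der_prim gc))) px xq.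
  exact: (Der_prim (Der_cI (Der_prim gc)) (inI_pq _ px xq)).
have Hd x : p <= x -> x <= q -> is_derive x 1 H (dH x).
  move=> px xq; apply: is_deriveB; last exact/scaled/(Der_prim fbc (inI_pq _ px xq)).
  apply: scaled; apply: is_deriveD; last exact: dd.
  apply: is_deriveD; last exact: dd.
  by apply: is_deriveD; [exact: (Der_prim fc (inI_pq _ px xq))|exact: shiftd (Der_prim fc) px xq].
have H0 : H p <= H q.
  apply: (nondecreasing_segment pq Hd) => x px xq.
  have := osc_pointwise Bs (inI_pq _ px xq) (inI_pqs _ px xq).
  have := csq_increment ad (Der_prim fac) (inI_pq _ px xq) (inI_pqs _ px xq).
  have := csq_increment bd (Der_prim fbc') (inI_pq _ px xq) (inI_pqs _ px xq).
  have -> : x + s - x = s by ring.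
  by rewrite /dH /f /fb; lra.
have f0 x : inI x -> 0 <= f x by rewrite csq_ge0.
have := prim_increment fc f0 pI qI; have := prim_increment fc f0 psI qsI.
have := second_increment fac (fun x _ => csq_ge0 (da x)) pI qI psI qsI.
have := second_increment fbc' (fun x _ => csq_ge0 (db x)) pI qI psI qsI.
move: H0; rewrite /H; lra.
Qed.

Lemma oscillation_bound (tau : R) : 0 < tau -> tau <= 1 / 2 -> B * tau <= 1 ->
  (D * tau) ^+ 2 / 4 * itg (fun x => csq (b x)) <=
  16 * itg (fun x => csq (a x - cis (th x) * b x))
  + 8 * tau ^+ 2 * (itg (fun x => csq (da x)) + itg (fun x => csq (db x))).
Proof.
move=> t0 t1 Bt.
(* Shift to the right on the left half of I and to the left on the right half: as tau <= 1/2, the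
   shifted points stay in I. *)
have h1 := @osc_half 0 (1 / 2) tau; have h2 := @osc_half (1 / 2) 1 (- tau).
move: h1 h2; rewrite normrN (gtr0_norm t0) mulrN !sqrrN.
move=> /(_ Bt ltac:(lra) ltac:(apply/inIP; lra) ltac:(apply/inIP; lra)
  ltac:(apply/inIP; lra) ltac:(apply/inIP; lra)) h1.
move=> /(_ Bt ltac:(lra) ltac:(apply/inIP; lra) ltac:(apply/inIP; lra)
  ltac:(apply/inIP; lra) ltac:(apply/inIP; lra)) h2.
rewrite /F in h1 h2; rewrite [X in _ * X <= _]/itg; lra.
Qed.

End oscillation.

End complex_calculus.

(** * Lipschitz bounds and bounded distortion *)

Section log_lipschitz.
Variable R : realType.
Implicit Types (f df : R -> R).

(** If [|df|] exceeded B at x, by continuity it would do so nearby, and the mean value theorem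
    between x and a close point of I would contradict the Lipschitz bound. *)
Lemma Der_lipschitz_conv f df (B : R) : Der f df -> cI df ->
  (forall x y, inI x -> inI y -> `|f x - f y| <= B * `|x - y|) ->
  forall x, inI x -> `|df x| <= B.
Proof.
move=> fd dfc fB x xI; rewrite leNgt; apply/negP => Bx.
have nc : cI (fun x => `|df x|) by apply: cI_compT dfc => y; exact: norm_continuous.
have /nbhs_ballP[e /= e0 He] : \forall z \near x, B < `|df z|.
  by apply: (nc x xI [set z | B < z]); exact: lt_nbhsr.
have [y [yI yx ye]] : exists y, [/\ inI y, y != x & `|y - x| < e].
  pose d := Num.min (e / 2) (1 / 2).
  have d0 : 0 < d by rewrite /d lt_min; apply/andP; split; lra.
  have de : d < e by rewrite /d gt_min; apply/orP; left; lra.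
  have d1 : d <= 1 / 2 by rewrite /d ge_min lexx orbT.
  case/inIP: (xI) => x0 x1; have [xh|xh] := leP x (1 / 2).
    exists (x + d); split; first by apply/inIP; lra.
      by apply/eqP; lra.
    by rewrite [x + d]addrC addrK gtr0_norm.
  exists (x - d); split; first by apply/inIP; lra.
    by apply/eqP; lra.
  by rewrite [x - d]addrC addrK normrN gtr0_norm.
have [c [cI1 cx]] : exists c, [/\ inI c, `|c - x| <= `|y - x| & f y - f x = df c * (y - x)].
  have [xy|/ltW xy] := leP x y.
    have [c [? c1 c2 ?]] := Der_MVT fd xI yI xy; exists c; split => //.
    by rewrite !ger0_norm ?subr_ge0// lerD2r.
  have [c [? c1 c2 e1]] := Der_MVT fd yI xI xy; exists c; split => //.
    by rewrite !ler0_norm ?subr_le0// lerN2 lerD2r.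
  by rewrite -opprB e1 -mulrN opprB.
move=> e1; have := fB y x yI xI; rewrite e1 normrM ler_pM2r ?normr_gt0 ?subr_eq0//.
by rewrite leNgt He// /ball /= distrC (le_lt_trans cx).
Qed.

(** [f x * expR (B * x)] is nondecreasing and [f x * expR (- B * x)] is nonincreasing. No logarithm
    is taken, so f may vanish. This is the distortion principle applied to Jacobians, weights and
    supersolutions. *)
Lemma loglip f df (B : R) : 0 <= B -> Der f df ->
  (forall x, inI x -> 0 <= f x) -> (forall x, inI x -> `|df x| <= B * f x) ->
  forall x y, inI x -> inI y -> f x <= expR B * f y.
Proof.
move=> B0 fd f0 fB x y xI yI.
have fB' z (zI : inI z) : 0 <= df z + B * f z /\ df z - B * f z <= 0.
  by have := fB z zI; rewrite ler_norml => /andP[h1 h2]; split; lra.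
have e1 (d : R) : d <= 1 -> expR (B * d) <= expR B.
  by move=> d1; rewrite ler_expR -[leRHS]mulr1 ler_wpM2l.
case/inIP: (xI) => x0 x1; case/inIP: (yI) => y0 y1.
have [xy|/ltW yx] := leP x y.
  have h := Der_nondecreasing (DerM fd (Der_exp (DerZ B (@Der_id R)))) _ xI yI xy.
  have {}h : f x * expR (B * x) <= f y * expR (B * y).
    apply: h => z zI; have [h1 _] := fB' z zI; have h2 := expR_gt0 (B * z).
    by have := mulr_ge0 h1 (ltW h2); lra.
  have E : expR (B * y) = expR (B * (y - x)) * expR (B * x).
    by rewrite -expRD; congr expR; ring.
  move: h; rewrite E mulrA ler_pM2r ?expR_gt0// => /le_trans; apply.
  by rewrite mulrC ler_wpM2r ?f0// e1//; lra.
have h := Der_nondecreasing (DerN (DerM fd (Der_exp (DerZ (- B) (@Der_id R))))) _ yI xI yx.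
have {}h : - (f y * expR (- B * y)) <= - (f x * expR (- B * x)).
  apply: h => z zI; have [_ h1] := fB' z zI; have h2 := expR_gt0 (- B * z).
  by have := mulr_le0_ge0 h1 (ltW h2); lra.
have E : expR (- B * y) = expR (B * (x - y)) * expR (- B * x).
  by rewrite -expRD; congr expR; ring.
move: h; rewrite lerN2 E mulrA ler_pM2r ?expR_gt0// => /le_trans; apply.
by rewrite mulrC ler_wpM2r ?f0// e1//; lra.
Qed.

End log_lipschitz.

(** * Words of inverse branches *)

Section operators.
Variable R : realType.
Variable h : nat -> R -> R.
Implicit Types (A : seq nat) (w : seq nat) (n : nat) (x : R).

Fixpoint words A n : seq (seq nat) :=
  if n is n'.+1 then [seq i :: w | i <- A, w <- words A n'] else [:: [::]].

(** The head of the word is the branch applied last, as in [branches]; a letter added in front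
    therefore has its weight evaluated at [gw w x]. *)
Fixpoint gw w x : R := if w is i :: w' then h i (gw w' x) else x.

Lemma words_all A (J : pred nat) n w : all J A -> w \in words A n ->
  all J w /\ size w = n.
Proof.
move=> AJ; elim: n w => [|n IH] w /=; first by rewrite inE => /eqP ->.
case/allpairsP => -[i w'] /= [iA w'n ->] /=; have [-> ->] := IH _ w'n.
by rewrite (allP AJ).
Qed.

Lemma words_mem A w : {subset w <= A} -> w \in words A (size w).
Proof.
elim: w => [|i w IH] wA //=; apply/allpairsP; exists (i, w) => /=; split => //.
  by apply: wA; rewrite inE eqxx.
by apply: IH => j jw; apply: wA; rewrite inE jw orbT.
Qed.

Lemma big_words A n (S : nmodType) (F : seq nat -> S) :
  \sum_(w <- words A n.+1) F w = \sum_(w <- words A n) \sum_(i <- A) F (i :: w).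
Proof. by rewrite /= big_allpairs_dep exchange_big. Qed.

Section operator.
Variable S : comNzRingType.
Variable A : seq nat.
Variable wt : nat -> R -> S.

Definition op (v : R -> S) (x : R) : S := \sum_(i <- A) wt i x * v (h i x).

Fixpoint ww w x : S := if w is i :: w' then wt i (gw w' x) * ww w' x else 1.

Lemma iter_opE n v x :
  iter n op v x = \sum_(w <- words A n) ww w x * v (gw w x).
Proof.
elim: n v x => [|n IH] v x; first by rewrite /= big_seq1 /= mul1r.
rewrite iterSr IH big_words; apply: eq_bigr => w _.
rewrite /op big_distrr /=; apply: eq_bigr => i _; ring.
Qed.

End operator.
End operators.

(** * Weighted Cauchy-Schwarz inequalities with a defect *)

Section cauchy_schwarz.
Variables (R : realType) (T : eqType).
Implicit Types (s : seq T) (p a : T -> R) (z : T -> R[i]).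

Let expand s p a (c : R) : \sum_(w <- s) p w * (a w - c) ^+ 2
  = \sum_(w <- s) p w * a w ^+ 2 - 2 * c * \sum_(w <- s) p w * a w
    + c ^+ 2 * \sum_(w <- s) p w.
Proof.
rewrite !mulr_sumr -sumrN -!big_split /=; apply: eq_bigr => w _; ring.
Qed.

Lemma sum_CS s p a : (forall w, w \in s -> 0 <= p w) ->
  (\sum_(w <- s) p w * a w) ^+ 2 <=
  (\sum_(w <- s) p w) * (\sum_(w <- s) p w * a w ^+ 2).
Proof.
elim: s => [|i s IH] p0; first by rewrite !big_nil mulr0 expr0n.
have pi : 0 <= p i by apply: p0; rewrite inE eqxx.
have {}p0 w : w \in s -> 0 <= p w by move=> ws; apply: p0; rewrite inE ws orbT.
have {}IH := IH p0.
have : 0 <= \sum_(w <- s) p w * (a w - a i) ^+ 2.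
  by rewrite big_seq sumr_ge0// => w /p0 pw; rewrite mulr_ge0 ?sqr_ge0.
rewrite expand => H; have := mulr_ge0 pi H.
rewrite !big_cons; move: IH; rewrite !expr2.
set P := \sum_(w <- s) p w; set Q := \sum_(w <- s) p w * a w ^+ 2.
set S := \sum_(w <- s) p w * a w; lra.
Qed.

(** Subtracting the constant [a w0] kills the term of w0, so Cauchy-Schwarz over the remaining terms
    has total mass smaller by [p w0]. Expanding the squares returns to a and leaves the defect. *)
Lemma sum_CS_defect s p a w0 : (forall w, w \in s -> 0 <= p w) -> w0 \in s ->
  (\sum_(w <- s) p w * a w) ^+ 2 <=
  (\sum_(w <- s) p w) * (\sum_(w <- s) p w * a w ^+ 2)
  - p w0 * \sum_(w <- s) p w * (a w - a w0) ^+ 2.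
Proof.
move=> p0 w0s; set c := a w0.
have e1 : \sum_(w <- s) p w * (a w - c) =
    \sum_(w <- s) p w * a w - c * \sum_(w <- s) p w.
  by rewrite mulr_sumr -sumrN -big_split /=; apply: eq_bigr => w _; ring.
have h : (\sum_(w <- s) p w * (a w - c)) ^+ 2 <=
   (\sum_(w <- s) p w - p w0) * \sum_(w <- s) p w * (a w - c) ^+ 2.
  rewrite !(perm_big _ (perm_to_rem w0s)) !big_cons /= subrr mulr0 expr0n mulr0 !add0r.
  rewrite [p w0 + _]addrC addrK; apply: (@sum_CS _ p (fun w => a w - c)) => w.
  by move/mem_rem; exact: p0.
move: h; rewrite e1 expand !expr2.
set P := \sum_(w <- s) p w; set Q := \sum_(w <- s) p w * _.
set S := \sum_(w <- s) p w * a w; lra.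
Qed.

Lemma Re_sum s z : complex.Re (\sum_(w <- s) z w) = \sum_(w <- s) complex.Re (z w).
Proof. by elim: s => [|i s IH]; rewrite ?big_nil// !big_cons cReD IH. Qed.

Lemma Im_sum s z : complex.Im (\sum_(w <- s) z w) = \sum_(w <- s) complex.Im (z w).
Proof. by elim: s => [|i s IH]; rewrite ?big_nil// !big_cons cImD IH. Qed.

Lemma csq_sum_CS_defect s p z w0 : (forall w, w \in s -> 0 <= p w) -> w0 \in s ->
  csq (\sum_(w <- s) (p w)%:C * z w) <=
  (\sum_(w <- s) p w) * (\sum_(w <- s) p w * csq (z w))
  - p w0 * \sum_(w <- s) p w * csq (z w - z w0).
Proof.
move=> p0 w0s; rewrite {1}/csq Re_sum Im_sum.
have e1 : \sum_(w <- s) complex.Re ((p w)%:C * z w) = \sum_(w <- s) p w * complex.Re (z w).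
  by apply: eq_bigr => w _; rewrite cReM /= mul0r subr0.
have e2 : \sum_(w <- s) complex.Im ((p w)%:C * z w) = \sum_(w <- s) p w * complex.Im (z w).
  by apply: eq_bigr => w _; rewrite cImM /= mul0r addr0.
have split_csq (f : T -> R[i]) : \sum_(w <- s) p w * csq (f w) =
    \sum_(w <- s) p w * complex.Re (f w) ^+ 2 + \sum_(w <- s) p w * complex.Im (f w) ^+ 2.
  by rewrite -big_split; apply: eq_bigr => w _; rewrite /csq mulrDr.
have e3 : \sum_(w <- s) p w * csq (z w - z w0) =
    \sum_(w <- s) p w * (complex.Re (z w) - complex.Re (z w0)) ^+ 2
    + \sum_(w <- s) p w * (complex.Im (z w) - complex.Im (z w0)) ^+ 2.
  by rewrite split_csq; congr (_ + _); apply: eq_bigr => w _; rewrite ?cReD ?cImD ?cReN ?cImN.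
rewrite e1 e2 e3 split_csq.
have h1 := sum_CS_defect (fun w => complex.Re (z w)) p0 w0s.
have h2 := sum_CS_defect (fun w => complex.Im (z w)) p0 w0s.
apply: le_trans (lerD h1 h2) _; rewrite !mulrDr; lra.
Qed.

Lemma normc_sum s z : normc (\sum_(w <- s) z w) <= \sum_(w <- s) normc (z w).
Proof.
elim: s => [|i s IH]; first by rewrite !big_nil Normc.normc0.
by rewrite !big_cons; apply: le_trans (le_normcD _ _) _; rewrite lerD2l.
Qed.

End cauchy_schwarz.

Section elementary.
Variable R : realType.

Lemma geometric_small (z c e : R) : 0 <= z -> z < 1 -> 0 < e ->
  exists N, forall n, (N <= n)%N -> c * z ^+ n <= e.
Proof.
move=> z0 z1 e0.
have /cvgrPdist_le /(_ e e0) [N _ HN] : geometric c z @ \oo --> (0 : R).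
  by apply: cvg_geometric; rewrite ger0_norm.
exists N => n Nn; have := HN n Nn; rewrite sub0r normrN /= => h.
exact: le_trans (ler_norm _) h.
Qed.

Lemma DerC_lipschitz (v dv : R -> R[i]) (b : R) x y : DerC v dv -> cIC dv -> 0 <= b ->
  (forall z, inI z -> normc (dv z) <= b) -> inI x -> inI y ->
  normc (v x - v y) <= b * `|x - y|.
Proof.
move=> vd dvc b0 dvb xI yI.
have [G Gd] := Der_primitive (cI_csq dvc).
rewrite normc_le ?mulr_ge0//; apply: le_trans (csq_increment vd Gd yI xI) _.
have [c cI1 ->] := Der_MVT_any Gd yI xI.
rewrite mulrCA -expr2 exprMn (real_normK (num_real (x - y))) ler_wpM2r ?sqr_ge0//.
by rewrite -normc_le// dvb.
Qed.

Lemma leq_decay_exponent (N : nat) : (N <= 4 * N + 3)%N.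
Proof. lia. Qed.

Lemma two_leq_decay_exponent (N : nat) : (2 <= 4 * N + 3)%N.
Proof. lia. Qed.

End elementary.

(** The powers of l met in [norm_decay]: the square of [l ^+ n1] with n1 = m + m (N + N), and the
    factor [l ^+ m] of [sup_decay]. *)
Lemma decay_exponent (N m : nat) :
  ((4 * N + 3) * m = (m + m * (N + N)) * 2 + m)%N.
Proof. lia. Qed.

(* The inverse branches h, with lam = |h'|, eps the sign of h' and rho = r \o h,
   extended to a neighbourhood of I so that derivatives at the endpoints are
   two-sided. *)
Record branch_system (R : realType) := BranchSystem {
  bs_J : pred nat;
  bs_h : nat -> R -> R;
  bs_lam : nat -> R -> R;
  bs_dlam : nat -> R -> R;
  bs_rho : nat -> R -> R;
  bs_drho : nat -> R -> R;
  bs_eps : nat -> R;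
  bs_K : R; bs_C : R; bs_q : R; bs_S1 : R; bs_M : R;
  hI : forall i x, bs_J i -> inI x -> inI (bs_h i x);
  hd : forall i, bs_J i -> Der (bs_h i) (fun x => bs_eps i * bs_lam i x);
  eps1 : forall i, bs_J i -> `|bs_eps i| = 1;
  lam_gt0 : forall i x, bs_J i -> inI x -> 0 < bs_lam i x;
  lamd : forall i, bs_J i -> Der (bs_lam i) (bs_dlam i);
  dlamc : forall i, bs_J i -> cI (bs_dlam i);
  dlamB : forall i x, bs_J i -> inI x -> `|bs_dlam i x| <= bs_K * bs_lam i x;
  rhod : forall i, bs_J i -> Der (bs_rho i) (bs_drho i);
  drhoc : forall i, bs_J i -> cI (bs_drho i);
  drhoB : forall i x, bs_J i -> inI x -> `|bs_drho i x| <= bs_K;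
  rho_ge0 : forall i x, bs_J i -> inI x -> 0 <= bs_rho i x;
  K0 : 0 < bs_K; C1 : 1 <= bs_C; q0 : 0 < bs_q; q1 : bs_q < 1; S10 : 0 < bs_S1; M1 : 1 <= bs_M;
  gw_contract : forall w x y, all bs_J w -> inI x -> inI y ->
    `|gw bs_h w x - gw bs_h w y| <= bs_C * bs_q ^+ size w * `|x - y| }.

Section branch_system_theory.
Variables (R : realType) (B : branch_system R).
Implicit Types (A : seq nat) (w : seq nat) (n : nat) (x : R).

Local Notation J := (bs_J B).
Local Notation h := (bs_h B).
Local Notation lam := (bs_lam B).
Local Notation dlam := (bs_dlam B).
Local Notation rho := (bs_rho B).
Local Notation drho := (bs_drho B).
Local Notation eps := (bs_eps B).
Local Notation K := (bs_K B).
Local Notation C := (bs_C B).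
Local Notation q := (bs_q B).
Local Notation S1 := (bs_S1 B).
Local Notation M := (bs_M B).
Local Notation gw := (gw h).

(** * Jacobians, roofs and distortion along words *)

Section branches.
(* gw w composes the branches along the word w; then lw w = |(gw w)'|, sw w is
   the sign of (gw w)', rw w = r^(n) \o gw w with n the length of w, and dlw, drw
   are the derivatives of lw, rw. *)
Fixpoint lw (w : seq nat) x : R := if w is i :: w' then lam i (gw w' x) * lw w' x else 1.
Fixpoint sw (w : seq nat) : R := if w is i :: w' then eps i * sw w' else 1.
Fixpoint rw (w : seq nat) x : R := if w is i :: w' then rho i (gw w' x) + rw w' x else 0.
Fixpoint dlw (w : seq nat) x : R :=
  if w is i :: w' then dlam i (gw w' x) * (sw w' * lw w' x) * lw w' x
    + lam i (gw w' x) * dlw w' x else 0.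
Fixpoint drw (w : seq nat) x : R :=
  if w is i :: w' then drho i (gw w' x) * (sw w' * lw w' x) + drw w' x else 0.

(* The extra condition on G expresses that the images of the branches are
   nonoverlapping. *)
Definition alphabet (A : seq nat) : Prop :=
  [/\ all J A,
      forall x, inI x -> \sum_(i <- A) expR (S1 * rho i x) * lam i x <= M &
      forall G : R -> R, (forall x y, inI x -> inI y -> x <= y -> G x <= G y) ->
        \sum_(i <- A) `|G (h i 1) - G (h i 0)| <= G 1 - G 0].

Lemma gwI w x : all J w -> inI x -> inI (gw w x).
Proof. by elim: w => //= i w IH /andP[Ji /IH wJ] /wJ; exact: hI. Qed.

Lemma sw_norm w : all J w -> `|sw w| = 1.
Proof.
elim: w => [|i w IH] /=; first by rewrite normr1.
by case/andP => Ji /IH e; rewrite normrM e eps1 // mulr1.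
Qed.

Lemma lw_gt0 w x : all J w -> inI x -> 0 < lw w x.
Proof.
elim: w => //= i w IH /andP[Ji wJ] xI.
by rewrite mulr_gt0 ?IH ?lam_gt0 ?gwI.
Qed.

Lemma rw_ge0 w x : all J w -> inI x -> 0 <= rw w x.
Proof.
elim: w => //= i w IH /andP[Ji wJ] xI.
by rewrite addr_ge0 ?IH ?rho_ge0 ?gwI.
Qed.

Lemma gwd w : all J w -> Der (gw w) (fun x => sw w * lw w x).
Proof.
elim: w => [_|i w IH] /=.
  by apply: (Der_ext (@Der_id R)) => x _; rewrite mul1r.
case/andP => Ji wJ.
apply: (Der_ext (Der_comp (hd Ji) (IH wJ) (fun x => gwI wJ))) => x _; ring.
Qed.

Lemma gwc w : all J w -> cI (gw w).
Proof. by move=> /gwd/Der_cI. Qed.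

Lemma lwd w : all J w -> Der (lw w) (dlw w).
Proof.
elim: w => [_|i w IH] /=; first exact: Der_cst.
case/andP => Ji wJ.
exact: (DerM (Der_comp (lamd Ji) (gwd wJ) (fun x => gwI wJ)) (IH wJ)).
Qed.

Lemma rwd w : all J w -> Der (rw w) (drw w).
Proof.
elim: w => [_|i w IH] /=; first exact: Der_cst.
case/andP => Ji wJ.
exact: (DerD (Der_comp (rhod Ji) (gwd wJ) (fun x => gwI wJ)) (IH wJ)).
Qed.

Lemma lwc w : all J w -> cI (lw w). Proof. by move=> /lwd/Der_cI. Qed.
Lemma rwc w : all J w -> cI (rw w). Proof. by move=> /rwd/Der_cI. Qed.

Lemma lw_contract w x : all J w -> inI x -> lw w x <= C * q ^+ size w.
Proof.
move=> wJ xI; have := @Der_lipschitz_conv _ _ _ (C * q ^+ size w) (gwd wJ).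
move=> /(_ (cIZ _ (lwc wJ)) (fun x y => @gw_contract _ B w x y wJ) x xI).
by rewrite normrM sw_norm// mul1r gtr0_norm// lw_gt0.
Qed.

Lemma dlwc w : all J w -> cI (dlw w).
Proof.
elim: w => [_|i w IH] /=; first exact: cI_cst.
case/andP => Ji wJ; have wI x := @gwI w x wJ.
apply: cID; last exact: (cIM (cI_comp (Der_cI (lamd Ji)) (gwc wJ) wI) (IH wJ)).
apply: cIM (lwc wJ); apply: cIM (cI_comp (dlamc Ji) (gwc wJ) wI) _.
exact: cIZ (lwc wJ).
Qed.

Lemma drwc w : all J w -> cI (drw w).
Proof.
elim: w => [_|i w IH] /=; first exact: cI_cst.
case/andP => Ji wJ; have wI x := @gwI w x wJ.
apply: cID (IH wJ); apply: cIM (cI_comp (drhoc Ji) (gwc wJ) wI) _.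
exact: cIZ (lwc wJ).
Qed.

Let K0 := K0 B.
Let C1 := C1 B.
Let q0 := q0 B.
Let q1 := q1 B.

(** The sum of the geometric series of terms K C q^n, the distortions picked up letter by letter.
    The inductions below bound a word of length n by the partial sum [K1 * (1 - q ^+ n)], and [geo]
    is their inductive step. *)
Definition K1 : R := K * C / (1 - q).

Lemma K1_gt0 : 0 < K1.
Proof.
have c0 : 0 < C by apply: lt_le_trans C1.
by rewrite /K1 divr_gt0 ?subr_gt0// mulr_gt0.
Qed.

Let geo n : K * (C * q ^+ n) + K1 * (1 - q ^+ n) = K1 * (1 - q ^+ n.+1).
Proof. by rewrite /K1 exprS; field; rewrite subr_eq0 gt_eqF. Qed.

Let geoK1 n (z : R) : 0 <= z -> K1 * (1 - q ^+ n) * z <= K1 * z.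
Proof.
move=> z0; rewrite ler_wpM2r// -[leRHS]mulr1 ler_wpM2l ?(ltW K1_gt0)//.
by rewrite gerBl exprn_ge0// ltW.
Qed.

Lemma dlwB w x : all J w -> inI x -> `|dlw w x| <= K1 * lw w x.
Proof.
move=> wJ xI; apply: (@le_trans _ _ (K1 * (1 - q ^+ size w) * lw w x)); last first.
  by rewrite geoK1// ltW ?lw_gt0.
elim: w wJ => [_|i w IH] /=; first by rewrite normr0 expr0 subrr mulr0 mul0r.
case/andP => Ji wJ; rewrite -geo; have wI := gwI wJ xI.
have l0 := lam_gt0 Ji wI; have w0 := lw_gt0 wJ xI.
apply: le_trans (ler_normD _ _) _; rewrite !normrM sw_norm// mul1r (gtr0_norm w0).
rewrite (gtr0_norm l0) [leRHS]mulrDl; apply: lerD; last first.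
  by rewrite [leRHS]mulrCA; apply: ler_wpM2l (IH wJ); exact: ltW.
rewrite [leRHS]mulrA ler_wpM2r ?(ltW w0)//.
rewrite -[leRHS]mulrA [_ * lam i _]mulrC mulrA.
by apply: ler_pM (dlamB Ji wI) (lw_contract wJ xI) => //; exact: ltW.
Qed.

Lemma drwB w x : all J w -> inI x -> `|drw w x| <= K1.
Proof.
move=> wJ xI; apply: (@le_trans _ _ (K1 * (1 - q ^+ size w))); last first.
  by have := @geoK1 (size w) 1 ler01; rewrite !mulr1.
elim: w wJ => [_|i w IH] /=; first by rewrite normr0 expr0 subrr mulr0.
case/andP => Ji wJ; rewrite -geo; have wI := gwI wJ xI.
have w0 := lw_gt0 wJ xI.
apply: le_trans (ler_normD _ _) _; rewrite !normrM sw_norm// mul1r (gtr0_norm w0).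
apply: lerD (IH wJ); apply: ler_pM (drhoB Ji wI) (lw_contract wJ xI) => //.
exact: ltW.
Qed.

End branches.

(** * Transfer operators of a finite alphabet *)

Section transfer_estimates.
Definition L0 A := op h A lam.
Definition Lr A (sg : R) := op h A (fun i x => expR (- (sg * rho i x)) * lam i x).
Definition Lc A (s : R[i]) :=
  op h A (fun i x => expc (- (s * (rho i x)%:C)) * (lam i x)%:C).

Definition wr (sg : R) w x : R := expR (- (sg * rw w x)) * lw w x.
Definition wc (s : R[i]) w x : R[i] := expc (- (s * (rw w x)%:C)) * (lw w x)%:C.

Lemma L0E A n v x :
  iter n (L0 A) v x = \sum_(w <- words A n) lw w x * v (gw w x).
Proof. by rewrite iter_opE; apply: eq_bigr. Qed.

Lemma LrE A sg n v x :
  iter n (Lr A sg) v x = \sum_(w <- words A n) wr sg w x * v (gw w x).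
Proof.
rewrite iter_opE; apply: eq_bigr => w _; congr (_ * _); rewrite /wr.
elim: w => [|i w IH] /=; first by rewrite mulr0 oppr0 expR0 mulr1.
by rewrite IH mulrDr opprD expRD; ring.
Qed.

Lemma expc0 : expc (0 : R[i]) = 1.
Proof. by rewrite /expc /= expR0 cos0 sin0 mul1r. Qed.

Lemma LcE A s n v x :
  iter n (Lc A s) v x = \sum_(w <- words A n) wc s w x * v (gw w x).
Proof.
rewrite iter_opE; apply: eq_bigr => w _; congr (_ * _); rewrite /wc.
elim: w => [|i w IH] /=; first by rewrite mulr0 oppr0 expc0 mulr1.
by rewrite IH rmorphD mulrDr opprD expcD rmorphM /=; ring.
Qed.

Lemma wr_gt0 sg w x : all J w -> inI x -> 0 < wr sg w x.
Proof. by move=> wJ xI; rewrite mulr_gt0 ?expR_gt0 ?lw_gt0. Qed.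

Section alphabet.
Variable A : seq nat.
Hypothesis AB : alphabet A.

Let AJ : all J A. Proof. by case: AB. Qed.

Lemma wordsJ n w : w \in words A n -> all J w.
Proof. by case/(words_all AJ). Qed.

Lemma words_size n w : w \in words A n -> size w = n.
Proof. by case/(words_all AJ). Qed.

Lemma sum_words_ge0 n (F : seq nat -> R) :
  (forall w, all J w -> 0 <= F w) -> 0 <= \sum_(w <- words A n) F w.
Proof. by move=> F0; rewrite big_seq sumr_ge0// => w /wordsJ; exact: F0. Qed.

Lemma le_sum_words n (F G : seq nat -> R) :
  (forall w, all J w -> size w = n -> F w <= G w) ->
  \sum_(w <- words A n) F w <= \sum_(w <- words A n) G w.
Proof.
move=> FG; rewrite big_seq [leRHS]big_seq; apply: ler_sum => w wA.
by rewrite FG ?(wordsJ wA) ?(words_size wA).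
Qed.

Lemma L0_cI n g : cI g -> cI (iter n (L0 A) g).
Proof.
move=> gc; rewrite (_ : iter _ _ _ = fun x => \sum_(w <- words A n) lw w x * g (gw w x)).
  apply: cI_sum_in => w /wordsJ wJ.
  exact: cIM (lwc wJ) (cI_comp gc (gwc wJ) (fun x => gwI wJ)).
by apply/funext => x; rewrite L0E.
Qed.

Lemma L0_ge0 n g x : (forall y, inI y -> 0 <= g y) -> inI x -> 0 <= iter n (L0 A) g x.
Proof.
move=> g0 xI; rewrite L0E; apply: sum_words_ge0 => w wJ.
by rewrite mulr_ge0 ?(ltW (lw_gt0 wJ xI))// g0 ?gwI.
Qed.

(** [L0 A g] is the derivative of the sum of the [eps i * prim g (h i x)]. The increments of the
    nondecreasing function [prim g] over nonoverlapping images add up to at most its increment over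
    I. *)
Lemma itg_L0 n g : cI g -> (forall x, inI x -> 0 <= g x) -> itg (iter n (L0 A) g) <= itg g.
Proof.
move=> gc g0; elim: n => [//|n IH] /=.
have {}gc := L0_cI (n:=n) gc.
have {}g0 x : inI x -> 0 <= iter n (L0 A) g x by exact: L0_ge0.
apply: le_trans IH; move: (iter n (L0 A) g) gc g0 => {n}g gc g0.
have Fd : Der (fun x => \sum_(i <- A) eps i * prim g (h i x)) (L0 A g).
  apply: (Der_ext (Der_sum_in (df := fun i x =>
      eps i * (g (h i x) * (eps i * lam i x))) _)) => [i iA|x _].
    have Ji := allP AJ i iA.
    exact: DerZ (Der_comp (Der_prim gc) (hd Ji) (fun x => hI Ji)).
  rewrite /L0 /op; apply: eq_big_seq => i iA; have := eps1 (allP AJ i iA).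
  move=> /(congr1 (fun z => z ^+ 2)); rewrite real_normK ?num_real// expr1n expr2 => e.
  by transitivity (eps i * eps i * (lam i x * g (h i x))); [ring|rewrite e mul1r].
rewrite (itg_prim Fd (L0_cI (n:=1) gc)) -sumrB.
case: AB => _ _ /(_ (prim g)) H.
apply: (@le_trans _ _ (\sum_(i <- A) `|prim g (h i 1) - prim g (h i 0)|)).
  rewrite big_seq [leRHS]big_seq; apply: ler_sum => i iA.
  by rewrite -mulrBr (le_trans (ler_norm _))// normrM eps1 ?mul1r// (allP AJ).
apply: H => x y xI yI xy.
by apply: (Der_nondecreasing (Der_prim gc)).
Qed.

(** The integral of the sum is at most 1, so the sum is at most 1 at some point, and bounded
    distortion carries this to every x with a constant independent of n. *)
Lemma sum_lw n x : inI x -> \sum_(w <- words A n) lw w x <= expR K1.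
Proof.
move=> xI; pose f x := \sum_(w <- words A n) lw w x.
have fd : Der f (fun x => \sum_(w <- words A n) dlw w x).
  by apply: Der_sum_in => w /wordsJ; exact: lwd.
have fE y : iter n (L0 A) (fun=> 1) y = f y.
  by rewrite L0E; apply: eq_bigr => w _; rewrite mulr1.
have [y yI fy] := itg_mean (Der_cI fd).
have i1 : itg f <= 1.
  have := itg_L0 n (cI_cst 1) (fun x _ => ler01).
  by rewrite itg_cst (_ : iter _ _ _ = f)//; apply/funext.
have f0 z : inI z -> 0 <= f z.
  by move=> zI; apply: sum_words_ge0 => w wJ; rewrite ltW ?lw_gt0.
have := loglip (ltW K1_gt0) fd f0 _ xI yI; rewrite fy => H.
apply: le_trans (H _) _; last by rewrite -[leRHS]mulr1 ler_wpM2l// expR_ge0.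
move=> z zI; apply: le_trans (ler_norm_sum _ _ _) _; rewrite mulr_sumr.
by apply: le_sum_words => w wJ _; exact: dlwB.
Qed.

Lemma sum_exp_lw n x : inI x ->
  \sum_(w <- words A n) expR (S1 * rw w x) * lw w x <= M ^+ n.
Proof.
move=> xI; elim: n => [|n IH]; first by rewrite big_seq1 /= mulr0 expR0 mulr1 expr0.
rewrite big_words exprSr; apply: le_trans (ler_wpM2r (le_trans ler01 (M1 B)) IH).
rewrite mulr_suml; apply: le_sum_words => w wJ _.
rewrite (eq_bigr (fun i => expR (S1 * rw w x) * lw w x *
  (expR (S1 * rho i (gw w x)) * lam i (gw w x)))) => [|i _]; last first.
  by rewrite /= mulrDr expRD; ring.
rewrite -mulr_sumr ler_wpM2l//; first by rewrite mulr_ge0 ?expR_ge0 ?ltW ?lw_gt0.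
by case: AB => _ H _; apply: H; rewrite gwI.
Qed.

(** Interpolation between [sum_lw] and [sum_exp_lw] by expR (th y) <= 1 + expR y, with y = S1 rw - n
    ln M. The growth per step, expR (th ln M), is close to 1 when th is small. *)
Lemma sum_wr_young (sg th : R) n x : inI x -> 0 <= th <= 1 -> `|sg| <= th * S1 ->
  \sum_(w <- words A n) wr sg w x <= expR (th * (n%:R * ln M)) * (expR K1 + 1).
Proof.
move=> xI /andP[th0 th1] sgB.
have young (y : R) : expR (th * y) <= 1 + expR y.
  have [y0|/ltW y0] := leP y 0.
    by rewrite ler_wpDr ?expR_ge0// -expR0 ler_expR mulr_ge0_le0.
  by rewrite ler_wpDl ?ler01// ler_expR -[leRHS]mul1r ler_wpM2r.
have M0 : 0 < M := lt_le_trans ltr01 (M1 B).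
apply: (@le_trans _ _ (\sum_(w <- words A n) expR (th * (n%:R * ln M)) *
   (lw w x + expR (S1 * rw w x) * lw w x * M ^- n))).
  apply: le_sum_words => w wJ _; rewrite /wr.
  have -> : expR (th * (n%:R * ln M)) * (lw w x + expR (S1 * rw w x) * lw w x * M ^- n)
     = (expR (th * (n%:R * ln M)) * (1 + expR (S1 * rw w x) * M ^- n)) * lw w x by ring.
  rewrite ler_wpM2r ?(ltW (lw_gt0 wJ xI))//.
  have -> : expR (S1 * rw w x) * M ^- n = expR (S1 * rw w x - n%:R * ln M).
    rewrite expRD; congr (_ * _); rewrite expRN; congr (_^-1).
    by rewrite mulrC expRM_natr lnK.
  apply: (@le_trans _ _ (expR (th * (n%:R * ln M) + th * (S1 * rw w x - n%:R * ln M)))).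
    rewrite ler_expR.
    have -> : th * (n%:R * ln M) + th * (S1 * rw w x - n%:R * ln M)
      = (th * S1) * rw w x by ring.
    rewrite -mulNr ler_wpM2r ?rw_ge0//.
    by apply: le_trans sgB; rewrite -normrN ler_norm.
  by rewrite expRD ler_wpM2l ?expR_ge0// young.
rewrite -mulr_sumr ler_wpM2l ?expR_ge0// big_split /= lerD ?sum_lw//.
by rewrite -mulr_suml ler_pdivrMr ?exprn_gt0// mul1r sum_exp_lw.
Qed.

Lemma Lr_le sg n f g x : (forall y, inI y -> f y <= g y) -> inI x ->
  iter n (Lr A sg) f x <= iter n (Lr A sg) g x.
Proof.
move=> fg xI; rewrite !LrE; apply: le_sum_words => w wJ _.
by rewrite ler_wpM2l ?(ltW (wr_gt0 sg wJ xI))// fg ?gwI.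
Qed.

Definition dwr (sg : R) w x : R :=
  expR (- (sg * rw w x)) * - (sg * drw w x) * lw w x + expR (- (sg * rw w x)) * dlw w x.

Lemma wrd sg w : all J w -> Der (wr sg w) (dwr sg w).
Proof. by move=> wJ; exact: DerM (Der_exp (DerN (DerZ sg (rwd wJ)))) (lwd wJ). Qed.

Lemma dwrc sg w : all J w -> cI (dwr sg w).
Proof.
move=> wJ; have e := cI_exp (cIN (cIZ sg (rwc wJ))).
apply: cID; last exact: cIM e (dlwc wJ).
exact: cIM (cIM e (cIN (cIZ sg (drwc wJ)))) (lwc wJ).
Qed.

Lemma dwrB sg w x : all J w -> inI x -> `|sg| <= 1 ->
  `|dwr sg w x| <= 2 * K1 * wr sg w x.
Proof.
move=> wJ xI s1; rewrite /dwr /wr -mulrA -mulrDr normrM ger0_norm ?expR_ge0//.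
rewrite mulrCA ler_wpM2l ?expR_ge0//; apply: le_trans (ler_normD _ _) _.
have l0 := lw_gt0 wJ xI.
rewrite normrM normrN normrM (gtr0_norm l0) [2 * K1]mulr_natl mulr2n mulrDl.
rewrite lerD ?dlwB// ler_wpM2r ?(ltW l0)// -[leRHS]mul1r.
by rewrite ler_pM ?drwB.
Qed.

End alphabet.
End transfer_estimates.

(** * Supersolutions and energies *)

Section supersolution.
(** The bound on df has the constant of [dwrB]: f is a positive combination of sums of weights and
    inherits their distortion. *)
Definition supersolution A (sg l : R) (f df : R -> R) : Prop :=
  [/\ Der f df, cI df, forall x, inI x -> 1 <= f x,
      forall x, inI x -> `|df x| <= 2 * K1 * f x &
      forall x, inI x -> Lr A sg f x <= l * f x].

(** f is the truncated resolvent series, the sum of l^-k L^k 1 for k <= m. Applying L shifts it: L f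
    = l (f - 1 + l^-(m+1) L^(m+1) 1), which is at most l f as soon as the last term is at most 1. By
    [sum_wr_young] some m achieves this whatever A and sg. *)
Lemma supersolution_exists (l : R) : 1 < l -> exists2 e, 0 < e & e <= 1 /\
  forall A sg, alphabet A -> `|sg| <= e ->
    exists f df, supersolution A sg l f df.
Proof.
move=> l1; have l0 : 0 < l by lra.
pose b := ln l; have b0 : 0 < b by rewrite ln_gt0.
have m0 : 0 <= ln M by rewrite ln_ge0// M1.
(* Small enough for L^k 1 to grow at most like l^(k/2), up to the constant C2 below. *)
pose th := Num.min 1 (b / (2 * (ln M + 1))).
have th0 : 0 < th by rewrite /th lt_min ltr01 divr_gt0//; lra.
have th1 : th <= 1 by rewrite /th ge_min lexx.
have thM : th * ln M <= b / 2.
  have : th <= b / (2 * (ln M + 1)) by rewrite /th ge_min lexx orbT.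
  rewrite ler_pdivlMr; last lra.
  by have := mulr_ge0 (ltW th0) m0; nra.
exists (Num.min 1 (th * S1)); first by rewrite lt_min ltr01 mulr_gt0 ?S10.
split; first by rewrite ge_min lexx.
move=> A sg AB; rewrite le_min => /andP[sg1 sgth].
pose C2 := expR K1 + 1.
have C20 : 0 < C2 by rewrite /C2 addr_gt0 ?expR_gt0.
pose a k x := \sum_(w <- words A k) wr sg w x.
have aB k x : inI x -> a k x <= expR (k%:R * (b / 2)) * C2.
  move=> xI; apply: le_trans (sum_wr_young _ _ xI _ sgth) _ => //; first by rewrite ltW.
  rewrite ler_wpM2r ?(ltW C20)// ler_expR mulrCA ler_wpM2l//.
have a0 k x : inI x -> 0 <= a k x.
  by move=> xI; apply: (sum_words_ge0 AB) => w wJ; rewrite ltW ?wr_gt0.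
have aL k x : Lr A sg (a k) x = a k.+1 x.
  rewrite /a (eq_bigr (fun w => wr sg w x * 1)) => [|w _]; last by rewrite mulr1.
  rewrite -[RHS](LrE A sg k.+1 (fun=> 1)) iterS; congr (Lr A sg _ x).
  by apply/funext => y; rewrite LrE; apply: eq_bigr => w _; rewrite mulr1.
(* Half of the factor l^-(m+1) absorbs the growth of L^(m+1) 1, the other half absorbs C2. *)
have [m Hm] : exists m, C2 <= expR (m%:R * (b / 2)).
  exists (Num.truncn (C2 / (b / 2))).+1.
  apply: le_trans (_ : 1 + _ <= _); last exact: expR_ge1Dx.
  rewrite -[leLHS]add0r lerD ?ler01// -ler_pdivrMr; last lra.
  by rewrite ltW// truncnS_gt.
have lE k : l ^+ k = expR (k%:R * b) by rewrite mulrC expRM_natr lnK.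
have am x : inI x -> l ^- m.+1 * a m.+1 x <= 1.
  move=> xI; rewrite mulrC ler_pdivrMr ?exprn_gt0// mul1r lE.
  apply: le_trans (aB _ _ xI) _.
  have -> : m.+1%:R * b = m.+1%:R * (b / 2) + m.+1%:R * (b / 2) by field.
  rewrite expRD ler_wpM2l ?expR_ge0//; apply: le_trans Hm _.
  by rewrite ler_expR ler_wpM2r ?ler_nat//; lra.
pose f x := \sum_(k <- iota 0 m.+1) l ^- k * a k x.
pose df x := \sum_(k <- iota 0 m.+1) l ^- k * \sum_(w <- words A k) dwr sg w x.
have fd : Der f df.
  apply: (@Der_sum_in _ _ _ (fun k x => l ^- k * a k x)) => k _; apply: DerZ.
  by apply: Der_sum_in => w /(wordsJ AB); exact: wrd.
exists f, df; split => //.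
- apply: (@cI_sum_in _ _ _ (fun k x => l ^- k * \sum_(w <- words A k) dwr sg w x)) => k _.
  apply: cIZ; apply: cI_sum_in => w /(wordsJ AB); exact: dwrc.
- move=> x xI; rewrite /f big_cons /= expr0 invr1 mul1r /a big_seq1.
  rewrite /wr /= mulr0 oppr0 expR0 mulr1 lerDl sumr_ge0// => k _.
  by rewrite mulr_ge0 ?invr_ge0 ?exprn_ge0 ?(ltW l0)//; exact: a0.
- move=> x xI; apply: le_trans (ler_norm_sum _ _ _) _; rewrite mulr_sumr.
  apply: ler_sum => k _; rewrite normrM ger0_norm ?invr_ge0 ?exprn_ge0 ?(ltW l0)//.
  rewrite mulrCA ler_wpM2l ?invr_ge0 ?exprn_ge0 ?(ltW l0)//.
  apply: le_trans (ler_norm_sum _ _ _) _; rewrite mulr_sumr.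
  by apply: (le_sum_words AB) => w wJ _; exact: dwrB.
move=> x xI.
have -> : Lr A sg f x = \sum_(k <- iota 0 m.+1) l ^- k * a k.+1 x.
  rewrite /Lr /op /f (eq_bigr (fun i => \sum_(k <- iota 0 m.+1)
     expR (- (sg * rho i x)) * lam i x * (l ^- k * a k (h i x)))) => [|i _]; last first.
    by rewrite mulr_sumr.
  rewrite exchange_big; apply: eq_bigr => k _ /=.
  rewrite -aL /Lr /op mulr_sumr; apply: eq_bigr => i _; ring.
have tele n : \sum_(k <- iota 0 n) l ^- k * a k.+1 x =
    l * (\sum_(k <- iota 0 n) l ^- k * a k x - a 0 x + l ^- n * a n x).
  elim: n => [|n IH]; first by rewrite !big_nil expr0 invr1; ring.
  have -> : iota 0 n.+1 = iota 0 n ++ [:: n] by rewrite -addn1 iotaD add0n.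
  rewrite !big_cat /= !big_seq1 IH exprSr; field.
  by rewrite expf_neq0 ?gt_eqF.
rewrite tele -/(f x) ler_pM2l//; have := am x xI.
have -> : a 0 x = 1 by rewrite /a big_seq1 /wr /= mulr0 oppr0 expR0 mulr1.
lra.
Qed.

End supersolution.

(** * Energies under the complex transfer operator *)

Section energy_estimates.
Definition dwc (s : R[i]) w x : R[i] :=
  expc (- (s * (rw w x)%:C)) * - (s * (drw w x)%:C) * (lw w x)%:C
  + expc (- (s * (rw w x)%:C)) * (dlw w x)%:C.

Definition dLc A (s : R[i]) n (v dv : R -> R[i]) x : R[i] :=
  \sum_(w <- words A n) (dwc s w x * v (gw w x)
    + wc s w x * ((sw w * lw w x)%:C * dv (gw w x))).

Lemma normc_real (c : R) : normc c%:C = `|c|.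
Proof. by rewrite /normc /= expr0n addr0 sqrtr_sqr. Qed.

Lemma normc_expc (z : R[i]) : normc (expc z) = expR (complex.Re z).
Proof.
apply/eqP; rewrite -(@eqrXn2 _ 2)// ?normc_ge0' ?expR_ge0//.
by rewrite normc_csq csq_expc.
Qed.

Lemma normc_exp_roof s w x :
  normc (expc (- (s * (rw w x)%:C))) = expR (- (complex.Re s * rw w x)).
Proof. by rewrite normc_expc cReN cReM /= mulr0 subr0. Qed.

Lemma normc_wc s w x : all J w -> inI x -> normc (wc s w x) = wr (complex.Re s) w x.
Proof.
move=> wJ xI; rewrite Normc.normcM normc_exp_roof normc_real.
by rewrite gtr0_norm ?lw_gt0.
Qed.

Lemma normc_dwc s (Ts : R) w x : all J w -> inI x -> normc s + 1 <= Ts ->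
  normc (dwc s w x) <= Ts * K1 * wr (complex.Re s) w x.
Proof.
move=> wJ xI sT; rewrite /dwc.
have l0 := lw_gt0 wJ xI; have e0 := expR_ge0 (- (complex.Re s * rw w x)).
have := normc_exp_roof s w x; move: (expc _) => e he.
apply: le_trans (le_normcD _ _) _.
rewrite !Normc.normcM normcN !Normc.normcM !normc_real he.
rewrite (gtr0_norm l0) -mulrA -mulrDr [leRHS]mulrCA ler_wpM2l//.
apply: (@le_trans _ _ (normc s * K1 * lw w x + K1 * lw w x)).
  rewrite lerD ?dlwB// ler_wpM2r ?(ltW l0)// ler_wpM2l ?normc_ge0'//.
  exact: drwB.
rewrite -mulrDl ler_wpM2r ?(ltW l0)//.
by have := ler_wpM2r (ltW K1_gt0) sT; lra.
Qed.

Section alphabet.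
Variable A : seq nat.
Hypothesis AB : alphabet A.

Lemma wcd s w : all J w -> DerC (wc s w) (dwc s w).
Proof.
move=> wJ.
have h : DerC (fun x => - (s * (rw w x)%:C)) (fun x => - (s * (drw w x)%:C)).
  apply: (@DerC_ext _ _ (fun x => (fun=> 0) x * (rw w x)%:C + (- s) * (drw w x)%:C)).
    under eq_fun do rewrite -mulNr.
    by apply: DerCM (DerC_real (rwd wJ)); split; exact: Der_cst.
  by move=> x _; rewrite mul0r add0r mulNr.
exact: DerCM (DerC_expc h) (DerC_real (lwd wJ)).
Qed.

Lemma wcc s w : all J w -> cIC (wc s w).
Proof. by move=> wJ; exact: DerC_cIC (wcd s wJ). Qed.

Lemma dwcc s w : all J w -> cIC (dwc s w).
Proof.
move=> wJ.
have cst (c : R[i]) : cIC (fun=> c) by split; exact: cI_cst.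
have e : cIC (fun x => expc (- (s * (rw w x)%:C))).
  by apply: cIC_expc; apply: cICN; apply: cICM (cst s) (cIC_real (rwc wJ)).
apply: cICD; last exact: cICM e (cIC_real (dlwc wJ)).
apply: cICM (cIC_real (lwc wJ)); apply: cICM e _.
by apply: cICN; exact: cICM (cst s) (cIC_real (drwc wJ)).
Qed.

Lemma Lcd s n v dv : DerC v dv -> DerC (iter n (Lc A s) v) (dLc A s n v dv).
Proof.
move=> vd.
rewrite (_ : iter _ _ _ = fun x => \sum_(w <- words A n) wc s w x * v (gw w x)).
  apply: DerC_sum_in => w /(wordsJ AB) wJ.
  apply: (DerC_ext (DerCM (wcd s wJ) (DerC_comp vd (gwd wJ) (fun x => gwI wJ)))) => x _.
  by [].
by apply/funext => x; rewrite LcE.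
Qed.

Lemma dLcc s n v dv : cIC v -> cIC dv -> cIC (dLc A s n v dv).
Proof.
move=> vc dvc; apply: cIC_sum_in => w /(wordsJ AB) wJ; have gI x := @gwI w x wJ.
apply: cICD; first exact: cICM (dwcc s wJ) (cIC_comp vc (gwc wJ) gI).
apply: cICM (wcc s wJ) _; apply: cICM (cIC_comp dvc (gwc wJ) gI).
by apply: cIC_real; exact: cIZ (lwc wJ).
Qed.

Lemma Lcc s n v : cIC v -> cIC (iter n (Lc A s) v).
Proof.
move=> vc; rewrite (_ : iter _ _ _ = fun x => \sum_(w <- words A n) wc s w x * v (gw w x)).
  apply: cIC_sum_in => w /(wordsJ AB) wJ.
  exact: cICM (wcc s wJ) (cIC_comp vc (gwc wJ) (fun x => gwI wJ)).
by apply/funext => x; rewrite LcE.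
Qed.

Lemma normc_Lc s n v x : inI x ->
  normc (iter n (Lc A s) v x) <=
  \sum_(w <- words A n) wr (complex.Re s) w x * normc (v (gw w x)).
Proof.
move=> xI; rewrite LcE; apply: le_trans (normc_sum _ _) _.
by apply: (le_sum_words AB) => w wJ _; rewrite Normc.normcM normc_wc.
Qed.

(** The Lasota-Yorke inequality before any summation of weights: differentiating a weight costs
    [Ts * K1], differentiating v along a branch gains the contraction [C * q ^+ n]. *)
Lemma normc_dLc s (Ts : R) n v dv x : inI x -> normc s + 1 <= Ts ->
  normc (dLc A s n v dv x) <=
  Ts * K1 * \sum_(w <- words A n) wr (complex.Re s) w x * normc (v (gw w x))
  + C * q ^+ n * \sum_(w <- words A n) wr (complex.Re s) w x * normc (dv (gw w x)).
Proof.
move=> xI sT; apply: le_trans (normc_sum _ _) _.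
rewrite !mulr_sumr -big_split /=; apply: (le_sum_words AB) => w wJ wn.
apply: le_trans (le_normcD _ _) _.
rewrite (Normc.normcM (dwc s w x)) (Normc.normcM (wc s w x)) (Normc.normcM (_%:C)) normc_real.
have l0 := lw_gt0 wJ xI.
rewrite normrM sw_norm// mul1r (gtr0_norm l0) normc_wc//; apply: lerD.
  by rewrite mulrA ler_wpM2r ?normc_ge0'// normc_dwc.
rewrite [leRHS]mulrCA ler_wpM2l ?(ltW (wr_gt0 _ wJ xI))//.
by rewrite ler_wpM2r ?normc_ge0'// -wn lw_contract.
Qed.

Section with_supersolution.
Variables (l : R) (l1 : 1 <= l).
Let l0 : 0 <= l. Proof. exact: le_trans ler01 l1. Qed.

Lemma supersolution_iter sg f df n x : supersolution A sg l f df -> inI x ->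
  iter n (Lr A sg) f x <= l ^+ n * f x.
Proof.
move=> [_ _ _ _ fl]; elim: n x => [|n IH] x xI; first by rewrite expr0 mul1r.
rewrite iterS.
have h : Lr A sg (iter n (Lr A sg) f) x <= Lr A sg (fun x => l ^+ n * f x) x.
  exact: (@Lr_le A AB sg 1).
apply: le_trans h _.
have -> : Lr A sg (fun x => l ^+ n * f x) x = l ^+ n * Lr A sg f x.
  by rewrite /Lr /op mulr_sumr; apply: eq_bigr => i _; rewrite mulrCA.
by rewrite exprSr -mulrA ler_wpM2l ?exprn_ge0// fl.
Qed.

(** The values of f at [gw w x] and at x agree up to the factor [expR (2 * K1)], so the growth of
    the iterates of f controls that of the iterates of 1. *)
Lemma sum_wr_le sg f df n x : supersolution A sg l f df -> inI x ->
  \sum_(w <- words A n) wr sg w x <= expR (2 * K1) * l ^+ n.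
Proof.
move=> ss xI; have [fd _ f1 dfB _] := ss.
have f0 y : inI y -> 0 < f y by move=> /f1; apply: lt_le_trans.
have k2 : 0 <= 2 * K1 by rewrite mulr_ge0 ?(ltW K1_gt0).
rewrite -(ler_pM2r (f0 x xI)) -mulrA; apply: le_trans (_ : _ <= expR (2 * K1) * iter n (Lr A sg) f x) _.
  rewrite LrE mulr_suml mulr_sumr; apply: (le_sum_words AB) => w wJ _.
  rewrite mulrCA ler_wpM2l ?(ltW (wr_gt0 sg wJ xI))//.
  by apply: (loglip k2 fd _ dfB) => //; [move=> y /f0/ltW|exact: gwI].
by rewrite ler_wpM2l ?expR_ge0//; exact: supersolution_iter ss xI.
Qed.

Variables (s : R[i]) (f df : R -> R).
Hypothesis ss : supersolution A (2 * complex.Re s) l f df.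

Let f_gt0 x : inI x -> 0 < f x.
Proof. by case: ss => _ _ f1 _ _ /f1; exact: lt_le_trans. Qed.

Let fc : cI f. Proof. by case: ss => /Der_cI. Qed.

Definition dens (u : R -> R) x : R := u x / f x.

Definition energy (v : R -> R[i]) : R := itg (dens (fun x => csq (v x))).

Lemma dens_cI u : cI u -> cI (dens u).
Proof.
move=> uc; apply: cIM uc (cIV _ fc) => x xI.
by rewrite gt_eqF ?f_gt0.
Qed.

Lemma dens_ge0 u x : (forall y, inI y -> 0 <= u y) -> inI x -> 0 <= dens u x.
Proof. by move=> u0 xI; rewrite divr_ge0 ?u0// ltW ?f_gt0. Qed.

Lemma energy_ge0 v : cIC v -> 0 <= energy v.
Proof.
move=> vc; apply: itg_ge0; first exact/dens_cI/cI_csq.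
by move=> x xI; apply: dens_ge0 => // y _; exact: csq_ge0.
Qed.

(** Each term factors as [p w * a w], where p is the weight at 2 sigma times f and a = expR (sigma
    rw) u / f. The masses p sum to an iterate of f, at most l^n f; in p a^2 = lw u^2 / f the
    exponentials cancel, so that only the plain operator [L0] remains. *)
Lemma wr_CS n (u : R -> R) x : inI x ->
  (\sum_(w <- words A n) wr (complex.Re s) w x * u (gw w x)) ^+ 2
  <= l ^+ n * f x * iter n (L0 A) (dens (fun x => u x ^+ 2)) x.
Proof.
move=> xI.
pose p w := wr (2 * complex.Re s) w x * f (gw w x).
pose a w := expR (complex.Re s * rw w x) * u (gw w x) / f (gw w x).
have p0 w : w \in words A n -> 0 <= p w.
  move=> /(wordsJ AB) wJ.
  by rewrite mulr_ge0 ?(ltW (wr_gt0 _ wJ xI)) ?(ltW (f_gt0 (gwI wJ xI))).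
have fn0 w : w \in words A n -> f (gw w x) != 0.
  by move=> /(wordsJ AB) wJ; rewrite gt_eqF// f_gt0// gwI.
have := sum_CS a p0.
rewrite (eq_big_seq (fun w => wr (complex.Re s) w x * u (gw w x))) => [|w wA]; last first.
  have f0 := fn0 w wA; rewrite /p /a /wr.
  rewrite (_ : - (2 * complex.Re s * rw w x) =
    - (complex.Re s * rw w x) - complex.Re s * rw w x); last ring.
  rewrite expRD expRN; set e := expR (complex.Re s * rw w x).
  have e0 : e != 0 by rewrite gt_eqF ?expR_gt0.
  by field; rewrite e0 f0.
move=> /le_trans; apply; apply: ler_pM.
- by rewrite big_seq sumr_ge0.
- rewrite big_seq sumr_ge0// => w wA; rewrite mulr_ge0 ?sqr_ge0// p0//.
- by rewrite -LrE; exact: supersolution_iter ss xI.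
rewrite L0E le_eqVlt; apply/orP; left; apply/eqP; apply: eq_big_seq => w wA.
have f0 := fn0 w wA; rewrite /p /a /wr /dens.
rewrite (_ : - (2 * complex.Re s * rw w x) =
    - (complex.Re s * rw w x) - complex.Re s * rw w x); last ring.
rewrite expRD expRN; set e := expR (complex.Re s * rw w x).
have e0 : e != 0 by rewrite gt_eqF ?expR_gt0.
by field; rewrite e0 f0.
Qed.

Lemma csq_Lc_le n v x : inI x ->
  csq (iter n (Lc A s) v x) <= l ^+ n * f x * iter n (L0 A) (dens (fun x => csq (v x))) x.
Proof.
move=> xI; rewrite -normc_csq.
apply: le_trans (_ : (\sum_(w <- words A n) wr (complex.Re s) w x * normc (v (gw w x))) ^+ 2 <= _).
  have h := normc_Lc s n v xI.
  by rewrite ler_pXn2r// nnegrE ?normc_ge0'// (le_trans _ h)// normc_ge0'.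
apply: le_trans (wr_CS n (fun x => normc (v x)) xI) _.
by rewrite (_ : (fun x => normc (v x) ^+ 2) = fun x => csq (v x))//; apply/funext => y; rewrite normc_csq.
Qed.

Lemma energy_Lc n v : cIC v -> energy (iter n (Lc A s) v) <= l ^+ n * energy v.
Proof.
move=> vc; have dc := dens_cI (cI_csq vc).
apply: (@le_trans _ _ (l ^+ n * itg (iter n (L0 A) (dens (fun x => csq (v x)))))).
  apply: itg_le_lin; [exact/dens_cI/cI_csq/Lcc|exact: L0_cI|].
  move=> x xI; rewrite ler_pdivrMr ?f_gt0// mulrAC; exact: csq_Lc_le.
rewrite ler_wpM2l ?exprn_ge0// itg_L0// => x xI.
by apply: dens_ge0 => // y _; exact: csq_ge0.
Qed.

Lemma energy_dLc (Ts : R) n v dv : cIC v -> cIC dv -> normc s + 1 <= Ts ->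
  energy (dLc A s n v dv) <=
  l ^+ n * (2 * (Ts * K1) ^+ 2 * energy v + 2 * (C * q ^+ n) ^+ 2 * energy dv).
Proof.
move=> vc dvc sT.
have c1 := dens_cI (cI_csq vc); have c2 := dens_cI (cI_csq dvc).
apply: (@le_trans _ _ (l ^+ n * (2 * (Ts * K1) ^+ 2) * itg (iter n (L0 A) (dens (fun x => csq (v x))))
   + l ^+ n * (2 * (C * q ^+ n) ^+ 2) * itg (iter n (L0 A) (dens (fun x => csq (dv x)))))).
  apply: itg_le_lin2; [exact/dens_cI/cI_csq/dLcc|exact: L0_cI|exact: L0_cI|].
  move=> x xI; rewrite ler_pdivrMr ?f_gt0// -normc_csq.
  have h := normc_dLc n v dv xI sT.
  have h1 := wr_CS n (fun x => normc (v x)) xI; have h2 := wr_CS n (fun x => normc (dv x)) xI.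
  rewrite (_ : (fun x => normc (v x) ^+ 2) = fun x => csq (v x)) in h1; last first.
    by apply/funext => y; rewrite normc_csq.
  rewrite (_ : (fun x => normc (dv x) ^+ 2) = fun x => csq (dv x)) in h2; last first.
    by apply/funext => y; rewrite normc_csq.
  move: h h1 h2.
  set X := \sum_(w <- _) _; set Y := \sum_(w <- _) _.
  set a := iter _ _ _ x; set b := iter _ _ _ x.
  set T1 := Ts * K1; set T2 := C * q ^+ n => h h1 h2.
  apply: (@le_trans _ _ ((T1 * X + T2 * Y) ^+ 2)).
    by rewrite ler_pXn2r// nnegrE ?normc_ge0'// (le_trans _ h)// normc_ge0'.
  have s1 := sqr_ge0 (T1 * X - T2 * Y).
  have := ler_wpM2l (sqr_ge0 T1) h1; have := ler_wpM2l (sqr_ge0 T2) h2.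
  by rewrite !expr2 in s1 *; lra.
have k1 : 0 <= l ^+ n * (2 * (Ts * K1) ^+ 2).
  by apply: mulr_ge0; [exact: exprn_ge0|apply: mulr_ge0 => //; exact: sqr_ge0].
have k2 : 0 <= l ^+ n * (2 * (C * q ^+ n) ^+ 2).
  by apply: mulr_ge0; [exact: exprn_ge0|apply: mulr_ge0 => //; exact: sqr_ge0].
have i1 := itg_L0 AB n c1 (fun x => dens_ge0 (fun y _ => csq_ge0 (v y))).
have i2 := itg_L0 AB n c2 (fun x => dens_ge0 (fun y _ => csq_ge0 (dv y))).
have := ler_wpM2l k1 i1; have := ler_wpM2l k2 i2.
by rewrite /energy mulrDr !mulrA; lra.
Qed.

End with_supersolution.

End alphabet.
End energy_estimates.

(** * Cancellation *)

Section cancellation.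
Variable A : seq nat.
Hypothesis AB : alphabet A.
Variables (l : R) (l1 : 1 <= l) (s : R[i]) (f df : R -> R).
Local Notation sg := (complex.Re s).
Local Notation t := (complex.Im s).
Hypothesis ss : supersolution A (2 * sg) l f df.
Variables (N : nat) (w1 w2 : seq nat) (D mn cc : R).
Hypotheses (w1A : w1 \in words A N) (w2A : w2 \in words A N).
Hypotheses (D0 : 0 < D) (mn0 : 0 < mn) (mn1 : mn <= 1) (cc0 : 0 <= cc).
Hypothesis phase : forall x, inI x -> D <= `|drw w1 x - drw w2 x|.
Hypothesis lw_ge : forall w x, w \in [:: w1; w2] -> inI x -> mn <= lw w x.
Hypothesis roof_le : forall w x, w \in [:: w1; w2] -> inI x ->
  expR (`|2 * sg| * rw w x) <= 2.
Hypotheses (sg1 : `|sg| <= 1) (lN : l ^+ N <= 2).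

(** Bounds [dm / m]: K1 comes from the exponential of the roof, 2 K1 C from f along the branch. *)
Let K3 : R := K1 * (1 + 2 * C).
(** [C3] and [C4] are the constants of [X_le]. [cp] is the least share of a chosen word in the mass:
    mn from its Jacobian, 1/2 from its roof, the exponential from the variation of f. [C5] bounds
    the energy by the defect in [energy_contraction]. *)
Let C3 : R := 2 * (256 * K1 ^+ 2 + D ^+ 2) / D ^+ 2.
Let C4 : R := 512 * C * expR (2 * K1) * cc / D ^+ 2.
Let cp : R := mn * expR (- (2 * K1)) / 2.
Let C5 : R := 2 + 4 * expR (4 * K1) * C3 / cp.

Hypotheses (t_large : 384 * K3 ^+ 2 <= t ^+ 2 * D ^+ 2) (t_K1 : 1 <= K1 * `|t|).
Hypothesis N_large : 16 * expR (2 * K1) * C4 * q ^+ N <= 1.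

Let f_gt0 x : inI x -> 0 < f x.
Proof. by case: ss => _ _ f1 _ _ /f1; exact: lt_le_trans. Qed.
Let fc : cI f. Proof. by case: ss => /Der_cI. Qed.
Let k0 : 0 < K1. Proof. exact: K1_gt0. Qed.
Let c1 : 1 <= C. Proof. exact: C1. Qed.

Let f_comp x y : inI x -> inI y -> f x <= expR (2 * K1) * f y.
Proof.
case: ss => fd _ _ dfB _; apply: (loglip _ fd _ dfB).
  by rewrite mulr_ge0 ?ltW.
by move=> z /f_gt0/ltW.
Qed.

Let F0 := f 0.
Let F00 : 0 < F0. Proof. exact/f_gt0/inI0. Qed.
Let f_leF x : inI x -> f x <= expR (2 * K1) * F0.
Proof. by move=> xI; apply: f_comp => //; exact: inI0. Qed.
Let f_geF x : inI x -> (f x)^-1 <= expR (2 * K1) / F0.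
Proof.
move=> xI; rewrite ler_pdivlMr// mulrC ler_pdivrMr ?f_gt0//.
by apply: f_comp => //; exact: inI0.
Qed.

Variables (v dv : R -> R[i]).
Hypotheses (vd : DerC v dv) (dvc : cIC dv).
Let vc : cIC v. Proof. exact: DerC_cIC vd. Qed.

(** The complex weight of w is the mass [p w] times [m w] times a phase of argument - t rw (see
    [pz]). The amplitude [al] collects all but the mass and the phase, so t enters its derivative
    only through dv. *)
Let m w x : R := expR (sg * rw w x) / f (gw w x).
Let dm w x : R := m w x * (sg * drw w x - df (gw w x) * (sw w * lw w x) / f (gw w x)).
Let al w x : R[i] := (m w x)%:C * v (gw w x).
Let dal w x : R[i] := (dm w x)%:C * v (gw w x)
  + (m w x)%:C * ((sw w * lw w x)%:C * dv (gw w x)).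

Let wi w : w \in [:: w1; w2] -> all J w /\ size w = N.
Proof.
rewrite !inE => /orP[]/eqP->; first by rewrite (wordsJ AB w1A) (words_size AB w1A).
by rewrite (wordsJ AB w2A) (words_size AB w2A).
Qed.

Let fg0 w x : all J w -> inI x -> 0 < f (gw w x).
Proof. by move=> wJ xI; apply/f_gt0/gwI. Qed.

Let md w : all J w -> Der (m w) (dm w).
Proof.
move=> wJ; case: ss => fd _ _ _ _.
have fg : Der (fun x => f (gw w x)) _ := Der_comp fd (gwd wJ) (fun x => gwI wJ).
have h := DerM (Der_exp (DerZ sg (rwd wJ))) (DerV (fun x xI => lt0r_neq0 (fg0 wJ xI)) fg).
apply: (Der_ext h) => x xI; rewrite /dm /m.
by field; rewrite gt_eqF ?fg0.
Qed.

Let dmc w : all J w -> cI (dm w).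
Proof.
move=> wJ; case: ss => fd dfc _ _ _; have gI x := @gwI w x wJ.
apply: cIM; first exact: Der_cI (md wJ).
apply: cIB; first exact: cIZ (drwc wJ).
apply: cIM; last first.
  apply: cIV (cI_comp fc (gwc wJ) gI) => x xI; by rewrite gt_eqF ?fg0.
by apply: cIM (cI_comp dfc (gwc wJ) gI) _; exact: cIZ (lwc wJ).
Qed.

Let ald w : all J w -> DerC (al w) (dal w).
Proof.
move=> wJ.
exact: DerCM (DerC_real (md wJ)) (DerC_comp vd (gwd wJ) (fun x => gwI wJ)).
Qed.

Let alc w : all J w -> cIC (al w).
Proof. by move=> wJ; exact: DerC_cIC (ald wJ). Qed.

Let dalc w : all J w -> cIC (dal w).
Proof.
move=> wJ; have gI x := @gwI w x wJ.
apply: cICD; first exact: cICM (cIC_real (dmc wJ)) (cIC_comp vc (gwc wJ) gI).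
apply: cICM (cIC_real (Der_cI (md wJ))) _.
apply: cICM (cIC_comp dvc (gwc wJ) gI); apply: cIC_real; exact: cIZ (lwc wJ).
Qed.

Let lw_leC w x : all J w -> inI x -> lw w x <= C.
Proof.
move=> wJ xI; apply: le_trans (lw_contract wJ xI) _.
rewrite -[leRHS]mulr1 ler_wpM2l//; first by apply: le_trans c1.
by apply: exprn_ile1; apply: ltW; [exact: q0|exact: q1].
Qed.

Let dm_le w x : all J w -> inI x -> dm w x ^+ 2 <= K3 ^+ 2 * m w x ^+ 2.
Proof.
move=> wJ xI; rewrite /dm exprMn mulrC ler_wpM2r ?sqr_ge0//.
rewrite -[leLHS]real_normK ?num_real// ler_pXn2r ?nnegrE//; last first.
  by rewrite /K3 mulr_ge0 ?(ltW k0)// addr_ge0 ?mulr_ge0 ?(le_trans ler01 c1).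
case: ss => _ _ _ dfB _; have gI := gwI wJ xI.
apply: le_trans (ler_normB _ _) _; rewrite /K3 mulrDr mulr1; apply: lerD.
  by rewrite normrM -[leRHS]mul1r ler_pM// drwB.
rewrite !normrM sw_norm// mul1r normfV (gtr0_norm (fg0 wJ xI)) (gtr0_norm (lw_gt0 wJ xI)).
rewrite ler_pdivrMr ?fg0//.
have h1 := dfB _ gI; have h2 := lw_leC wJ xI.
apply: le_trans (ler_pM _ _ h1 h2) _ => //; first by rewrite ltW ?lw_gt0.
by rewrite le_eqVlt; apply/orP; left; apply/eqP; ring.
Qed.

Let expsg w x : w \in [:: w1; w2] -> inI x ->
  expR (2 * sg * rw w x) <= 2 /\ 1 / 2 <= expR (- (2 * sg * rw w x)).
Proof.
move=> wi' xI; have [wJ _] := wi wi'; have r0 := rw_ge0 wJ xI.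
have h : expR (2 * sg * rw w x) <= 2.
  by apply: le_trans (roof_le wi' xI); rewrite ler_expR ler_wpM2r ?ler_norm.
split => //; rewrite expRN div1r lef_pV2 ?posrE ?expR_gt0//.
Qed.

(** Of the two factors [lw w x], one is kept to form a single term of the sum [L0], the other is at
    most C q^N and supplies the smallness. *)
Let tail_le w x : w \in [:: w1; w2] -> inI x ->
  m w x ^+ 2 * lw w x ^+ 2 * csq (dv (gw w x)) <=
  (2 * (C * q ^+ N) * (expR (2 * K1) / F0)) * iter N (L0 A) (dens f (fun x => csq (dv x))) x.
Proof.
move=> wi' xI; have [wJ wN] := wi wi'; have l0 := lw_gt0 wJ xI; have f0 := fg0 wJ xI.
have wA : w \in words A N by move: wi'; rewrite !inE => /orP[]/eqP->.
have h1 : lw w x * dens f (fun x => csq (dv x)) (gw w x) <=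
    iter N (L0 A) (dens f (fun x => csq (dv x))) x.
  rewrite L0E (big_rem w)//= lerDl big_seq sumr_ge0// => w' /mem_rem /(wordsJ AB) w'J.
  rewrite mulr_ge0 ?(ltW (lw_gt0 w'J xI))// /dens divr_ge0 ?csq_ge0//.
  exact: ltW (fg0 w'J xI).
have -> : m w x ^+ 2 * lw w x ^+ 2 * csq (dv (gw w x)) =
   (expR (2 * sg * rw w x) * lw w x * (f (gw w x))^-1) *
   (lw w x * dens f (fun x => csq (dv x)) (gw w x)).
  rewrite /m /dens (_ : 2 * sg * rw w x = sg * rw w x + sg * rw w x); last ring.
  by rewrite expRD; field; rewrite gt_eqF.
have [e1 _] := expsg wi' xI.
apply: ler_pM h1.
- by rewrite !mulr_ge0 ?expR_ge0 ?invr_ge0// ltW.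
- by rewrite mulr_ge0 ?(ltW l0)// /dens divr_ge0 ?csq_ge0// ltW.
apply: ler_pM (f_geF (gwI wJ xI)); rewrite ?invr_ge0 ?(ltW f0)//.
  by rewrite mulr_ge0 ?expR_ge0// ltW.
by apply: ler_pM e1 _; rewrite ?expR_ge0 ?(ltW l0)// -wN lw_contract.
Qed.

Let itg_dal w : w \in [:: w1; w2] ->
  itg (fun x => csq (dal w x)) <= 2 * K3 ^+ 2 * itg (fun x => csq (al w x))
  + 2 * (2 * (C * q ^+ N) * (expR (2 * K1) / F0)) * energy f dv.
Proof.
move=> wi'; have [wJ wN] := wi wi'.
have dc := dens_cI ss (cI_csq dvc).
set c := 2 * (C * q ^+ N) * (expR (2 * K1) / F0).
apply: (@le_trans _ _ (2 * K3 ^+ 2 * itg (fun x => csq (al w x))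
   + 2 * c * itg (iter N (L0 A) (dens f (fun x => csq (dv x)))))); last first.
  rewrite lerD2l ler_wpM2l//.
    have e0 := expR_ge0 (2 * K1).
    rewrite /c !mulr_ge0 ?invr_ge0 ?exprn_ge0 ?(ltW F00)//; first exact: le_trans ler01 c1.
    exact: ltW (q0 B).
  by apply: (itg_L0 AB) => // x xI; rewrite divr_ge0 ?csq_ge0// ltW ?f_gt0.
apply: itg_le_lin2; [exact/cI_csq/dalc|exact/cI_csq/alc|exact: L0_cI|move=> x xI].
apply: le_trans (csqD_le _ _) _; rewrite !csqM !csq_real.
have h1 := dm_le wJ xI; have h2 := tail_le wi' xI.
have h1' := ler_wpM2r (csq_ge0 (v (gw w x))) h1.
have h2' : m w x ^+ 2 * ((sw w * lw w x) ^+ 2 * csq (dv (gw w x))) <= c *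
    iter N (L0 A) (dens f (fun x => csq (dv x))) x.
  apply: le_trans h2; rewrite [leLHS]mulrA.
  have -> : (sw w * lw w x) ^+ 2 = lw w x ^+ 2; last by [].
  by rewrite -[LHS]real_normK ?num_real// normrM sw_norm// mul1r real_normK ?num_real.
move: h1' h2'; rewrite -[leRHS]mulrA.
move: (dm w x ^+ 2 * _) (m w x ^+ 2 * (_ * _)) (m w x ^+ 2 * csq _) => a1 a2 a3.
by move=> h1' h2'; lra.
Qed.

Let p w x : R := wr (2 * sg) w x * f (gw w x).
Let z w x : R[i] := cis (- (t * rw w x)) * al w x.

Let p_ge0 w x : all J w -> inI x -> 0 <= p w x.
Proof. by move=> wJ xI; rewrite mulr_ge0 ?(ltW (wr_gt0 _ wJ xI))// ltW// fg0. Qed.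

Let pz w x : all J w -> inI x -> (p w x)%:C * z w x = wc s w x * v (gw w x).
Proof.
move=> wJ xI.
have -> : wc s w x = (expR (- (sg * rw w x)) * lw w x)%:C * cis (- (t * rw w x)).
  rewrite /wc expcE cReN cImN cReM cImM /= !mulr0 subr0 add0r rmorphM /=; ring.
rewrite /z /al.
have -> : expR (- (sg * rw w x)) * lw w x = p w x * m w x.
  rewrite /p /m /wr (_ : - (2 * sg * rw w x) = - (sg * rw w x) - sg * rw w x); last ring.
  rewrite expRD (expRN (sg * rw w x)); field.
  by rewrite !lt0r_neq0 ?expR_gt0 ?fg0.
rewrite (rmorphM _ (p w x) (m w x)) /=; ring.
Qed.

Let csq_z w x : csq (z w x) = csq (al w x).
Proof. by rewrite csqM csq_cis mul1r. Qed.

Let p_csq w x : all J w -> inI x ->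
  p w x * csq (z w x) = lw w x * dens f (fun x => csq (v x)) (gw w x).
Proof.
move=> wJ xI; rewrite csq_z /al csqM csq_real /dens /p /m /wr.
rewrite (_ : - (2 * sg * rw w x) = - (sg * rw w x) - sg * rw w x); last ring.
rewrite expRD (expRN (sg * rw w x)); field.
by rewrite !lt0r_neq0 ?expR_gt0 ?fg0.
Qed.

Let Q x : R := iter N (L0 A) (dens f (fun x => csq (v x))) x.
(** The Cauchy-Schwarz defect of the terms [z w], measured against the reference word w2. *)
Let V x : R := \sum_(w <- words A N) p w x * csq (z w x - z w2 x).

Let zc w : all J w -> cIC (z w).
Proof.
by move=> wJ; apply: cICM (alc wJ); apply: cIC_cis; apply: cIN; exact: cIZ (rwc wJ).
Qed.

Let pc w : all J w -> cI (p w).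
Proof.
move=> wJ; apply: cIM (cI_comp fc (gwc wJ) (fun x => gwI wJ)).
exact: Der_cI (wrd _ wJ).
Qed.

Let w2i : w2 \in [:: w1; w2]. Proof. by rewrite !inE eqxx orbT. Qed.
Let w1i : w1 \in [:: w1; w2]. Proof. by rewrite !inE eqxx. Qed.

Let Vc : cI V.
Proof.
have [w2J _] := wi w2i.
apply: cI_sum_in => w /(wordsJ AB) wJ; apply: cIM (pc wJ) _.
apply: cI_csq; apply: cICD (zc wJ) _; exact: cICN (zc w2J).
Qed.

Let V_ge0 x : inI x -> 0 <= V x.
Proof.
move=> xI; apply: (sum_words_ge0 AB) => w wJ.
by rewrite mulr_ge0 ?csq_ge0 ?p_ge0.
Qed.

Let cp0 : 0 < cp.
Proof. by rewrite /cp divr_gt0// mulr_gt0 ?expR_gt0. Qed.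

Let cp1 : cp <= 1.
Proof.
rewrite /cp ler_pdivrMr// mul1r; have : expR (- (2 * K1)) <= 1.
  by rewrite expR_le1 oppr_le0 mulr_ge0// ltW.
by move=> e1; have := ler_wpM2r (expR_ge0 (- (2 * K1))) mn1; rewrite mul1r; lra.
Qed.

Let p_ge w x : w \in [:: w1; w2] -> inI x -> cp * f x <= p w x.
Proof.
move=> wi' xI; have [wJ _] := wi wi'; have [_ e1] := expsg wi' xI.
have h1 := lw_ge wi' xI; have gI := gwI wJ xI; have h2 := f_comp xI gI.
have f0 := f_gt0 xI.
rewrite /cp /p /wr mulrC (_ : f x * _ = 1 / 2 * mn * (expR (- (2 * K1)) * f x)); last first.
  by field.
apply: ler_pM; rewrite ?mulr_ge0 ?expR_ge0 ?(ltW mn0) ?(ltW f0)//.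
  by apply: ler_pM; rewrite ?(ltW mn0).
by rewrite expRN mulrC ler_pdivrMr ?expR_gt0// mulrC.
Qed.

Let Q_le_energy : itg Q <= energy f v.
Proof.
apply: (itg_L0 AB); first exact (dens_cI ss (cI_csq vc)).
by move=> x xI; rewrite divr_ge0 ?csq_ge0// ltW ?f_gt0.
Qed.

Let Qc : cI Q.
Proof. by apply: (L0_cI AB); exact (dens_cI ss (cI_csq vc)). Qed.

Let Qc0 : cI (dens f (fun x => csq (v x))).
Proof. exact (dens_cI ss (cI_csq vc)). Qed.

Let QE x : inI x -> Q x = \sum_(w <- words A N) p w x * csq (z w x).
Proof.
by move=> xI; rewrite /Q L0E; apply: eq_big_seq => w /(wordsJ AB) wJ; rewrite p_csq.
Qed.

Let sum_p_le x : inI x -> \sum_(w <- words A N) p w x <= l ^+ N * f x.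
Proof. by move=> xI; rewrite -LrE; exact: supersolution_iter ss xI. Qed.

Let new_energy_le : energy f (iter N (Lc A s) v) <= l ^+ N * itg Q + - cp * itg V.
Proof.
apply: itg_le_lin2; [|exact: Qc|exact: Vc|move=> x xI].
  by exact (dens_cI ss (cI_csq (Lcc AB s N vc))).
have p0 w : w \in words A N -> 0 <= p w x by move=> /(wordsJ AB) wJ; exact: p_ge0.
have := csq_sum_CS_defect (z^~ x) p0 w2A; rewrite -QE// -/(V x).
rewrite (eq_big_seq (fun w => wc s w x * v (gw w x))); last first.
  by move=> w /(wordsJ AB) wJ; rewrite pz.
rewrite -LcE /dens ler_pdivrMr ?f_gt0// => /le_trans; apply.
have Q0 : 0 <= Q x by rewrite QE// big_seq sumr_ge0// => w /p0 ?; rewrite mulr_ge0 ?csq_ge0.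
have h1 := ler_wpM2r Q0 (sum_p_le xI); have h2 := ler_wpM2r (V_ge0 xI) (p_ge w2i xI).
by move: h1 h2; lra.
Qed.

Let X : R := itg (fun x => csq (al w2 x)).
Let Y : R := itg (fun x => csq (al w1 x - cis (t * (rw w1 x - rw w2 x)) * al w2 x)).

(** Every term is close to the reference term up to its defect, |z w|^2 <= 2 |z w - z w2|^2 + 2 |z
    w2|^2, so the energy is controlled by V and by the single amplitude of w2. *)
Let Q_le : itg Q <= 2 * itg V + (4 * (expR (2 * K1) * F0)) * X.
Proof.
have [w2J _] := wi w2i.
apply: itg_le_lin2; [exact: Qc|exact: Vc|exact/cI_csq/alc|move=> x xI].
have S0 := csq_ge0 (al w2 x).
apply: (@le_trans _ _ (2 * V x + 2 * (\sum_(w <- words A N) p w x) * csq (al w2 x))).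
  rewrite QE// -csq_z -mulrA mulr_suml !mulr_sumr -big_split /=.
  apply: (le_sum_words AB) => w wJ _.
  have := csqD_le (z w x - z w2 x) (z w2 x); rewrite subrK => h.
  by have := ler_wpM2l (p_ge0 wJ xI) h; lra.
rewrite lerD2l ler_wpM2r// -[X in _ <= X * _](_ : 2 * 2 = _) -?mulrA; last by ring.
rewrite ler_wpM2l//; apply: le_trans (sum_p_le xI) _.
by apply: ler_pM (f_leF xI) => //; [rewrite exprn_ge0// (le_trans ler01 l1)|exact/ltW/f_gt0].
Qed.

(** Multiplication by a phase of modulus 1 turns the integrand of Y into |z w1 - z w2|^2, which
    occurs in V with the mass of w1. *)
Let Y_le : Y <= expR (2 * K1) / (cp * F0) * itg V.
Proof.
have [w1J _] := wi w1i; have [w2J _] := wi w2i.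
apply: itg_le_lin; [|exact: Vc|move=> x xI].
  apply: cI_csq; apply: cICD (alc w1J) _; apply: cICN; apply: cICM (alc w2J).
  by apply: cIC_cis; apply: cIZ; apply: cIB; exact: rwc.
have -> : csq (al w1 x - cis (t * (rw w1 x - rw w2 x)) * al w2 x) = csq (z w1 x - z w2 x).
  rewrite -[LHS]mul1r -(csq_cis (- (t * rw w1 x))) -csqM mulrBr.
  rewrite (mulrA _ (cis (t * _)) (al w2 x)) -cisD.
  by congr (csq (_ - cis _ * _)); ring.
have h1 : cp * f x * csq (z w1 x - z w2 x) <= V x.
  apply: (@le_trans _ _ (p w1 x * csq (z w1 x - z w2 x))).
    by apply: ler_wpM2r (p_ge w1i xI); exact: csq_ge0.
  rewrite /V (big_rem w1)//= lerDl big_seq sumr_ge0// => w /mem_rem /(wordsJ AB) wJ.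
  by rewrite mulr_ge0 ?csq_ge0 ?p_ge0.
have f0 := f_gt0 xI; have h2 := f_geF xI.
have -> : csq (z w1 x - z w2 x) = (f x)^-1 * cp^-1 * (cp * f x * csq (z w1 x - z w2 x)).
  by field; rewrite !gt_eqF.
apply: ler_pM h1.
- by apply: mulr_ge0; rewrite invr_ge0 ltW.
- by apply: mulr_ge0; [apply: mulr_ge0; exact: ltW|exact: csq_ge0].
rewrite (_ : expR (2 * K1) / (cp * F0) = expR (2 * K1) / F0 * cp^-1).
  by apply: ler_wpM2r => //; rewrite invr_ge0 ltW.
by rewrite invfM; ring.
Qed.

(** The oscillation bound says that a small Y forces the amplitude of w2 to be small unless the
    amplitudes vary. Their variation has a part absorbed because |t| is large, and a part coming
    from dv which the cone condition turns into q^N times the energy of v. *)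
Let X_le : energy f dv <= cc * t ^+ 2 * energy f v ->
  X <= C3 * Y + C4 * q ^+ N / F0 * energy f v.
Proof.
move=> cone; have [w1J _] := wi w1i; have [w2J _] := wi w2i.
have t0 : 0 < `|t| by rewrite -(pmulr_rgt0 _ k0) (lt_le_trans ltr01).
have thd : Der (fun x => t * (rw w1 x - rw w2 x)) (fun x => t * (drw w1 x - drw w2 x)).
  by apply: DerZ; apply: DerB; exact: rwd.
have phB x : inI x -> D * `|t| <= `|t * (drw w1 x - drw w2 x)| <= 2 * K1 * `|t|.
  move=> xI; rewrite normrM mulrC ler_pM2l// phase//= mulrC ler_pM2r//.
  apply: le_trans (ler_normB _ _) _; rewrite mulr_natl mulr2n.
  by apply: lerD; exact: drwB.
have K1n : K1 != 0 by rewrite lt0r_neq0.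
have tn : `|t| != 0 by rewrite lt0r_neq0.
(* The shift is the inverse of the largest speed 2 K1 |t| of the relative phase, which thus turns by
   at most 1 over it. *)
have tau1 : (2 * K1 * `|t|)^-1 <= 1 / 2.
  have h : 2 <= 2 * K1 * `|t| by have := t_K1; lra.
  by rewrite div1r lef_pV2 ?posrE ?(lt_le_trans _ h).
have tau0 : 0 < (2 * K1 * `|t|)^-1 by rewrite invr_gt0 mulr_gt0// mulr_gt0.
have Btau : 2 * K1 * `|t| * (2 * K1 * `|t|)^-1 <= 1.
  by rewrite mulfV// mulf_neq0// mulf_neq0.
have osc := oscillation_bound (ald w1J) (ald w2J) (dalc w1J) (dalc w2J) thd
  (mulr_gt0 D0 t0) phB tau0 tau1 Btau.
rewrite -/X -/Y in osc.
have h1 := itg_dal w1i; have h2 := itg_dal w2i; rewrite -/X in h2.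
have hX1 : itg (fun x => csq (al w1 x)) <= 2 * Y + 2 * X.
  apply: itg_le_lin2.
  - exact/cI_csq/alc.
  - apply: cI_csq; apply: cICD (alc w1J) _; apply: cICN; apply: cICM (alc w2J).
    by apply: cIC_cis; apply: cIZ; apply: cIB; exact: rwc.
  - exact/cI_csq/alc.
  move=> x _; set u := cis _ * _.
  have -> : csq (al w2 x) = csq u by rewrite /u (csqM (cis _)) csq_cis mul1r.
  by have := csqD_le (al w1 x - u) u; rewrite subrK.
have X0 : 0 <= X by apply: itg_ge0 => [|x _]; [exact/cI_csq/alc|exact: csq_ge0].
have Y0 : 0 <= Y.
  apply: itg_ge0 => [|x _]; last exact: csq_ge0.
  apply: cI_csq; apply: cICD (alc w1J) _; apply: cICN; apply: cICM (alc w2J).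
  by apply: cIC_cis; apply: cIZ; apply: cIB; exact: rwc.
set c' := 2 * (2 * (C * q ^+ N) * (expR (2 * K1) / F0)) in h1 h2.
have c'0 : 0 <= c'.
  rewrite /c'; have ? := expR_ge0 (2 * K1); have ? : 0 <= q ^+ N by rewrite exprn_ge0// ltW ?q0.
  have ? : 0 <= F0^-1 by rewrite invr_ge0 ltW.
  have ? : 0 <= C by apply: le_trans c1.
  by apply: mulr_ge0 => //; apply: mulr_ge0; apply: mulr_ge0 => //; apply: mulr_ge0.
have t20 : 0 < t ^+ 2 by rewrite -real_normK ?num_real// exprn_gt0.
have osc' : D ^+ 2 * t ^+ 2 * X <= 256 * K1 ^+ 2 * t ^+ 2 * Y
   + 32 * (itg (fun x => csq (dal w1 x)) + itg (fun x => csq (dal w2 x))).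
  have k : 0 <= 16 * K1 ^+ 2 * t ^+ 2.
    by rewrite mulr_ge0 ?(ltW t20)// mulr_ge0// sqr_ge0.
  have := ler_wpM2l k osc; set I1 := itg _; set I2 := itg _.
  rewrite -(real_normK (num_real t)) => osc2; apply: le_trans (le_trans osc2 _).
    rewrite le_eqVlt; apply/orP; left; apply/eqP; field.
    by rewrite K1n tn.
  rewrite le_eqVlt; apply/orP; left; apply/eqP; field.
  by rewrite K1n tn.
(* The amplitudes contribute 192 K3^2 X, at most half of the left-hand side D^2 t^2 X since 384 K3^2
   <= t^2 D^2. *)
have g1 := ler_wpM2r X0 t_large; have g2 := ler_wpM2r Y0 t_large.
have g3 := ler_wpM2l c'0 cone.
have g4 := ler_wpM2l (sqr_ge0 K3) hX1.
have E0 : 0 <= energy f v.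
  by apply: itg_ge0 => [|x xI]; [exact: Qc0|rewrite divr_ge0 ?csq_ge0// ltW ?f_gt0].
have fin : D ^+ 2 * X <= 2 * (256 * K1 ^+ 2 + D ^+ 2) * Y + 128 * c' * cc * energy f v.
  rewrite -(ler_pM2r t20).
  have g5 : 0 <= t ^+ 2 * D ^+ 2 * Y by apply: mulr_ge0 => //; apply: mulr_ge0; exact: sqr_ge0.
  move: osc' h1 h2 g1 g2 g3 g4 g5.
  move: (t ^+ 2) (D ^+ 2) (K3 ^+ 2) (K1 ^+ 2) => t2 D2 K32 K12.
  move: (itg (fun x => csq (al w1 x))) (itg (fun x => csq (dal w1 x))) => I1 I2.
  move: (itg (fun x => csq (dal w2 x))) (energy f v) (energy f dv) => I3 E E'.
  move: X Y (c') => x y c; lra.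
have D20 : 0 < D ^+ 2 by rewrite exprn_gt0.
rewrite -(ler_pM2l D20); apply: le_trans fin _.
rewrite le_eqVlt; apply/orP; left; apply/eqP; rewrite /C3 /C4 /c'; field.
by rewrite !lt0r_neq0.
Qed.

(** [key] bounds the integral of Q by C5 times the defect plus a quarter of the old energy. Spending
    the whole loss cp V to cancel the fraction cp / C5 of Q therefore gains cp / C5, of which that
    quarter gives back 1/4. *)
Lemma energy_contraction : energy f dv <= cc * t ^+ 2 * energy f v ->
  energy f (iter N (Lc A s) v) <= (l ^+ N - 3 / 4 * (cp / C5)) * energy f v.
Proof.
move=> /X_le hX.
have e0 := expR_gt0 (2 * K1).
have C30 : 0 <= C3.
  by apply: divr_ge0 (sqr_ge0 D); have := sqr_ge0 K1; have := sqr_ge0 D; lra.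
have C5_2 : 2 <= C5.
  have e4 : 0 <= 4 * expR (4 * K1) by have := expR_gt0 (4 * K1); lra.
  by rewrite /C5 lerDl divr_ge0 ?(ltW cp0)// mulr_ge0.
have C50 : 0 < C5 by apply: lt_le_trans C5_2.
have E0 : 0 <= energy f v.
  by apply: itg_ge0 => [|x xI]; [exact: Qc0|rewrite divr_ge0 ?csq_ge0// ltW ?f_gt0].
have key : itg Q <= C5 * itg V + 1 / 4 * energy f v.
  apply: le_trans Q_le _.
  have k : 0 <= 4 * (expR (2 * K1) * F0) by rewrite !mulr_ge0 ?ltW.
  have h1 := ler_wpM2l k hX; have h2 := ler_wpM2l (mulr_ge0 k C30) Y_le.
  have h3 := ler_wpM2r E0 N_large.
  have e1 : 4 * (expR (2 * K1) * F0) * C3 * (expR (2 * K1) / (cp * F0) * itg V)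
     = (C5 - 2) * itg V.
    rewrite /C5 (_ : 4 * K1 = 2 * K1 + 2 * K1) ?expRD; last ring.
    by field; rewrite !lt0r_neq0.
  have e2 : 4 * (expR (2 * K1) * F0) * (C3 * Y + C4 * q ^+ N / F0 * energy f v)
     = 4 * (expR (2 * K1) * F0) * C3 * Y + 4 * expR (2 * K1) * C4 * q ^+ N * energy f v.
    by field; rewrite lt0r_neq0.
  rewrite e2 in h1; rewrite e1 in h2.
  move: h1 h2 h3; move: (4 * _ * X) (_ * C3 * Y) => a1 a2.
  move: (expR _) (C4) (q ^+ N) (energy f v) (itg V) (C5) => a3 a4 a5 a6 a7 a8; lra.
apply: le_trans new_energy_le _.
have k1 : 0 <= cp / C5 by rewrite divr_ge0 ?ltW.
have k2 : cp / C5 <= 1 by rewrite ler_pdivrMr// mul1r; apply: le_trans cp1 _; lra.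
have lN1 : 1 <= l ^+ N by apply: exprn_ege1.
have h1 := ler_wpM2l k1 key.
have e1 : cp / C5 * (C5 * itg V + 1 / 4 * energy f v) =
    cp * itg V + cp / C5 * (1 / 4 * energy f v) by field; rewrite lt0r_neq0.
have h2 : (l ^+ N - cp / C5) * itg Q <= (l ^+ N - cp / C5) * energy f v.
  by apply: ler_wpM2l Q_le_energy; rewrite subr_ge0; exact: le_trans lN1.
rewrite e1 in h1; rewrite mulNr; move: h1 h2.
move: (cp / C5) (l ^+ N) (itg Q) (cp * itg V) (energy f v) => d L IQ cW E h1 h2; lra.
Qed.

End cancellation.

(** * From the energy to the supremum *)

Section smoothing.
(** A continuous function takes its mean value somewhere, and from there it moves by at most its
    total variation. *)
Lemma sup_le_itg (G dG H : R -> R) x : Der G dG -> cI H ->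
  (forall y, inI y -> `|dG y| <= H y) -> inI x -> G x <= itg G + itg H.
Proof.
move=> Gd Hc GH xI; have [y yI <-] := itg_mean (Der_cI Gd).
have H0 z : inI z -> 0 <= H z by move=> /GH; apply: le_trans.
have mono (u u' : R) : inI u -> inI u' -> u <= u' -> `|G u' - G u| <= prim H u' - prim H u.
  move=> uI uI' uu; rewrite ler_norml; apply/andP; split.
    have := Der_nondecreasing (DerD (Der_prim Hc) Gd) _ uI uI' uu.
    have h z : inI z -> 0 <= H z + dG z by move=> /GH; rewrite ler_norml => /andP[h _]; lra.
    by move=> /(_ h); lra.
  have := Der_nondecreasing (DerB (Der_prim Hc) Gd) _ uI uI' uu.
  have h z : inI z -> 0 <= H z - dG z by move=> /GH; rewrite ler_norml => /andP[_ h]; lra.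
  by move=> /(_ h); lra.
suff : `|G x - G y| <= itg H by rewrite ler_norml => /andP[_]; lra.
have [xy|/ltW yx] := leP x y.
  by rewrite distrC; apply: le_trans (mono _ _ xI yI xy) _; exact: prim_increment.
by apply: le_trans (mono _ _ yI xI yx) _; exact: prim_increment.
Qed.

Section alphabet.
Variable A : seq nat.
Hypothesis AB : alphabet A.

(** In the derivative of the iterate, the Jacobians contribute K1 times the iterate itself and the
    inner derivatives gain C q^n. Then [sup_le_itg] applies, and [itg_L0] removes the iterates from
    the integrals. *)
Lemma L0_sup n (g dg gt : R -> R) x : Der g dg -> cI gt ->
  (forall y, inI y -> 0 <= g y) -> (forall y, inI y -> `|dg y| <= gt y) -> inI x ->
  iter n (L0 A) g x <= (1 + K1) * itg g + C * q ^+ n * itg gt.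
Proof.
move=> gd gtc g0 dgt xI.
pose dG x := \sum_(w <- words A n)
  (dlw w x * g (gw w x) + lw w x * (dg (gw w x) * (sw w * lw w x))).
have Gd : Der (iter n (L0 A) g) dG.
  rewrite (_ : iter _ _ _ = fun x => \sum_(w <- words A n) lw w x * g (gw w x)).
    apply: Der_sum_in => w /(wordsJ AB) wJ.
    exact: DerM (lwd wJ) (Der_comp gd (gwd wJ) (fun x => gwI wJ)).
  by apply/funext => y; rewrite L0E.
have gc := Der_cI gd.
have c1 := L0_cI AB (n:=n) gc; have c2 := L0_cI AB (n:=n) gtc.
have gt0 y : inI y -> 0 <= gt y by move=> /dgt; apply: le_trans.
pose H x := K1 * iter n (L0 A) g x + C * q ^+ n * iter n (L0 A) gt x.
have Hc : cI H by apply: cID; exact: cIZ.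
have GH y : inI y -> `|dG y| <= H y.
  move=> yI; apply: le_trans (ler_norm_sum _ _ _) _.
  rewrite /H !L0E !mulr_sumr -big_split /=; apply: (le_sum_words AB) => w wJ wn.
  have gI := gwI wJ yI; have l0 := lw_gt0 wJ yI.
  apply: le_trans (ler_normD _ _) _; rewrite !normrM sw_norm// mul1r.
  rewrite (gtr0_norm l0) (ger0_norm (g0 _ gI)); apply: lerD.
    by rewrite mulrA; apply: ler_wpM2r; [exact: g0|exact: dlwB].
  rewrite mulrCA [leRHS]mulrC -[leRHS]mulrA -wn.
  have h1 := dgt _ gI; have h2 := lw_contract wJ yI.
  have h3 : `|dg (gw w y)| * lw w y <= gt (gw w y) * (C * q ^+ size w).
    by apply: ler_pM => //; exact: ltW.
  by have := ler_wpM2l (ltW l0) h3; lra.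
apply: le_trans (sup_le_itg Gd Hc GH xI) _.
rewrite (itgD (cIZ _ c1) (cIZ _ c2)) !itgZ// addrA -[X in X + _ + _]mul1r -mulrDl.
apply: lerD; apply: ler_wpM2l; rewrite ?itg_L0//.
  by rewrite addr_ge0// ltW ?K1_gt0.
by rewrite mulr_ge0 ?exprn_ge0 ?(ltW (q0 B))// (le_trans ler01)// C1.
Qed.

Variables (l : R) (l1 : 1 <= l) (s : R[i]) (f df : R -> R).
Local Notation t := (complex.Im s).
Hypothesis ss : supersolution A (2 * complex.Re s) l f df.
Hypotheses (sg1 : `|complex.Re s| <= 1) (t1 : 1 <= `|t|).

Let f_gt0 x : inI x -> 0 < f x.
Proof. by case: ss => _ _ f1 _ _ /f1; exact: lt_le_trans. Qed.
Let k0 : 0 < K1. Proof. exact: K1_gt0. Qed.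
Let c1 : 1 <= C. Proof. exact: C1. Qed.
Let t0 : 0 < `|t|. Proof. exact: lt_le_trans t1. Qed.

Lemma normc_s_le : normc s + 1 <= 3 * `|t|.
Proof.
have h : normc s <= 2 * `|t|.
  rewrite normc_le ?mulr_ge0// /csq exprMn real_normK ?num_real//.
  have h1 : complex.Re s ^+ 2 <= 1.
    by rewrite -[leLHS]real_normK ?num_real// expr_le1.
  have h2 : 1 <= t ^+ 2 by rewrite -[leRHS]real_normK ?num_real// exprn_ege1.
  by rewrite !expr2 in h1 h2 *; lra.
by move: t1 h; lra.
Qed.

(** [L0_sup] is applied to |v|^2 / f. Through 2 c d <= |t| c^2 + d^2 / |t| the derivative of this
    function has integral of order |t| G, and m is large enough for q^m to cancel |t|. *)
Lemma sup_smoothing (cc G : R) m v dv x : 0 <= cc -> DerC v dv -> cIC dv ->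
  energy f v <= G -> energy f dv <= cc * t ^+ 2 * G -> q ^+ m * `|t| <= 1 -> inI x ->
  csq (iter m (Lc A s) v x) <=
    l ^+ m * f x * ((1 + K1 + C * (1 + 2 * K1 + cc)) * G).
Proof.
move=> cc0 vd dvc EG E'G qm xI; have vc := DerC_cIC vd.
have lm : 0 <= l ^+ m by rewrite exprn_ge0// (le_trans ler01).
apply: le_trans (csq_Lc_le AB l1 ss m v xI) _.
rewrite ler_wpM2l ?mulr_ge0 ?(ltW (f_gt0 xI))//.
have [fd _ _ dfB _] := ss.
have [v1 v2] := vd.
have csqd : Der (fun x => csq (v x))
    (fun x => 2 * (complex.Re (v x) * complex.Re (dv x) + complex.Im (v x) * complex.Im (dv x))).
  have h := DerD (DerM v1 v1) (DerM v2 v2).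
  rewrite (_ : (fun x => csq (v x)) = fun x => complex.Re (v x) * complex.Re (v x)
     + complex.Im (v x) * complex.Im (v x)); last by apply/funext => y; rewrite /csq !expr2.
  by apply: (Der_ext h) => y _; ring.
have gd := DerM csqd (DerV (fun x xI => lt0r_neq0 (f_gt0 xI)) fd).
have dc1 := dens_cI ss (cI_csq vc); have dc2 := dens_cI ss (cI_csq dvc).
pose gt x := (`|t| + 2 * K1) * dens f (fun x => csq (v x)) x
   + `|t|^-1 * dens f (fun x => csq (dv x)) x.
have gtc : cI gt by apply: cID; exact: cIZ.
have E0 : 0 <= energy f v := energy_ge0 ss vc.
have G0 : 0 <= G := le_trans E0 EG.
have e1 : itg gt <= (1 + 2 * K1 + cc) * `|t| * G.
  rewrite (itgD (cIZ _ dc1) (cIZ _ dc2)) !itgZ// -/(energy f v) -/(energy f dv).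
  have h1 : `|t|^-1 * energy f dv <= cc * `|t| * G.
    rewrite mulrC ler_pdivrMr//; apply: le_trans E'G _.
    by rewrite -(real_normK (num_real t)) le_eqVlt; apply/orP; left; apply/eqP; ring.
  have k : 0 <= `|t| + 2 * K1 by move: k0 t0; lra.
  have h2 := ler_wpM2l k EG.
  have h3 : 0 <= (`|t| - 1) * (K1 * G).
    by apply: mulr_ge0; [rewrite subr_ge0|apply: mulr_ge0 => //; exact: ltW].
  by move: h1 h2 h3; move: (energy f v) (energy f dv) => E E'; lra.
apply: le_trans (L0_sup m gd gtc _ _ xI) _.
- by move=> y yI; rewrite divr_ge0 ?csq_ge0// ltW ?f_gt0.
- move=> y yI; have f0 := f_gt0 yI.
  have -> : 2 * (complex.Re (v y) * complex.Re (dv y) + complex.Im (v y) * complex.Im (dv y)) / f y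
     + csq (v y) * (- df y / f y ^+ 2) =
     (2 * (complex.Re (v y) * complex.Re (dv y) + complex.Im (v y) * complex.Im (dv y))
      - csq (v y) * (df y / f y)) / f y by field; rewrite lt0r_neq0.
  rewrite normrM (ger0_norm (x := (f y)^-1)) ?invr_ge0 ?(ltW f0)//.
  rewrite (_ : gt y = ((`|t| + 2 * K1) * csq (v y) + `|t|^-1 * csq (dv y)) / f y); last first.
    by rewrite /gt /dens; ring.
  rewrite ler_wpM2r ?invr_ge0 ?(ltW f0)//; apply: le_trans (ler_normB _ _) _.
  have h1 : `|2 * (complex.Re (v y) * complex.Re (dv y) + complex.Im (v y) * complex.Im (dv y))|
      <= `|t| * csq (v y) + `|t|^-1 * csq (dv y).
    rewrite /csq; set a := complex.Re (v y); set b := complex.Im (v y).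
    set a' := complex.Re (dv y); set b' := complex.Im (dv y); have := t0; set u := `|t| => u0.
    have e2 (c d : R) : `|2 * (c * d)| <= u * c ^+ 2 + u^-1 * d ^+ 2.
      have E1 := sqr_ge0 (u * c - d); have E2 := sqr_ge0 (u * c + d).
      have -> : u * c ^+ 2 + u^-1 * d ^+ 2 = (u ^+ 2 * c ^+ 2 + d ^+ 2) / u.
        by field; rewrite lt0r_neq0.
      rewrite ler_pdivlMr// -{1}(gtr0_norm u0) -normrM ler_norml.
      by rewrite !expr2 in E1 E2 *; apply/andP; split; lra.
    rewrite mulrDr; apply: le_trans (ler_normD _ _) _.
    by have := e2 a a'; have := e2 b b'; lra.
  have h2 : `|csq (v y) * (df y / f y)| <= 2 * K1 * csq (v y).
    rewrite normrM (ger0_norm (csq_ge0 _)) mulrC ler_wpM2r ?csq_ge0//.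
    by rewrite normrM normfV (gtr0_norm f0) ler_pdivrMr// dfB.
  by move: h1 h2; lra.
rewrite -/(energy f v) [leRHS]mulrDl; apply: lerD.
  by rewrite ler_wpM2l// addr_ge0// ltW.
have cm : 0 <= C * q ^+ m by rewrite mulr_ge0 ?exprn_ge0 ?(ltW (q0 B))// (le_trans ler01 c1).
apply: le_trans (ler_wpM2l cm e1) _.
have k : 0 <= C * ((1 + 2 * K1 + cc) * G).
  have h : 0 <= 1 + 2 * K1 + cc by move: k0 cc0; lra.
  by apply: mulr_ge0; [exact: le_trans c1|exact: mulr_ge0].
by have := ler_wpM2l k qm; lra.
Qed.

End alphabet.
End smoothing.

(** * Decay of the energies and of the norm *)

Section decay.
Variable A : seq nat.
Hypothesis AB : alphabet A.
Variables (l : R) (l1 : 1 <= l) (s : R[i]) (f df f2 df2 : R -> R).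
Local Notation t := (complex.Im s).
Hypothesis ss : supersolution A (2 * complex.Re s) l f df.
Hypothesis ss2 : supersolution A (complex.Re s) l f2 df2.
Hypotheses (sg1 : `|complex.Re s| <= 1) (t1 : 1 <= `|t|).

Let k0 : 0 < K1. Proof. exact: K1_gt0. Qed.
Let c1 : 1 <= C. Proof. exact: C1. Qed.
Let q0 : 0 < q. Proof. exact: q0. Qed.
Let q1 : q < 1. Proof. exact: q1. Qed.
Let t0 : 0 < `|t|. Proof. exact: lt_le_trans t1. Qed.
Let l0 : 0 < l. Proof. exact: lt_le_trans l1. Qed.
Let f_gt0 x : inI x -> 0 < f x.
Proof. by case: ss => _ _ f1 _ _ /f1; exact: lt_le_trans. Qed.
Let C0 : 0 <= C. Proof. exact: le_trans c1. Qed.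

(** Supremum bounds involve the sum of the weights at sigma itself, hence the second supersolution
    [f2]; the energies use the one at 2 sigma. *)
Lemma Lc_bounds n v dv (a b : R) x : inI x -> 0 <= a -> 0 <= b ->
  (forall y, inI y -> normc (v y) <= a) -> (forall y, inI y -> normc (dv y) <= b) ->
  normc (iter n (Lc A s) v x) <= expR (2 * K1) * l ^+ n * a /\
  normc (dLc A s n v dv x) <=
    expR (2 * K1) * l ^+ n * (3 * `|t| * K1 * a + C * q ^+ n * b).
Proof.
move=> xI a0 b0 va dvb.
have sumB u (d : R) : 0 <= d -> (forall y, inI y -> normc (u y) <= d) ->
    \sum_(w <- words A n) wr (complex.Re s) w x * normc (u (gw w x)) <=
    expR (2 * K1) * l ^+ n * d.
  move=> d0 ud; apply: (@le_trans _ _ (\sum_(w <- words A n) wr (complex.Re s) w x * d)).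
    apply: (le_sum_words AB) => w wJ _.
    by rewrite ler_wpM2l ?(ltW (wr_gt0 _ wJ xI))// ud// gwI.
  by rewrite -mulr_suml ler_wpM2r//; exact: (sum_wr_le AB l1 n ss2 xI).
have h1 := sumB v a a0 va; have h2 := sumB dv b b0 dvb.
split; first exact: le_trans (normc_Lc AB s n v xI) h1.
apply: le_trans (normc_dLc AB n v dv xI (normc_s_le sg1 t1)) _.
have e1 : 0 <= 3 * `|t| * K1 by rewrite mulr_ge0 ?(ltW k0).
have e2 : 0 <= C * q ^+ n by rewrite mulr_ge0// exprn_ge0// ltW.
by have := ler_wpM2l e1 h1; have := ler_wpM2l e2 h2; lra.
Qed.

Variables (N : nat) (cc c : R).
Hypotheses (c0 : 0 < c) (c_half : c <= 1 / 2) (lN : l ^+ N <= 1 + c / 2).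
Hypotheses (cc_ge : 72 * K1 ^+ 2 + 1 <= cc) (N_large : 8 * (C * q ^+ N) ^+ 2 <= 1).
Hypothesis contraction : forall v dv, DerC v dv -> cIC dv ->
  energy f dv <= cc * t ^+ 2 * energy f v ->
  energy f (iter N (Lc A s) v) <= (l ^+ N - c) * energy f v.

Let cct : 0 < cc * t ^+ 2.
Proof.
rewrite mulr_gt0 -?(real_normK (num_real t)) ?exprn_gt0//.
by apply: lt_le_trans cc_ge; have := sqr_ge0 K1; lra.
Qed.

(** The constants in [cc_ge] and [N_large] come from here: 72 K1^2 is 4 times 2 (3 K1)^2, and 8 is 4
    times 2, so each of the two Lasota-Yorke terms is at most a quarter of cc t^2 G. *)
Let energy_step v dv (G : R) : DerC v dv -> cIC dv ->
  energy f v <= G -> energy f dv <= cc * t ^+ 2 * G ->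
  energy f (iter N (Lc A s) v) <= l ^+ N * G /\
  energy f (dLc A s N v dv) <= l ^+ N * (cc * t ^+ 2) * G / 2.
Proof.
move=> vd dvc EG E'G; have vc := DerC_cIC vd.
have lN0 : 0 <= l ^+ N by rewrite exprn_ge0// ltW.
split.
  by apply: le_trans (energy_Lc AB l1 ss N vc) _; rewrite ler_wpM2l.
apply: le_trans (energy_dLc AB l1 ss N vc dvc (normc_s_le sg1 t1)) _.
rewrite (_ : l ^+ N * (cc * t ^+ 2) * G / 2 = l ^+ N * (cc * t ^+ 2 * G / 2)); last by ring.
rewrite ler_wpM2l//.
have E0 := energy_ge0 ss vc; have E'0 := energy_ge0 ss dvc.
have h1 := ler_wpM2r E'0 N_large.
have t2 : 0 <= t ^+ 2 by exact: sqr_ge0.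
have e1 : (3 * `|t| * K1) ^+ 2 = 9 * t ^+ 2 * K1 ^+ 2.
  by rewrite -(real_normK (num_real t)); ring.
rewrite e1.
have h2 := ler_wpM2l t2 cc_ge; have h3 := ler_wpM2r (le_trans E0 EG) h2.
have h4 : t ^+ 2 * K1 ^+ 2 * energy f v <= t ^+ 2 * K1 ^+ 2 * G.
  by rewrite ler_wpM2l// mulr_ge0 ?sqr_ge0.
have h5 : 0 <= t ^+ 2 * G by rewrite mulr_ge0// (le_trans E0).
move: h1 h3 h4 h5 E'G; move: (t ^+ 2) (K1 ^+ 2) (energy f v) (energy f dv).
by move: ((C * q ^+ N) ^+ 2) => a1 a2 a3 a4 a5; lra.
Qed.

(** G bounds the energy of v and, in units of cc t^2, that of v'. In a block of 2N steps, the first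
    N bring the second bound down to l^N G / 2. If the cone condition then holds, the next N steps
    contract; if it fails, the energy of v is itself below l^N G / 2, and growth by l^N does no
    harm. *)
Lemma energy_decay j v dv (G : R) : DerC v dv -> cIC dv ->
  energy f v <= G -> energy f dv <= cc * t ^+ 2 * G ->
  exists dv', [/\ DerC (iter (j * (N + N)) (Lc A s) v) dv', cIC dv',
    energy f (iter (j * (N + N)) (Lc A s) v) <= (1 - c ^+ 2 / 4) ^+ j * G &
    energy f dv' <= cc * t ^+ 2 * ((1 - c ^+ 2 / 4) ^+ j * G)].
Proof.
move=> vd dvc EG E'G; elim: j => [|j [u' [ud uc EU EU']]].
  by exists dv; rewrite expr0 mul1r.
rewrite mulSn iterD; set u := iter (j * (N + N)) _ v in ud EU EU' *.
set Gj := (1 - c ^+ 2 / 4) ^+ j * G in EU EU'.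
have uc' := DerC_cIC ud.
have [E1 E1'] := energy_step ud uc EU EU'.
have ud1 := Lcd AB s N ud; have udc1 := dLcc AB s N uc' uc.
have lN0 : 0 < l ^+ N by rewrite exprn_gt0.
have lN1 : 1 <= l ^+ N by exact: exprn_ege1.
have Gj0 : 0 <= Gj := le_trans (energy_ge0 ss uc') EU.
have E1b : energy f (dLc A s N u u') <= cc * t ^+ 2 * (l ^+ N * Gj).
  apply: le_trans E1' _; have : 0 <= l ^+ N * (cc * t ^+ 2) * Gj.
    by apply: mulr_ge0 => //; apply: mulr_ge0; exact: ltW.
  by lra.
have [E2 E2'] := energy_step ud1 udc1 E1 E1b.
exists (dLc A s N (iter N (Lc A s) u) (dLc A s N u u')).
have ud2 := Lcd AB s N ud1; have udc2 := dLcc AB s N (DerC_cIC ud1) udc1.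
(* The second bound is (1 + c/2)(1 - c/2), the value reached at l^N = 1 + c/2; the first has room to
   spare because c <= 1/2. *)
have gam : l ^+ N * l ^+ N / 2 <= 1 - c ^+ 2 / 4 /\ l ^+ N * (l ^+ N - c) <= 1 - c ^+ 2 / 4.
  move: lN0 lN1 lN; move: (l ^+ N) => L L0 L1 LN; rewrite !expr2.
  have h1 : 0 <= (1 + c / 2 - L) * (1 + c / 2 + L) by apply: mulr_ge0; move: c0; lra.
  have h2 : 0 <= (1 / 2 - c) * c by apply: mulr_ge0; move: c0 c_half; lra.
  have h3 : 0 <= (1 + c / 2 - L) * (L + 1 - c / 2) by apply: mulr_ge0; move: c0 c_half; lra.
  by split; move: c0 c_half; lra.
have [gam1 gam2] := gam.
rewrite exprS -mulrA -/Gj iterD; split => //.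
- have [cone|ncone] := leP (energy f (dLc A s N u u')) (cc * t ^+ 2 * energy f (iter N (Lc A s) u)).
    apply: le_trans (contraction ud1 udc1 cone) _.
    have k : 0 <= l ^+ N - c by rewrite subr_ge0 (le_trans _ lN1)//; move: c_half; lra.
    apply: le_trans (ler_wpM2l k E1) _.
    by have := ler_wpM2r Gj0 gam2; lra.
  apply: le_trans (energy_Lc AB l1 ss N (DerC_cIC ud1)) _.
  have : energy f (iter N (Lc A s) u) <= l ^+ N * Gj / 2.
    rewrite -(ler_pM2l cct); apply: le_trans (ltW ncone) _.
    by apply: le_trans E1' _; rewrite le_eqVlt; apply/orP; left; apply/eqP; ring.
  move=> h; have := ler_wpM2l (ltW lN0) h; have := ler_wpM2r Gj0 gam1.
  by move: (energy f _) => E; lra.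
apply: le_trans E2' _; have := ler_wpM2l (ltW cct) (ler_wpM2r Gj0 gam1).
by move: (cc * t ^+ 2) => d; lra.
Qed.

Let C6 : R := 1 + K1 + C * (1 + 2 * K1 + cc).

(* After m smoothing steps with q^m |t| <= 1 the energy controls the supremum. *)
Lemma sup_decay m v dv (a : R) x : DerC v dv -> cIC dv -> 0 <= a ->
  (forall y, inI y -> normc (v y) <= a) ->
  (forall y, inI y -> normc (dv y) <= `|t| * a) ->
  q ^+ m * `|t| <= 1 -> inI x ->
  csq (iter (m + m * (N + N)) (Lc A s) v x) <=
    expR (4 * K1) * C6 * (l * (1 - c ^+ 2 / 4)) ^+ m * a ^+ 2.
Proof.
move=> vd dvc a0 va dva qm xI; have vc := DerC_cIC vd.
have [fd _ _ dfB _] := ss.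
have f_comp y z : inI y -> inI z -> f y <= expR (2 * K1) * f z.
  apply: (loglip _ fd _ dfB); first by rewrite mulr_ge0 ?(ltW k0).
  by move=> w /f_gt0/ltW.
have F0 : 0 < f 0 by apply/f_gt0/inI0.
have cc1 : 1 <= cc by apply: le_trans cc_ge; have := sqr_ge0 K1; lra.
have en u (d : R) : cIC u -> 0 <= d -> (forall y, inI y -> normc (u y) <= d) ->
    energy f u <= expR (2 * K1) / f 0 * d ^+ 2.
  move=> uc d0 ud; rewrite -[leRHS]itg_cst; apply: itg_le.
  - by have := dens_cI ss (cI_csq uc).
  - exact: cI_cst.
  move=> y yI; have fy := f_gt0 yI; rewrite /dens ler_pdivrMr//.
  have h1 : csq (u y) <= d ^+ 2 by rewrite -normc_le// ud.
  apply: le_trans h1 _; rewrite mulrAC ler_peMl ?sqr_ge0//.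
  by rewrite mulrAC ler_pdivlMr// mul1r; apply: f_comp => //; exact: inI0.
set G := expR (2 * K1) / f 0 * a ^+ 2.
have EG : energy f v <= G by exact: en.
have E'G : energy f dv <= cc * t ^+ 2 * G.
  apply: le_trans (en _ _ dvc _ dva) _; first by rewrite mulr_ge0.
  rewrite exprMn (real_normK (num_real t)) /G.
  have h : 0 <= t ^+ 2 * (expR (2 * K1) / f 0 * a ^+ 2).
    by rewrite mulr_ge0 ?sqr_ge0// mulr_ge0 ?sqr_ge0// divr_ge0 ?expR_ge0// ltW.
  by have := ler_wpM2r h cc1; lra.
have [u' [ud uc EU EU']] := energy_decay m vd dvc EG E'G.
rewrite iterD.
have sm := sup_smoothing AB l1 ss t1 (le_trans ler01 cc1) ud uc EU EU' qm xI.
apply: le_trans sm _.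
rewrite -/C6 exprMn /G.
have C60 : 0 <= C6.
  rewrite /C6 addr_ge0//; first by move: k0; lra.
  by rewrite mulr_ge0//; move: k0 cc1; lra.
have g0 : 0 <= (1 - c ^+ 2 / 4) ^+ m.
  rewrite exprn_ge0// expr2.
  have : 0 <= (1 / 2 - c) * (c + 1 / 2) by apply: mulr_ge0; move: c0 c_half; lra.
  by lra.
have h : f x / f 0 <= expR (2 * K1).
  by rewrite ler_pdivrMr//; apply: f_comp => //; exact: inI0.
have k : 0 <= l ^+ m * C6 * (1 - c ^+ 2 / 4) ^+ m * expR (2 * K1) * a ^+ 2.
  rewrite mulr_ge0 ?sqr_ge0// mulr_ge0 ?expR_ge0// mulr_ge0// mulr_ge0//.
  by rewrite exprn_ge0// ltW.
have := ler_wpM2l k h.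
rewrite (_ : 4 * K1 = 2 * K1 + 2 * K1) ?expRD; last by ring.
by lra.
Qed.

Let gam_ge0 : 0 <= 1 - c ^+ 2 / 4.
Proof.
rewrite expr2; have : 0 <= (1 / 2 - c) * (c + 1 / 2) by apply: mulr_ge0; move: c0 c_half; lra.
by lra.
Qed.

Let C8 : R := expR (2 * K1) * (1 + 3 * K1).
Let Cst : R := expR (2 * K1) * (1 + 3 * K1 + C).

Let C80 : 0 < C8.
Proof. by rewrite /C8 mulr_gt0 ?expR_gt0//; move: k0; lra. Qed.

Lemma norm_growth n v dv (a : R) x : inI x -> 0 <= a ->
  (forall y, inI y -> normc (v y) <= a) -> (forall y, inI y -> normc (dv y) <= `|t| * a) ->
  normc (iter n (Lc A s) v x) <= Cst * l ^+ n * a /\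
  normc (dLc A s n v dv x) <= Cst * l ^+ n * (`|t| * a).
Proof.
move=> xI a0 va dva; have ta0 : 0 <= `|t| * a by rewrite mulr_ge0.
have [h1 h2] := Lc_bounds n xI a0 ta0 va dva.
have e0 := expR_gt0 (2 * K1); have ln0 : 0 < l ^+ n by rewrite exprn_gt0.
have qn : q ^+ n <= 1 by apply: exprn_ile1; exact: ltW.
have k : 0 <= expR (2 * K1) * l ^+ n by rewrite mulr_ge0 ?ltW.
split.
  apply: le_trans h1 _; rewrite /Cst.
  have := mulr_ge0 (mulr_ge0 k a0) (_ : 0 <= 3 * K1 + C).
  have h : 0 <= 3 * K1 + C by move: k0 c1; lra.
  by move=> /(_ h); lra.
apply: le_trans h2 _.
rewrite (_ : Cst * l ^+ n * (`|t| * a) =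
  expR (2 * K1) * l ^+ n * ((1 + 3 * K1 + C) * (`|t| * a))); last by rewrite /Cst; ring.
rewrite ler_wpM2l//.
have := ler_wpM2l (mulr_ge0 C0 ta0) qn; move: ta0; lra.
Qed.

(** Two runs of n1 steps. The first brings the supremum below [eta]; during the second the
    derivative forgets its size at rate q^n1 and inherits the smallness of the supremum. [eta] is
    such that the growth of the second run brings it back to a / 8. *)
Lemma norm_decay m v dv (a g' q' : R) x : DerC v dv -> cIC dv -> 0 <= a ->
  (forall y, inI y -> normc (v y) <= a) ->
  (forall y, inI y -> normc (dv y) <= `|t| * a) ->
  q ^+ m * `|t| <= 1 ->
  l ^+ (4 * N + 3) * (1 - c ^+ 2 / 4) <= g' -> q * l ^+ 2 <= q' -> q' <= 1 ->
  64 * C8 ^+ 2 * (expR (4 * K1) * C6) * g' ^+ m <= 1 ->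
  8 * C * expR (2 * K1) * Cst * q' ^+ m <= 1 ->
  let n1 := (m + m * (N + N))%N in
  inI x ->
  normc (iter (n1 + n1) (Lc A s) v x) <= a / 4 /\
  normc (dLc A s n1 (iter n1 (Lc A s) v) (dLc A s n1 v dv) x) <= `|t| * a / 4.
Proof.
move=> vd dvc a0 va dva qm gg' qq' q'1 g'm q'm n1 xI.
have e0 := expR_gt0 (2 * K1).
have ln0 : 0 < l ^+ n1 by rewrite exprn_gt0.
pose eta := a / (8 * C8 * l ^+ n1).
have d0 : 0 < 8 * C8 * l ^+ n1 by rewrite mulr_gt0// mulr_gt0.
have eta0 : 0 <= eta by rewrite divr_ge0// ltW.
have ta0 : 0 <= `|t| * a by rewrite mulr_ge0.
have u_le y : inI y -> normc (iter n1 (Lc A s) v y) <= eta.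
  move=> yI; rewrite normc_le//; apply: le_trans (sup_decay vd dvc a0 va dva qm yI) _.
  rewrite /eta expr_div_n ler_pdivlMr ?exprn_gt0//.
  have -> : expR (4 * K1) * C6 * (l * (1 - c ^+ 2 / 4)) ^+ m * a ^+ 2 * (8 * C8 * l ^+ n1) ^+ 2
     = (64 * C8 ^+ 2 * (expR (4 * K1) * C6)) * (l ^+ (4 * N + 3) * (1 - c ^+ 2 / 4)) ^+ m * a ^+ 2.
    have -> : (l ^+ (4 * N + 3) * (1 - c ^+ 2 / 4)) ^+ m =
       (l ^+ n1) ^+ 2 * (l * (1 - c ^+ 2 / 4)) ^+ m.
      rewrite !exprMn -!exprM mulrA -exprD; congr (_ ^+ _ * _).
      exact: decay_exponent.
    by ring.
  rewrite -[leRHS]mul1r ler_wpM2r ?sqr_ge0//; apply: le_trans g'm.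
  have C60 : 0 <= C6.
    have cc1 : 1 <= cc by apply: le_trans cc_ge; have := sqr_ge0 K1; lra.
    rewrite /C6 addr_ge0//; first by move: k0; lra.
    by rewrite mulr_ge0//; move: k0 cc1; lra.
  apply: ler_wpM2l.
    apply: mulr_ge0; first by apply: mulr_ge0 => //; exact: sqr_ge0.
    by apply: mulr_ge0 => //; exact: expR_ge0.
  have lg0 : 0 <= l ^+ (4 * N + 3) * (1 - c ^+ 2 / 4).
    by apply: mulr_ge0 => //; apply: exprn_ge0; exact: ltW.
  have g'0 : 0 <= g' := le_trans lg0 gg'.
  by apply: lerXn2r gg'; rewrite nnegrE.
have Cst0 : 0 <= Cst by rewrite /Cst mulr_ge0 ?(ltW e0)//; move: k0 c1; lra.
have b0 : 0 <= Cst * l ^+ n1 * (`|t| * a) by rewrite mulr_ge0// mulr_ge0// ltW.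
have du_le y : inI y -> normc (dLc A s n1 v dv y) <= Cst * l ^+ n1 * (`|t| * a).
  by move=> yI; have [] := norm_growth n1 yI a0 va dva.
have [h1 h2] := Lc_bounds n1 xI eta0 b0 u_le du_le.
have e1 : expR (2 * K1) * (1 + 3 * K1) * l ^+ n1 * eta = a / 8.
  by rewrite /eta /C8; field; rewrite !lt0r_neq0//; move: k0; lra.
have e2 : 0 <= expR (2 * K1) * l ^+ n1 * eta.
  by apply: mulr_ge0 => //; apply: mulr_ge0; exact: ltW.
have e3 : 0 <= expR (2 * K1) * l ^+ n1 * eta * K1 by rewrite mulr_ge0// ltW.
have ql0 : 0 <= q * l ^+ 2.
  by apply: mulr_ge0; [exact: ltW|exact: sqr_ge0].
have q'0 : 0 <= q' by exact: le_trans qq'.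
(* In this term the derivative grows by l^n1 in each of the two runs, while the contraction q^n1 of
   the second run alone is used. *)
have e4 : q ^+ n1 * l ^+ n1 * l ^+ n1 <= q' ^+ m.
  have h : (q * l ^+ 2) ^+ n1 <= q' ^+ n1 by apply: lerXn2r qq'; rewrite nnegrE.
  have -> : q ^+ n1 * l ^+ n1 * l ^+ n1 = (q * l ^+ 2) ^+ n1.
    by rewrite exprMn -exprM mulnC exprM expr2 mulrA.
  apply: le_trans h _; rewrite /n1 exprD ler_piMr ?exprn_ge0//.
  exact: exprn_ile1.
rewrite iterD; split; first by apply: le_trans h1 _; move: e1 e2 e3 a0; lra.
apply: le_trans h2 _.
have k : 0 <= expR (2 * K1) * C * Cst * (`|t| * a).
  by rewrite mulr_ge0// mulr_ge0// mulr_ge0// ltW.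
have h3 := ler_wpM2l k e4; have h4 := ler_wpM2r ta0 q'm.
have h5 : expR (2 * K1) * l ^+ n1 * eta * (3 * K1) <= a / 8 by move: e1 e2; lra.
have h6 := ler_wpM2l (ltW t0) h5.
by move: h3 h4 h6; move: (q' ^+ m) (l ^+ n1) (q ^+ n1) => a1 a2 a3; lra.
Qed.

End decay.

(** * Choice of constants, uniform in the alphabet *)

Section uniform_estimate.
Definition uniform_phase : Prop := exists D : R, exists n0 : nat, 0 < D /\
  forall n, (n0 <= n)%N -> exists w1 w2, [/\ all J w1, all J w2,
    size w1 = n /\ size w2 = n &
    forall x, inI x -> D <= `|drw w1 x - drw w2 x|].

Let k0 : 0 < K1. Proof. exact: K1_gt0. Qed.
Let c1 : 1 <= C. Proof. exact: C1. Qed.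
Let q0 : 0 < q. Proof. exact: q0. Qed.
Let q1 : q < 1. Proof. exact: q1. Qed.

(** Derivatives are measured by Lipschitz bounds, which pass to pointwise limits; together with the
    uniformity over all alphabets containing A0 this transfers the estimates to infinitely many
    branches. *)
Definition controlled (A0 : seq nat) (Cst l e t0 : R) (Mf : R -> nat) : Prop :=
  forall A s v dv (a : R), alphabet A -> {subset A0 <= A} ->
    `|complex.Re s| <= e -> t0 <= `|complex.Im s| ->
    DerC v dv -> cIC dv -> 0 <= a ->
    (forall y, inI y -> normc (v y) <= a) ->
    (forall y, inI y -> normc (dv y) <= `|complex.Im s| * a) ->
    (forall n x y, inI x -> inI y ->
      normc (iter n (Lc A s) v x) <= Cst * l ^+ n * a /\
      normc (iter n (Lc A s) v x - iter n (Lc A s) v y)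
        <= Cst * l ^+ n * (`|complex.Im s| * a) * `|x - y|) /\
    (forall x y, inI x -> inI y ->
      normc (iter (Mf (complex.Im s)) (Lc A s) v x) <= a / 4 /\
      normc (iter (Mf (complex.Im s)) (Lc A s) v x - iter (Mf (complex.Im s)) (Lc A s) v y)
        <= `|complex.Im s| * a / 4 * `|x - y|).

Let cc : R := 72 * K1 ^+ 2 + 1.

Let cc1 : 1 <= cc.
Proof. by rewrite /cc; have := sqr_ge0 K1; lra. Qed.

(** N and c depend on the phase condition and on the two words, not on l, so that l may afterwards
    be chosen in terms of them. The phase condition is available for all large lengths with the same
    D, hence N can also be taken large enough for the smallness conditions on q^N. *)
Lemma energy_contraction_uniform : uniform_phase ->
  exists N c A0 Rm U, [/\ 0 < c, c <= 1 / 2, 8 * (C * q ^+ N) ^+ 2 <= 1, all J A0 &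
    0 < Rm /\ forall A l s f df, alphabet A -> {subset A0 <= A} -> 1 <= l ->
      l ^+ N <= 2 -> `|complex.Re s| <= 1 -> `|2 * complex.Re s| * Rm <= ln 2 ->
      1 <= `|complex.Im s| -> U <= `|complex.Im s| ->
      supersolution A (2 * complex.Re s) l f df ->
      forall v dv, DerC v dv -> cIC dv ->
      energy f dv <= cc * complex.Im s ^+ 2 * energy f v ->
      energy f (iter N (Lc A s) v) <= (l ^+ N - c) * energy f v].
Proof.
move=> [D [n0 [D0 phase]]].
pose C4 : R := 512 * C * expR (2 * K1) * cc / D ^+ 2.
have C0 : 0 < C by exact: lt_le_trans c1.
have [N1 HN1] := geometric_small (8 * C ^+ 2) (ltW q0) q1 ltr01.
have [N2 HN2] := geometric_small (16 * expR (2 * K1) * C4) (ltW q0) q1 ltr01.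
pose N := maxn n0 (maxn N1 N2).
have [w1 [w2 [w1J w2J [w1N w2N] ph]]] := phase N (leq_maxl _ _).
have N1N : (N1 <= N)%N by rewrite /N !leq_max leqnn orbT.
have N2N : (N2 <= N)%N by rewrite /N !leq_max leqnn !orbT.
have NL1 : 8 * (C * q ^+ N) ^+ 2 <= 1.
  have qN : 0 <= q ^+ N <= 1 by rewrite exprn_ge0 ?exprn_ile1// ltW.
  case/andP: qN => qN0 qN1; have h1 := HN1 N N1N.
  have h2 : 0 <= 8 * C ^+ 2 * q ^+ N * (1 - q ^+ N).
    rewrite mulr_ge0 ?subr_ge0// mulr_ge0// mulr_ge0//; exact: sqr_ge0.
  by rewrite exprMn; move: h1 h2; move: (q ^+ N) => x; rewrite [x ^+ 2]expr2; lra.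
have NL2 := HN2 N N2N.
have [mn [mn0 mn1 mnB]] : exists mn : R, [/\ 0 < mn, mn <= 1 &
    forall w x, w \in [:: w1; w2] -> inI x -> mn <= lw w x].
  have [m1 m10 H1] := cI_pos_min (lwc w1J) (fun x => @lw_gt0 w1 x w1J).
  have [m2 m20 H2] := cI_pos_min (lwc w2J) (fun x => @lw_gt0 w2 x w2J).
  exists (Num.min 1 (Num.min m1 m2)); split.
  - by rewrite !lt_min ltr01 m10 m20.
  - by rewrite ge_min lexx.
  - by move=> w x; rewrite !inE => /orP[]/eqP-> xI; rewrite !ge_min (H1, H2) ?orbT.
have [Rm Rm0 RmB] : exists2 Rm : R, 0 < Rm &
    forall w x, w \in [:: w1; w2] -> inI x -> rw w x <= Rm.
  have [m1 m10 H1] := cI_bounded (rwc w1J); have [m2 m20 H2] := cI_bounded (rwc w2J).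
  exists (m1 + m2); first by rewrite addr_gt0.
  move=> w x; rewrite !inE => /orP[]/eqP-> xI; apply: le_trans (ler_norm _) _.
    by apply: le_trans (H1 x xI) _; lra.
  by apply: le_trans (H2 x xI) _; lra.
pose C3 : R := 2 * (256 * K1 ^+ 2 + D ^+ 2) / D ^+ 2.
pose cp : R := mn * expR (- (2 * K1)) / 2.
pose C5 : R := 2 + 4 * expR (4 * K1) * C3 / cp.
have cp0 : 0 < cp by rewrite /cp divr_gt0// mulr_gt0 ?expR_gt0.
have cp_half : cp <= 1 / 2.
  have : expR (- (2 * K1)) <= 1 by rewrite expR_le1 oppr_le0 mulr_ge0// ltW.
  move=> e1; have := ler_wpM2r (expR_ge0 (- (2 * K1))) mn1; rewrite mul1r /cp; lra.
have C52 : 2 <= C5.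
  have C30 : 0 <= C3.
    by apply: divr_ge0 (sqr_ge0 D); have := sqr_ge0 K1; have := sqr_ge0 D; lra.
  have e4 : 0 <= 4 * expR (4 * K1) by have := expR_gt0 (4 * K1); lra.
  by rewrite /C5 lerDl divr_ge0 ?(ltW cp0)// mulr_ge0.
pose c : R := 3 / 4 * (cp / C5).
have c0 : 0 < c by rewrite /c mulr_gt0// divr_gt0//; lra.
have c_half : c <= 1 / 2.
  have : cp / C5 <= 1 / 2 by rewrite ler_pdivrMr; lra.
  by rewrite /c; lra.
pose K3 : R := K1 * (1 + 2 * C).
exists N, c, (w1 ++ w2), Rm, (Num.max K1^-1 (384 * K3 ^+ 2 / D ^+ 2)); split => //.
  by rewrite all_cat w1J w2J.
split => // A l s f df AB sub l1 lN2 sg1 roofb t1; rewrite ge_max => /andP[tK' tD'] ss.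
set t := complex.Im s in t1 tK' tD' *.
have w1A : w1 \in words A N.
  by rewrite -w1N; apply: words_mem => i iw; apply: sub; rewrite mem_cat iw.
have w2A : w2 \in words A N.
  by rewrite -w2N; apply: words_mem => i iw; apply: sub; rewrite mem_cat iw orbT.
have roof w x : w \in [:: w1; w2] -> inI x -> expR (`|2 * complex.Re s| * rw w x) <= 2.
  move=> wi xI; rewrite -[leRHS]lnK ?posrE// ler_expR; apply: le_trans roofb.
  by apply: ler_wpM2l => //; exact: RmB.
have tD : 384 * K3 ^+ 2 <= t ^+ 2 * D ^+ 2.
  move: tD'; rewrite ler_pdivrMr ?exprn_gt0// => /le_trans; apply.
  by rewrite ler_wpM2r ?sqr_ge0// -(real_normK (num_real t)) expr2 ler_peMl.
have tK : 1 <= K1 * `|t|.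
  by move: tK'; rewrite -[K1^-1]mul1r ler_pdivrMr// mulrC.
move=> v dv vd dvc.
have H := energy_contraction AB l1 ss w1A w2A D0 mn0 mn1 ph mnB
      roof sg1 lN2 tD tK NL2 vd dvc.
exact: H.
Qed.

Lemma uniform_control (alpha : R) : 0 < alpha -> uniform_phase ->
  exists A0 Cst l e t0 Mf, [/\ 1 <= Cst, 1 <= l, 0 < e, 1 <= t0 &
    [/\ all J A0, controlled A0 Cst l e t0 Mf &
      forall t, t0 <= `|t| -> (0 < Mf t)%N /\
        4 * Cst * (Mf t)%:R * l ^+ Mf t <= `|t| `^ alpha]].
Proof.
move=> al0 /energy_contraction_uniform.
move=> [N [c [A0 [Rm [U [c0 c_half NL1 A0J [Rm0 contr]]]]]]].
pose gam : R := 1 - c ^+ 2 / 4.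
have c20 : 0 < c ^+ 2 by rewrite exprn_gt0.
have gam0 : 0 < gam.
  by rewrite /gam expr2; have := ler_pM (ltW c0) (ltW c0) c_half c_half; lra.
have gam1 : gam < 1 by rewrite /gam; lra.
(* Halfway between the true rates and 1, to leave room for powers of l. *)
pose g' : R := (1 + gam) / 2; pose q' : R := (1 + q) / 2.
have g'0 : 0 <= g' by rewrite /g'; lra.
have g'1 : g' < 1 by rewrite /g'; lra.
have q'0 : 0 <= q' by rewrite /q'; move: q0; lra.
have q'1 : q' < 1 by rewrite /q'; move: q1; lra.
pose C8 : R := expR (2 * K1) * (1 + 3 * K1).
pose C6 : R := 1 + K1 + C * (1 + 2 * K1 + cc).
pose Cst : R := expR (2 * K1) * (1 + 3 * K1 + C).
have Cst1 : 1 <= Cst.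
  rewrite /Cst -[leLHS]mulr1 ler_pM//; last by move: k0 c1; lra.
  by rewrite -expR0 ler_expR mulr_ge0// ltW.
have [m1 Hm1] := geometric_small (64 * C8 ^+ 2 * (expR (4 * K1) * C6)) g'0 g'1 ltr01.
have [m2 Hm2] := geometric_small (8 * C * expR (2 * K1) * Cst) q'0 q'1 ltr01.
pose kap : R := - ln q.
have kap0 : 0 < kap by rewrite /kap oppr_gt0 ln_lt0// q0 q1.
(* The total number of iterations is 2 (1 + 2N) m, and m is at most ln |t| times the last factor
   once ln |t| >= 1; so it is at most B2 ln |t|. *)
pose B2 : R := 2 * (1 + 2 * N%:R) * (kap^-1 + 1 + (maxn m1 m2)%:R).
have B20 : 0 < B2.
  have h1 : 0 < 2 * (1 + 2 * N%:R) :> R by have := ler0n R N; lra.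
  have h2 : 0 < kap^-1 + 1 + (maxn m1 m2)%:R.
    have ki : 0 < kap^-1 by rewrite invr_gt0.
    by have := ler0n R (maxn m1 m2); lra.
  by rewrite /B2 mulr_gt0.
pose k := (4 * N + 3)%N.
(* The conditions on l bound l^N by 1 + c/2, l^k by g' / gam and l^2 by q' / q. None of these
   exponents exceeds k, so bounding l^k by the minimum meets all three. *)
pose b : R := Num.min (1 + c / 2) (Num.min (g' / gam) (q' / q)).
have b1 : 1 < b.
  rewrite /b !lt_min; apply/and3P; split; first by move: c0; lra.
    by rewrite ltr_pdivlMr// mul1r /g'; lra.
  by rewrite ltr_pdivlMr// mul1r /q'; move: q1; lra.
(* With l = expR y, the first term gives l^k <= b and the second makes l^(B2 ln |t|) at most
   |t|^(alpha/2). *)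
pose y : R := Num.min (ln b / k%:R) (alpha / (2 * B2)).
have k0' : 0 < k%:R :> R by rewrite ltr0n /k addnS.
have y0 : 0 < y by rewrite /y lt_min !divr_gt0// ?ln_gt0// mulr_gt0.
pose l := expR y.
have lE n : l ^+ n = expR (y * n%:R) by rewrite expRM_natr.
have l1 : 1 <= l by rewrite /l -expR0 ler_expR ltW.
have lk : l ^+ k <= b.
  rewrite lE -[leRHS]lnK ?posrE ?(lt_trans ltr01 b1)// ler_expR -ler_pdivlMr//.
  by rewrite /y ge_min lexx.
have lj j : (j <= k)%N -> l ^+ j <= b by move=> jk; apply: le_trans lk; exact: ler_weXn2l.
have lN : l ^+ N <= 1 + c / 2.
  by apply: le_trans (lj N _) _; [exact: leq_decay_exponent|rewrite /b ge_min lexx].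
have lg : l ^+ k * gam <= g'.
  rewrite -ler_pdivlMr//; apply: le_trans lk _.
  by rewrite /b !ge_min lexx orbT.
have lq : q * l ^+ 2 <= q'.
  rewrite mulrC -ler_pdivlMr//; apply: le_trans (lj 2 _) _; first exact: two_leq_decay_exponent.
  by rewrite /b !ge_min lexx !orbT.
have l1' : 1 < l by rewrite /l -expR0 ltr_expR.
have [e1 e10 [e11 sup_ex]] := supersolution_exists l1'.
have ln2 : 0 < ln 2 :> R by rewrite ln_gt0// ltr1n.
pose e := Num.min (e1 / 2) (ln 2 / (2 * Rm)).
have e0 : 0 < e by rewrite /e lt_min !divr_gt0// mulr_gt0.
have ee1 : e <= e1 / 2 by rewrite /e ge_min lexx.
have e1e1 : e <= e1 by apply: le_trans ee1 _; rewrite ler_pdivrMr// ler_peMr ?(ltW e10)// ler1n.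
have lN2 : l ^+ N <= 2.
  by apply: le_trans lN _; move: c_half; lra.
have eR : 2 * e * Rm <= ln 2.
  rewrite mulrAC -ler_pdivlMl ?mulr_gt0// mulrC.
  by rewrite /e ge_min lexx orbT.
have Cst0 : 0 < Cst by exact: lt_le_trans Cst1.
(* With u = ln |t|, the last bound gives 4 Cst B2 u <= (alpha u / 4)^2 <= expR (alpha u / 2): the
   linear factor in the number of iterations costs only the other half of the exponent alpha. *)
have [U0 [U01 UU UC]] : exists U0 : R, [/\ 1 <= U0, U <= U0 &
    64 * Cst * B2 / alpha ^+ 2 <= U0].
  exists (Num.max (Num.max 1 U) (64 * Cst * B2 / alpha ^+ 2)).
  by split; rewrite !le_max lexx ?orbT.
pose mt (t : R) := ((Num.truncn (ln `|t| / kap)).+1 + maxn m1 m2)%N.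
pose n1 (t : R) := (mt t + mt t * (N + N))%N.
exists A0, Cst, l, e, (expR U0), (fun t => n1 t + n1 t)%N; split => //.
  by rewrite -[leLHS]expR0 ler_expR (le_trans ler01 U01).
have tU (t : R) : expR U0 <= `|t| -> 0 < `|t| /\ U0 <= ln `|t|.
  move=> h; have tp : 0 < `|t| by apply: lt_le_trans h; exact: expR_gt0.
  by split => //; rewrite -ler_expR lnK.
have qmt (t : R) : expR U0 <= `|t| -> q ^+ mt t * `|t| <= 1.
  move=> /tU[tp tU0].
  have -> : q ^+ mt t = expR (- kap * (mt t)%:R) by rewrite expRM_natr /kap opprK lnK.
  rewrite -[X in _ * X <= _]lnK ?posrE// -expRD expR_le1.
  have : ln `|t| / kap <= (mt t)%:R.
    rewrite /mt natrD; apply: le_trans (ltW (truncnS_gt _)) _.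
    by rewrite lerDl.
  by rewrite ler_pdivrMr// mulNr mulrC addrC subr_le0.
split.
- by [].
- move=> A s v dv a AB sub sge tge vd dvc a0 va dva.
  set t := complex.Im s in tge dva *; have [tp tU0] := tU t tge.
  have tU1 : U0 <= `|t| by apply: le_trans tge; apply: le_trans (expR_ge1Dx _); rewrite lerDr.
  have t1 : 1 <= `|t| by exact: le_trans tU1.
  have sg1 : `|complex.Re s| <= 1 by apply: le_trans sge _; exact: le_trans e1e1 e11.
  have sg2 : `|2 * complex.Re s| <= e1 by rewrite normrM normr_nat mulrC -ler_pdivlMr// (le_trans sge).
  have [f [df ss]] := sup_ex A _ AB sg2.
  have [|f2 [df2 ss2]] := sup_ex A (complex.Re s) AB; first exact: le_trans sge e1e1.
  have roof : `|2 * complex.Re s| * Rm <= ln 2.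
    by apply: le_trans eR; rewrite ler_wpM2r ?(ltW Rm0)// normrM normr_nat ler_wpM2l.
  have cN := contr A l s f df AB sub l1 lN2 sg1 roof t1 (le_trans UU tU1) ss.
  have vc := DerC_cIC vd.
  split=> [n x z xI zI|x z xI zI].
    have [h1 _] := norm_growth AB l1 ss2 sg1 t1 n xI a0 va dva.
    split => //; apply: (DerC_lipschitz (Lcd AB s n vd) (dLcc AB s n vc dvc)) => //.
      by apply: mulr_ge0; [apply: mulr_ge0 (ltW Cst0) _; rewrite exprn_ge0// expR_ge0|
        exact: mulr_ge0].
    by move=> x' x'I; have [] := norm_growth AB l1 ss2 sg1 t1 n x'I a0 va dva.
  have qm := qmt t tge.
  have dec x' (x'I : inI x') := norm_decay AB l1 ss ss2 sg1 t1 c0 c_half lN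
    (lexx _) NL1 cN vd dvc a0 va dva qm lg lq (ltW q'1)
    (Hm1 _ (leq_trans (leq_maxl _ _) (leq_addl _ _)))
    (Hm2 _ (leq_trans (leq_maxr _ _) (leq_addl _ _))) x'I.
  have [h1 _] := dec x xI; split => //.
  rewrite {1 2}/n1 iterD.
  apply: (DerC_lipschitz (Lcd AB s _ (Lcd AB s _ vd))
    (dLcc AB s _ (Lcc AB s _ vc) (dLcc AB s _ vc dvc))) => //.
    by rewrite divr_ge0// mulr_ge0.
  by move=> x' x'I; have [] := dec x' x'I.
move=> t /tU[tp tU0]; split; first by rewrite /n1 /mt !addSn.
have u0 : 0 < ln `|t| by apply: lt_le_trans tU0; exact: lt_le_trans U01.
have mtB : (mt t)%:R <= ln `|t| * (kap^-1 + 1 + (maxn m1 m2)%:R).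
  rewrite /mt natrD -addn1 natrD !mulrDr; apply: lerD.
    apply: lerD; last by rewrite mulr1 (le_trans U01).
    by rewrite truncn_le divr_ge0 ?(ltW u0) ?(ltW kap0).
  by rewrite ler_peMl// (le_trans U01).
have MB : (n1 t + n1 t)%:R <= B2 * ln `|t|.
  rewrite /n1; move: mtB; move: (mt t) => p mtB; rewrite !natrD natrM natrD /B2.
  have h : 0 <= 2 * (1 + 2 * N%:R) :> R by have := ler0n R N; lra.
  by have := ler_wpM2l h mtB; lra.
pose u := ln `|t|; rewrite -/u in MB u0 tU0.
have lM : l ^+ (n1 t + n1 t) <= expR (alpha / 2 * u).
  rewrite lE ler_expR.
  have h1 : y * B2 <= alpha / 2.
    have h : y <= alpha / (2 * B2) by rewrite /y ge_min lexx orbT.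
    have e2 : alpha / 2 = alpha / (2 * B2) * B2 by field; rewrite lt0r_neq0.
    by rewrite e2 ler_wpM2r// ltW.
  by apply: le_trans (ler_wpM2l (ltW y0) MB) _; rewrite mulrA ler_wpM2r ?(ltW u0).
have -> : `|t| `^ alpha = expR (alpha / 2 * u) * expR (alpha / 2 * u).
  by rewrite -[`|t|]lnK ?posrE// -/u -expRM -expRD; congr expR; field.
have big : 4 * Cst * (B2 * u) <= expR (alpha / 2 * u).
  have -> : alpha / 2 * u = alpha / 4 * u + alpha / 4 * u by field.
  have au0 : 0 <= alpha / 4 * u by rewrite mulr_ge0 ?(ltW u0)// divr_ge0// ltW.
  have h1 : alpha / 4 * u <= expR (alpha / 4 * u).
    by apply: le_trans (expR_ge1Dx _); rewrite lerDr.
  rewrite expRD; apply: le_trans (ler_pM au0 au0 h1 h1).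
  have h2 : 64 * Cst * B2 / alpha ^+ 2 <= u by exact: le_trans tU0.
  move: h2; rewrite ler_pdivrMr ?exprn_gt0// => h2.
  rewrite (_ : 4 * Cst * (B2 * u) = 64 * Cst * B2 * (u / 16)); last by field.
  rewrite (_ : alpha / 4 * u * (alpha / 4 * u) = u * alpha ^+ 2 * (u / 16)); last by field.
  by rewrite ler_wpM2r// divr_ge0// ltW.
have Cst4 : 0 <= 4 * Cst by rewrite mulr_ge0// ltW.
apply: ler_pM lM.
- by rewrite mulr_ge0.
- by rewrite exprn_ge0// expR_ge0.
by apply: le_trans big; rewrite ler_wpM2l.
Qed.

End uniform_estimate.

End branch_system_theory.

(** * The space of C^1 functions and the Neumann series *)

Section relative_derivative.
Variable R : realType.
Implicit Types (f df F dF : R -> R) (x y : R).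

(** No point of I is isolated in I, which makes limits of slopes relative to I unique. *)
Lemma nbhs_I01 x : inI x -> ProperFilter (within (@I01 R) x^').
Proof.
move=> xI; apply: Build_ProperFilter_ex => P.
move=> /nbhs_ballP[e /= e0 He].
pose d := Num.min (e / 2) (1 / 2).
have d0 : 0 < d by rewrite /d lt_min; apply/andP; split; lra.
have de : d < e by rewrite /d gt_min; apply/orP; left; lra.
have d1 : d <= 1 / 2 by rewrite /d ge_min lexx orbT.
case/inIP: (xI) => x0 x1; have [xh|xh] := leP x (1 / 2).
  exists (x + d); apply: He.
  - by rewrite /ball /= opprD addrA subrr sub0r normrN gtr0_norm.
  - by apply/eqP; lra.
  - by apply/I01E/inIP; lra.
exists (x - d); apply: He.
- by rewrite /ball /= opprB addrCA subrr addr0 gtr0_norm.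
- by apply/eqP; lra.
- by apply/I01E/inIP; lra.
Qed.

Lemma nbhs_I01oo x : inI x -> ProperFilter (within `]0, 1[%classic (nbhs x)).
Proof.
move=> xI; apply: Build_ProperFilter_ex => P.
move=> /nbhs_ballP[e /= e0 He].
pose d := Num.min (e / 2) (1 / 4).
have d0 : 0 < d by rewrite /d lt_min; apply/andP; split; lra.
have de : d < e by rewrite /d gt_min; apply/orP; left; lra.
have d1 : d <= 1 / 4 by rewrite /d ge_min lexx orbT.
case/inIP: (xI) => x0 x1; have [xh|xh] := leP x (1 / 2).
  exists (x + d); apply: He.
  - by rewrite /ball /= opprD addrA subrr sub0r normrN gtr0_norm.
  - by rewrite /= in_itv /=; apply/andP; split; lra.
exists (x - d); apply: He.
- by rewrite /ball /= opprB addrCA subrr addr0 gtr0_norm.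
- by rewrite /= in_itv /=; apply/andP; split; lra.
Qed.

Lemma ext_eq (A : set R) (u phi : R -> R) x : ProperFilter (within A (nbhs x)) ->
  {for x, continuous phi} -> (forall y, A y -> u y = phi y) -> ext A u x = phi x.
Proof.
move=> PF phic e; apply/cvg_lim => //.
apply: (@cvg_trans _ (phi y @[y --> within A (nbhs x)])).
  apply: near_eq_cvg; rewrite near_withinE; near=> y => Ay; exact/esym/e.
by apply: cvg_trans phic; apply: cvg_app; exact: cvg_within.
Unshelve. all: by end_near. Qed.

Lemma compI_eq (u g phi : R -> R) x : inI x -> {for x, continuous phi} ->
  (forall y, 0 < y -> y < 1 -> u (g y) = phi y) -> compI u g x = phi x.
Proof.
move=> xI phic e; apply: ext_eq => //; first exact: nbhs_I01oo.
by move=> y; rewrite /= in_itv /= => /andP[y0 y1]; exact: e.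
Qed.

Lemma slope_cvg F dF x : Der F dF -> inI x ->
  slope F x y @[y --> within (@I01 R) x^'] --> dF x.
Proof.
move=> Fd xI; have [Fx e] := Fd x xI.
have h : slope F x y @[y --> x^'] --> dF x.
  apply/cvgrPdist_le => eps eps0.
  have /cvgrPdist_le /(_ eps eps0) H := (Fx : cvg _).
  rewrite -e; move: H => /nbhs_ballP[d /= d0 Hd].
  apply/nbhs_ballP; exists d => //= y xy yx.
  have := Hd (y - x); rewrite /ball /= sub0r normrN distrC => /(_ _ _).
  rewrite /= subr_eq0 => /(_ _ yx).
  rewrite /slope /derive /= [(y - x)%R *: _]/GRing.scale /= mulr1 subrK.
  rewrite [_^-1 *: _]/GRing.scale /= mulrC; apply.
  by move: xy; rewrite /ball /= distrC.
by apply: cvg_trans h; apply: cvg_app; exact: cvg_within.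
Qed.

Lemma derivI_eq f F dF x : Der F dF -> (forall y, inI y -> f y = F y) -> inI x ->
  slope f x y @[y --> within (@I01 R) x^'] --> dF x /\ derivI f x = dF x.
Proof.
move=> Fd fF xI; have PF := nbhs_I01 xI.
have h : slope f x y @[y --> within (@I01 R) x^'] --> dF x.
  apply: cvg_trans (slope_cvg Fd xI); apply: near_eq_cvg; rewrite near_withinE.
  by near=> y => /I01E yI; rewrite /slope !fF.
by split => //; apply/cvg_lim.
Unshelve. all: by end_near. Qed.

Lemma within_cI f : cI f -> {within @I01 R, continuous f}.
Proof.
move=> fc; apply: continuous_in_subspaceT => x; rewrite inE => /I01E; exact: fc.
Qed.

Lemma within_eq f g : (forall x, inI x -> f x = g x) -> {within @I01 R, continuous f} ->
  {within @I01 R, continuous g}.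
Proof.
move=> fg /subspace_continuousP fc; apply/subspace_continuousP => x xI.
apply: (@cvg_trans _ (f y @[y --> within (@I01 R) (nbhs x)])).
  apply: near_eq_cvg; rewrite near_withinE.
  by near=> y => /I01E yI; rewrite fg.
have e : f x = g x by apply/fg/I01E.
by rewrite /from_subspace -e; exact: fc.
Unshelve. all: by end_near. Qed.

Lemma Der_isC1 f F dF : Der F dF -> cI dF -> (forall x, inI x -> f x = F x) ->
  isC1 f /\ forall x, inI x -> derivI f x = dF x.
Proof.
move=> Fd dFc fF; have de x : inI x -> derivI f x = dF x.
  by move=> xI; have [] := derivI_eq Fd fF xI.
split=> //; split.
  by move=> x /I01E xI; have [h _] := derivI_eq Fd fF xI; apply/cvg_ex; exists (dF x).
by apply: within_eq (within_cI dFc) => x xI; rewrite de.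
Qed.

Lemma cI_clamp f : {within @I01 R, continuous f} ->
  cI (fun x => f (clamp x)).
Proof.
move=> /subspace_continuousP fc x xI.
have h : clamp y @[y --> x] --> within (@I01 R) (nbhs (clamp x)).
  move=> P; rewrite /= /within /= => HP.
  have h : \forall y \near x, I01 (clamp y) -> P (clamp y) := @continuous_clamp R x _ HP.
  suff : \forall y \near x, P (clamp y) by [].
  by apply: filterS h => y; apply; apply/I01E; exact: clampI.
have cx : @I01 R (clamp x) by apply/I01E; exact: clampI.
exact: (cvg_comp _ _ h (fc (clamp x) cx)).
Qed.

Lemma slope_eps f x (d : R) : slope f x y @[y --> within (@I01 R) x^'] --> d ->
  forall e, 0 < e -> exists2 dl, 0 < dl & forall y, inI y -> `|y - x| < dl ->
    `|f y - f x - d * (y - x)| <= e * `|y - x|.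
Proof.
move=> /cvgrPdist_le h e e0; have := h e e0.
move=> /nbhs_ballP[dl /= dl0 Hd]; exists dl => // y yI yx.
have [->|nyx] := eqVneq y x; first by rewrite !subrr mulr0 subrr normr0 mulr0.
have := Hd y; rewrite /ball /= distrC => /(_ yx nyx); rewrite I01E => /(_ yI).
rewrite distrC /slope => H.
have n0 : y - x != 0 by rewrite subr_eq0.
have -> : f y - f x - d * (y - x) = ((f y - f x) / (y - x) - d) * (y - x) by field.
by rewrite normrM ler_wpM2r.
Qed.

Lemma is_derive_eps f x (d : R) :
  (forall e, 0 < e -> exists2 dl, 0 < dl & forall y, `|y - x| < dl ->
    `|f y - f x - d * (y - x)| <= e * `|y - x|) -> is_derive x 1 f d.
Proof.
move=> H.
have h : (fun t => t^-1 *: ((f \o shift x) (t *: 1) - f x)) @ 0^' --> d.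
  apply/cvgrPdist_le => e e0; have [dl dl0 Hd] := H e e0.
  apply/nbhs_ballP; exists dl => //= t; rewrite /ball /= sub0r normrN => tdl t0.
  rewrite /= [t *: _]/GRing.scale /= mulr1 [_^-1 *: _]/GRing.scale /=.
  have := Hd (t + x); rewrite addrK => /(_ tdl) h1.
  rewrite distrC -(ler_pM2r (_ : 0 < `|t|)) ?normr_gt0// -normrM.
  by apply: le_trans h1; rewrite le_eqVlt; apply/orP; left; apply/eqP; congr (`|_|); field.
by split; [apply/cvg_ex; exists d|apply/cvg_lim].
Qed.

(** The extension is f 0 plus a primitive of the clamped relative derivative. Its difference with f
    is continuous on I and has zero derivative inside, hence is constant; at the endpoints, where
    the derivative of f is one-sided, continuity suffices. *)
Lemma isC1_Der f : isC1 f -> exists F dF, [/\ Der F dF, cI dF,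
  forall x, inI x -> F x = f x & forall x, inI x -> dF x = derivI f x].
Proof.
move=> [fcvg fcont].
have gc := cI_clamp fcont; set g := fun x => derivI f (clamp x) in gc.
have slf x : inI x -> slope f x y @[y --> within (@I01 R) x^'] --> derivI f x.
  by move=> /I01E; exact: fcvg.
exists (fun x => f 0 + (prim g x - prim g 0)), g.
have Fd : Der (fun x => f 0 + (prim g x - prim g 0)) g.
  apply: (Der_ext (DerD (Der_cst (f 0)) (DerB (Der_prim gc) (Der_cst (prim g 0))))) => x _.
  by rewrite add0r subr0.
split => //; last by move=> x xI; rewrite /g clamp_id.
move=> x xI; case/inIP: (xI) => x0 x1.
pose D y := f y - (f 0 + (prim g y - prim g 0)).
suff : D x = D 0 by rewrite /D subrr addr0 subrr => /eqP; rewrite subr_eq0 => /eqP ->.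
have seg y : 0 <= y -> y <= x -> inI y.
  by move=> y0 yx; apply/inIP; split => //; exact: le_trans x1.
have [y||c _] := @MVT_segment _ D (fun=> 0) 0 x x0; last by rewrite mul0r => /eqP; rewrite subr_eq0 => /eqP.
- rewrite in_itv /= => /andP[y0 yx]; have yI := seg y (ltW y0) (ltW yx).
  rewrite -(subrr (derivI f y)); apply: is_deriveB; last first.
    have := Fd y yI; rewrite /g clamp_id//.
  apply: is_derive_eps => e e0; have [dl dl0 Hd] := slope_eps (slf y yI) e0.
  have y1 : 0 < 1 - y by rewrite subr_gt0 (lt_le_trans yx).
  exists (Num.min dl (Num.min y (1 - y))); first by rewrite !lt_min dl0 y0 y1.
  move=> z; rewrite !lt_min => /and3P[z1 z2 z3]; apply: Hd => //.
  by move: z2 z3; rewrite !ltr_norml => /andP[? _] /andP[_ ?]; apply/inIP; lra.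
apply/subspace_continuousP => y; rewrite /= in_itv /= => /andP[y0 yx].
have yI := seg y y0 yx.
apply: cvgB; last first.
  have := Der_cI Fd yI => h; apply: cvg_trans h; apply: cvg_app; exact: cvg_within.
apply/cvgrPdist_le => e e0; have [dl dl0 Hd] := slope_eps (slf y yI) ltr01.
pose d := derivI f y; pose m := Num.min dl (e / (`|d| + 1)).
have d1 : 0 < `|d| + 1 by rewrite ltr_wpDl.
have m0 : 0 < m by rewrite lt_min dl0 divr_gt0.
apply/nbhs_ballP; exists m => //= z yz; rewrite in_itv /= => /andP[z0 zx].
move: yz; rewrite /ball /= distrC /m lt_min => /andP[z1 z2].
have := Hd z (seg z z0 zx) z1; rewrite -/d mul1r => H.
rewrite distrC; have -> : f z - f y = (f z - f y - d * (z - y)) + d * (z - y) by ring.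
apply: le_trans (ler_normD _ _) _; rewrite normrM.
apply: (@le_trans _ _ ((`|d| + 1) * `|z - y|)); first by rewrite mulrDl mul1r addrC lerD2l.
by rewrite mulrC -ler_pdivlMr// ltW.
Qed.

End relative_derivative.

(** * Uniform limits and termwise differentiation *)

Section uniform_limits.
Variable R : realType.

Definition tends (u : nat -> R) (a : R) : Prop :=
  forall e, 0 < e -> exists n0, forall n, (n0 <= n)%N -> `|a - u n| <= e.

Lemma tendsP (u : nat -> R) (a : R) : tends u a <-> u @ \oo --> a.
Proof.
split=> [h|/cvgrPdist_le h e e0].
  apply/cvgrPdist_le => e e0; have [n0 H] := h e e0.
  by exists n0.
by have [n0 _ H] := h e e0; exists n0.
Qed.

Lemma tends_cauchy (u tau : nat -> R) : tends tau 0 ->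
  (forall m n, (n <= m)%N -> `|u m - u n| <= tau n) ->
  exists2 a, tends u a & forall n, `|a - u n| <= tau n.
Proof.
move=> tau0 ut.
have [n0 H0] : exists n0, forall n, (n0 <= n)%N -> `|0 - tau n| <= 1 by apply: tau0.
have cu : cvg (u @ \oo).
  apply/cauchy_cvgP/cauchy_exP => e e0.
  have [n1 H] := tau0 (e / 2) ltac:(by rewrite divr_gt0).
  exists (u n1), n1 => // m /= nm; rewrite /ball /= distrC.
  apply: le_lt_trans (ut m n1 nm) _; apply: le_lt_trans (ler_norm _) _.
  by have := H n1 (leqnn _); rewrite sub0r normrN => h; apply: le_lt_trans h _; lra.
have ua : tends u (lim (u @ \oo)) by apply/tendsP.
exists (lim (u @ \oo)) => // n; apply/ler_addgt0Pr => e e0.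
have [n1 H] := ua e e0; have h1 := H (maxn n n1) (leq_maxr _ _).
have h2 := ut (maxn n n1) n (leq_maxl _ _).
by have := ler_distD (u (maxn n n1)) (lim (u @ \oo)) (u n); lra.
Qed.

Lemma cI_uniform_limit (f : nat -> R -> R) (g : R -> R) (tau : nat -> R) :
  tends tau 0 -> (forall n, continuous (f n)) ->
  (forall n x, `|g x - f n x| <= tau n) -> continuous g.
Proof.
move=> t0 fc fg x; apply/cvgrPdist_le => e e0.
have [n H] := t0 (e / 3) ltac:(by rewrite divr_gt0).
have tn : tau n <= e / 3.
  by apply: le_trans (ler_norm _) _; have := H n (leqnn _); rewrite sub0r normrN.
have /cvgrPdist_le /(_ (e / 3) ltac:(by rewrite divr_gt0)) := fc n x.
apply: filterS => y h1.
have h2 := fg n x; have h3 := fg n y.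
have := ler_distD (f n x) (g x) (g y); have := ler_distD (f n y) (f n x) (g y).
by rewrite [`|f n y - g y|]distrC; lra.
Qed.

(** The derivatives converge uniformly to some dG, and a primitive of dG minus F n has derivative at
    most tau n; in the limit the primitive and F0 differ by a constant. *)
Lemma Der_uniform_limit (F g : nat -> R -> R) (F0 : R -> R) (tau : nat -> R) :
  tends tau 0 -> (forall n, Der (F n) (g n)) -> (forall n, cI (g n)) ->
  (forall m n x, (n <= m)%N -> inI x -> `|g m x - g n x| <= tau n) ->
  (forall x, inI x -> tends (fun n => F n x) (F0 x)) ->
  exists G dG, [/\ Der G dG, cI dG & forall x, inI x -> G x = F0 x].
Proof.
move=> t0 Fd gc gt FF.
have lim_g x : exists a, forall n, `|a - g n (clamp x)| <= tau n.
  have [a _ h] := tends_cauchy t0 (fun m n nm => gt m n (clamp x) nm (clampI x)).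
  by exists a.
have [dG HdG] := choice lim_g.
have dGc : continuous dG.
  apply: (@cI_uniform_limit (fun n x => g n (clamp x)) _ tau t0) => [n x|n x]; last exact: HdG.
  apply: continuous_comp; first exact: continuous_clamp.
  by apply: gc; exact: clampI.
have dGcI : cI dG by move=> x _; exact: dGc.
exists (fun x => F0 0 + (prim dG x - prim dG 0)), dG; split => //.
  apply: (Der_ext (DerD (Der_cst (F0 0)) (DerB (Der_prim dGcI) (Der_cst (prim dG 0))))) => x _.
  by rewrite add0r subr0.
move=> x xI; apply/eqP; rewrite -subr_eq0 -normr_le0; apply/ler_addgt0Pr => e e0.
rewrite add0r.
have e3 : 0 < e / 3 by rewrite divr_gt0.
have [n1 H1] := t0 _ e3; have [n2 H2] := FF x xI _ e3; have [n3 H3] := FF 0 (inI0 R) _ e3.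
pose n := maxn n1 (maxn n2 n3).
have h1 : tau n <= e / 3.
  apply: le_trans (ler_norm _) _; have := H1 n; rewrite sub0r normrN; apply.
  by rewrite /n leq_maxl.
have h2 := H2 n ltac:(by rewrite /n !leq_max leqnn !orbT).
have h3 := H3 n ltac:(by rewrite /n !leq_max leqnn !orbT).
have hd := DerB (Der_prim dGcI) (Fd n).
have := @Der_lipschitz _ _ _ (tau n) x 0 hd.
have hb z : inI z -> `|dG z - g n z| <= tau n by move=> zI; have := HdG z n; rewrite clamp_id.
have tn0 : 0 <= tau n by apply: le_trans (hb x xI).
move=> /(_ hb xI (inI0 R)); rewrite subr0 => h4.
have h5 : tau n * `|x| <= tau n.
  by rewrite ler_piMr//; case/inIP: xI => x0 x1; rewrite ger0_norm.
have -> : F0 0 + (prim dG x - prim dG 0) - F0 x =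
  (prim dG x - F n x - (prim dG 0 - F n 0)) + (F0 0 - F n 0) - (F0 x - F n x) by ring.
apply: le_trans (ler_normB _ _) _; apply: le_trans (lerD (ler_normD _ _) (lexx _)) _.
by lra.
Qed.

Lemma DerC_uniform_limit (v dv : nat -> R -> R[i]) (u : R -> R[i]) (tau : nat -> R) :
  tends tau 0 -> (forall n, DerC (v n) (dv n)) -> (forall n, cIC (dv n)) ->
  (forall m n x, (n <= m)%N -> inI x -> normc (dv m x - dv n x) <= tau n) ->
  (forall x, inI x -> tends (fun n => complex.Re (v n x)) (complex.Re (u x)) /\
     tends (fun n => complex.Im (v n x)) (complex.Im (u x))) ->
  exists w dw, [/\ DerC w dw, cIC dw & forall x, inI x -> w x = u x].
Proof.
move=> t0 vd dvc dt vu.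
have Re_le (z : R[i]) : `|complex.Re z| <= normc z.
  case: z => a b; rewrite /= -sqrtr_sqr ler_wsqrtr// lerDl sqr_ge0 //.
have Im_le (z : R[i]) : `|complex.Im z| <= normc z.
  case: z => a b; rewrite /= -sqrtr_sqr ler_wsqrtr// lerDr sqr_ge0 //.
have [G1 [dG1 [d1 c1 e1]]] := @Der_uniform_limit (fun n x => complex.Re (v n x))
  (fun n x => complex.Re (dv n x)) (fun x => complex.Re (u x)) tau t0
  (fun n => proj1 (vd n)) (fun n => proj1 (dvc n))
  ltac:(by move=> m n x nm xI; rewrite -cReN -cReD; apply: le_trans (Re_le _) (dt _ _ _ nm xI))
  (fun x xI => proj1 (vu x xI)).
have [G2 [dG2 [d2 c2 e2]]] := @Der_uniform_limit (fun n x => complex.Im (v n x))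
  (fun n x => complex.Im (dv n x)) (fun x => complex.Im (u x)) tau t0
  (fun n => proj2 (vd n)) (fun n => proj2 (dvc n))
  ltac:(by move=> m n x nm xI; rewrite -cImN -cImD; apply: le_trans (Im_le _) (dt _ _ _ nm xI))
  (fun x xI => proj2 (vu x xI)).
exists (fun x => G1 x +i* G2 x), (fun x => dG1 x +i* dG2 x); split => //.
by move=> x xI; rewrite e1// e2//; case: (u x).
Qed.

End uniform_limits.

(** * The weighted norm on C^1 functions *)

Section C1_space.
Variable R : realType.
Implicit Types (f : R -> R[i]).

Lemma C1I_DerC f : C1I f -> exists v dv, [/\ DerC v dv, cIC dv,
  forall x, inI x -> v x = f x & forall x, inI x -> dv x = Defs.derivC f x].
Proof.
move=> [/isC1_Der[F1 [dF1 [d1 c1 e1 e1']]] /isC1_Der[F2 [dF2 [d2 c2 e2 e2']]] _].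
exists (fun x => F1 x +i* F2 x), (fun x => dF1 x +i* dF2 x); split => //.
  by move=> x xI; rewrite e1// e2//; case: (f x).
by move=> x xI; rewrite e1'// e2'.
Qed.

Lemma DerC_C1I f v dv : DerC v dv -> cIC dv -> (forall x, inI x -> f x = v x) ->
  (forall x, ~~ inI x -> f x = 0) ->
  C1I f /\ forall x, inI x -> Defs.derivC f x = dv x.
Proof.
move=> [d1 d2] [c1 c2] fv f0.
have [h1 h1'] := Der_isC1 d1 c1 (fun x xI => congr1 (@complex.Re R) (fv x xI)).
have [h2 h2'] := Der_isC1 d2 c2 (fun x xI => congr1 (@complex.Im R) (fv x xI)).
split; last by move=> x xI; rewrite /Defs.derivC h1'// h2'//; case: (dv x).
split => // x xI; apply: f0; apply/negP => xI'; apply: xI; exact/I01E.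
Qed.

Lemma C1I_off f x : C1I f -> ~~ inI x -> f x = 0.
Proof. by move=> [_ _ h] xI; apply: h => /I01E; exact/negP. Qed.

Lemma supnorm_ge f x : cIC f -> inI x -> normc (f x) <= supnorm f.
Proof.
move=> fc xI; have [b b0 Hb] := cI_bounded (cI_csq fc).
apply: sup_upper_bound; last by exists x => //; exact/I01E.
split; first by exists (normc (f x)), x => //; exact/I01E.
exists (Num.sqrt b) => _ [y /I01E yI <-]; rewrite normc_le ?sqrtr_ge0// sqr_sqrtr ?(ltW b0)//.
by apply: le_trans (ler_norm _) (Hb y yI).
Qed.

Lemma supnorm_le f (c : R) : (forall x, inI x -> normc (f x) <= c) -> supnorm f <= c.
Proof.
move=> fc; apply: ge_sup; first by exists (normc (f 0)), 0 => //; apply/I01E; exact: inI0.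
by move=> _ [y /I01E yI <-]; exact: fc.
Qed.

Lemma supnorm_ext f g : (forall x, inI x -> f x = g x) -> supnorm f = supnorm g.
Proof.
move=> fg; rewrite /supnorm; congr sup; apply/seteqP; split => _ [x xI <-]; exists x => //.
  by rewrite fg//; exact/I01E.
by rewrite fg//; exact/I01E.
Qed.

Variable t : R.
Hypothesis t0 : t != 0.
Let t0' : 0 < `|t|. Proof. by rewrite normr_gt0. Qed.

Lemma norm1_bounds f x : C1I f -> inI x ->
  normc (f x) <= norm1 t f /\ normc (Defs.derivC f x) <= `|t| * norm1 t f.
Proof.
move=> /C1I_DerC[v [dv [vd dvc vf dvf]]] xI.
have h1 y : inI y -> normc (f y) <= supnorm f.
  by move=> yI; rewrite -vf// -(supnorm_ext vf); apply: supnorm_ge => //; exact: DerC_cIC vd.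
have h2 y : inI y -> normc (Defs.derivC f y) <= supnorm (Defs.derivC f).
  by move=> yI; rewrite -dvf// -(supnorm_ext dvf); apply: supnorm_ge.
have s1 : 0 <= supnorm f := le_trans (normc_ge0' _) (h1 x xI).
have s2 : 0 <= supnorm (Defs.derivC f) := le_trans (normc_ge0' _) (h2 x xI).
split; rewrite /norm1.
  by apply: le_trans (h1 x xI) _; rewrite lerDl divr_ge0// ltW.
apply: le_trans (h2 x xI) _; rewrite mulrDr mulrCA mulfV ?lt0r_neq0// mulr1 lerDr.
by rewrite mulr_ge0.
Qed.

Lemma norm1_ge0 f : C1I f -> 0 <= norm1 t f.
Proof.
move=> fC; have [h _] := norm1_bounds fC (inI0 R); exact: le_trans (normc_ge0' _) h.
Qed.

Lemma norm1_eq0 f : C1I f -> norm1 t f <= 0 -> f = fun=> 0.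
Proof.
move=> fC f0; apply/funext => x; have [xI|xI] := boolP (inI x); last exact: C1I_off.
have [h _] := norm1_bounds fC xI; apply: Normc.eq0_normc.
by apply/eqP; rewrite eq_le normc_ge0' andbT (le_trans h).
Qed.

(** Projecting v on the direction of d = dv x gives a real function with derivative |d|^2 at x and
    Lipschitz constant |d| c, to which [Der_lipschitz_conv] applies. *)
Lemma derivC_lipschitz f (c : R) x : C1I f ->
  (forall y z, inI y -> inI z -> normc (f y - f z) <= c * `|y - z|) -> inI x ->
  normc (Defs.derivC f x) <= c.
Proof.
move=> /C1I_DerC[v [dv [vd dvc vf dvf]]] fL xI; rewrite -dvf//.
set d := dv x; have [->|d0] := eqVneq d 0.
  rewrite Normc.normc0; have := fL 0 1 (inI0 R) (inI1 R).
  by rewrite sub0r normrN normr1 mulr1; apply: le_trans; exact: normc_ge0'.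
have [v1 v2] := vd; have [c1 c2] := dvc.
have hd := DerD (DerZ (complex.Re d) v1) (DerZ (complex.Im d) v2).
have hc : cI (fun x => complex.Re d * complex.Re (dv x) + complex.Im d * complex.Im (dv x)).
  by apply: cID; exact: cIZ.
have nd : 0 < normc d.
  rewrite lt_def normc_ge0' andbT; apply/eqP => h; move: d0.
  by rewrite (Normc.eq0_normc h) eqxx.
have := Der_lipschitz_conv hd hc (B := normc d * c).
have L (y z : R) : inI y -> inI z ->
  `|complex.Re d * complex.Re (v y) + complex.Im d * complex.Im (v y) -
    (complex.Re d * complex.Re (v z) + complex.Im d * complex.Im (v z))|
    <= normc d * c * `|y - z|.
  move=> yI zI; rewrite -mulrA; apply: le_trans (_ : _ <= normc d * normc (v y - v z)) _.
    rewrite -(ler_pXn2r (ltn0Sn 1)) ?nnegrE ?mulr_ge0 ?normc_ge0'//.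
    rewrite exprMn !normc_csq real_normK ?num_real// /csq cReD cImD cReN cImN.
    set a := complex.Re d; set b := complex.Im d.
    set r1 := complex.Re (v y); set r2 := complex.Re (v z).
    set i1 := complex.Im (v y); set i2 := complex.Im (v z).
    have := sqr_ge0 (a * (i1 - i2) - b * (r1 - r2)); rewrite !expr2; lra.
  by rewrite ler_wpM2l ?normc_ge0'// !vf// fL.
move=> /(_ L x xI); rewrite -/d -!expr2 -/(csq d) (ger0_norm (csq_ge0 d)) -normc_csq expr2.
by rewrite ler_pM2l.
Qed.

Lemma norm1_le f (c1 c2 : R) : C1I f -> (forall x, inI x -> normc (f x) <= c1) ->
  (forall x y, inI x -> inI y -> normc (f x - f y) <= c2 * `|x - y|) ->
  norm1 t f <= c1 + c2 / `|t|.
Proof.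
move=> fC f1 f2; rewrite /norm1; apply: lerD; first exact: supnorm_le.
rewrite ler_wpM2r ?invr_ge0//; apply: supnorm_le => x xI.
exact: derivC_lipschitz.
Qed.

Lemma C1I_lipschitz f x y : C1I f -> inI x -> inI y ->
  normc (f x - f y) <= `|t| * norm1 t f * `|x - y|.
Proof.
move=> fC xI yI; have [v [dv [vd dvc vf dvf]]] := C1I_DerC fC.
rewrite -!vf//; apply: (DerC_lipschitz vd dvc) => //.
  by rewrite mulr_ge0// norm1_ge0.
by move=> z zI; rewrite dvf//; have [] := norm1_bounds fC zI.
Qed.

Lemma C1I_add f g : C1I f -> C1I g -> C1I (fun x => f x + g x).
Proof.
move=> fC gC; have [v [dv [vd dvc vf _]]] := C1I_DerC fC.
have [u [du [ud duc ug _]]] := C1I_DerC gC.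
have [] // := DerC_C1I (DerCD vd ud) (cICD dvc duc) (f := fun x => f x + g x).
  by move=> x xI; rewrite vf// ug.
by move=> x xI; rewrite !C1I_off// addr0.
Qed.

Lemma C1I_opp f : C1I f -> C1I (fun x => - f x).
Proof.
move=> fC; have [v [dv [[v1 v2] dvc vf _]]] := C1I_DerC fC.
have vd : DerC (fun x => - v x) (fun x => - dv x).
  split; (under eq_fun do rewrite ?cReN ?cImN).
    by apply: (Der_ext (DerN v1)) => x _; rewrite cReN.
  by apply: (Der_ext (DerN v2)) => x _; rewrite cImN.
have [] // := DerC_C1I vd (cICN dvc) (f := fun x => - f x).
  by move=> x xI; rewrite vf.
by move=> x xI; rewrite C1I_off// oppr0.
Qed.

Lemma C1I_sub f g : C1I f -> C1I g -> C1I (fun x => f x - g x).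
Proof. by move=> fC gC; apply: C1I_add => //; exact: C1I_opp. Qed.

Lemma C1I_0 : C1I (fun=> 0 : R[i]).
Proof.
have h : DerC (fun=> 0 : R[i]) (fun=> 0) by split; exact: Der_cst.
have c : cIC (fun=> 0 : R[i]) by split; exact: cI_cst.
by have [] := DerC_C1I h c (f := fun=> 0).
Qed.

Lemma norm1_add f g : C1I f -> C1I g -> norm1 t (fun x => f x + g x) <= norm1 t f + norm1 t g.
Proof.
move=> fC gC; have [v [dv [vd dvc vf dvf]]] := C1I_DerC fC.
have [u [du [ud duc ug dug]]] := C1I_DerC gC.
have [_ e] := DerC_C1I (DerCD vd ud) (cICD dvc duc) (f := fun x => f x + g x)
  (fun x xI => congr2 +%R (esym (vf x xI)) (esym (ug x xI)))
  (fun x xI => etrans (congr2 +%R (C1I_off fC xI) (C1I_off gC xI)) (addr0 _)).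
rewrite /norm1 addrACA -mulrDl; apply: lerD.
  apply: supnorm_le => x xI; apply: le_trans (le_normcD _ _) _; apply: lerD.
    by rewrite -vf// -(supnorm_ext vf) supnorm_ge//; exact: DerC_cIC vd.
  by rewrite -ug// -(supnorm_ext ug) supnorm_ge//; exact: DerC_cIC ud.
rewrite ler_wpM2r ?invr_ge0//; apply: supnorm_le => x xI; rewrite e//.
apply: le_trans (le_normcD _ _) _; apply: lerD.
  by rewrite -(supnorm_ext dvf) supnorm_ge.
by rewrite -(supnorm_ext dug) supnorm_ge.
Qed.

Lemma norm1_opp f : C1I f -> norm1 t (fun x => - f x) <= norm1 t f.
Proof.
move=> fC; have N z : normc (- z : R[i]) = normc z by exact: normcN.
apply: le_trans (norm1_le (c1 := supnorm f) (c2 := supnorm (Defs.derivC f)) (C1I_opp fC) _ _) _.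
- move=> x xI; rewrite N; have [v [dv [vd dvc vf dvf]]] := C1I_DerC fC.
  by rewrite -vf// -(supnorm_ext vf) supnorm_ge//; exact: DerC_cIC vd.
- move=> x y xI yI; rewrite -opprD N.
  have [v [dv [vd dvc vf dvf]]] := C1I_DerC fC.
  have sg z : inI z -> normc (dv z) <= supnorm (Defs.derivC f).
    by move=> zI; rewrite -(supnorm_ext dvf) supnorm_ge.
  rewrite -!vf//; apply: (DerC_lipschitz vd dvc) => //.
  by apply: le_trans (sg 0 (inI0 R)); exact: normc_ge0'.
by [].
Qed.

End C1_space.

Lemma big_iota_ord (S : nmodType) (F : nat -> S) k :
  \sum_(j <- iota 0 k) F j = \sum_(j < k) F j.
Proof. by rewrite -(big_mkord xpredT) /index_iota subn0. Qed.

Section complex_limits.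
Variable R : realType.

Definition tendsC (u : nat -> R[i]) (z : R[i]) : Prop :=
  forall e, 0 < e -> exists n0, forall n, (n0 <= n)%N -> normc (z - u n) <= e.

Lemma normRe (z : R[i]) : `|complex.Re z| <= normc z.
Proof. by case: z => a b; rewrite /= -sqrtr_sqr ler_wsqrtr// lerDl sqr_ge0. Qed.

Lemma normIm (z : R[i]) : `|complex.Im z| <= normc z.
Proof. by case: z => a b; rewrite /= -sqrtr_sqr ler_wsqrtr// lerDr sqr_ge0. Qed.

Lemma normc_ReIm (z : R[i]) : normc z <= `|complex.Re z| + `|complex.Im z|.
Proof.
rewrite normc_le ?addr_ge0// /csq -(real_normK (num_real (complex.Re z))).
rewrite -(real_normK (num_real (complex.Im z))).
have := mulr_ge0 (normr_ge0 (complex.Re z)) (normr_ge0 (complex.Im z)).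
by rewrite !expr2; lra.
Qed.

Lemma normc_trans (y z w : R[i]) : normc (z - w) <= normc (z - y) + normc (y - w).
Proof.
have -> : z - w = (z - y) + (y - w) by ring.
exact: le_normcD.
Qed.

Lemma tendsC_cauchy (u : nat -> R[i]) (tau : nat -> R) : tends tau 0 ->
  (forall m n, (n <= m)%N -> normc (u m - u n) <= tau n) ->
  tendsC u (limC u) /\ forall n, normc (limC u - u n) <= 2 * tau n.
Proof.
move=> t0 ut.
have [m n nm|a ua ha] := @tends_cauchy R (fun n => complex.Re (u n)) tau t0.
  by rewrite -cReN -cReD; apply: le_trans (normRe _) (ut m n nm).
have [m n nm|b ub hb] := @tends_cauchy R (fun n => complex.Im (u n)) tau t0.
  by rewrite -cImN -cImD; apply: le_trans (normIm _) (ut m n nm).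
have -> : limC u = a +i* b.
  by rewrite /limC; congr (_ +i* _); apply/cvg_lim => //; apply/tendsP.
have h n : normc ((a +i* b) - u n) <= 2 * tau n.
  apply: le_trans (normc_ReIm _) _; rewrite cReD cImD cReN cImN /=.
  by have := ha n; have := hb n; lra.
split => // e e0; have [n0 H] := t0 (e / 2) ltac:(by rewrite divr_gt0).
exists n0 => n nn; apply: le_trans (h n) _.
by have := H n nn; rewrite sub0r normrN; have := ler_norm (tau n); lra.
Qed.

Lemma tendsC_le (u : nat -> R[i]) z (c : R) n0 : tendsC u z ->
  (forall n, (n0 <= n)%N -> normc (u n) <= c) -> normc z <= c.
Proof.
move=> uz uc; apply/ler_addgt0Pr => e e0; have [n1 H] := uz e e0.
have h1 := H (maxn n0 n1) (leq_maxr _ _); have h2 := uc (maxn n0 n1) (leq_maxl _ _).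
have := le_normcD (z - u (maxn n0 n1)) (u (maxn n0 n1)); rewrite subrK; lra.
Qed.

Lemma tendsCB (u v : nat -> R[i]) z w : tendsC u z -> tendsC v w ->
  tendsC (fun n => u n - v n) (z - w).
Proof.
move=> uz vw e e0; have e2 : 0 < e / 2 by rewrite divr_gt0.
have [n1 H1] := uz _ e2; have [n2 H2] := vw _ e2.
exists (maxn n1 n2) => n; rewrite geq_max => /andP[/H1 h1 /H2 h2].
have -> : z - w - (u n - v n) = (z - u n) - (w - v n) by ring.
by apply: le_trans (le_normcD _ _) _; rewrite normcN; lra.
Qed.

Lemma tendsC_uniq (u : nat -> R[i]) z w : tendsC u z -> tendsC u w -> z = w.
Proof.
move=> uz uw; apply/eqP; rewrite -subr_eq0; apply/eqP; apply: Normc.eq0_normc.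
apply/eqP; rewrite eq_le normc_ge0' andbT.
apply: (@tendsC_le (fun n => u n - u n) _ 0 0 (tendsCB uz uw)) => n _.
by rewrite subrr Normc.normc0.
Qed.

Lemma C1I_uniform_limit (v dv : nat -> R -> R[i]) (u : R -> R[i]) (tau : nat -> R) :
  tends tau 0 -> (forall n, DerC (v n) (dv n)) -> (forall n, cIC (dv n)) ->
  (forall m n x, (n <= m)%N -> inI x -> normc (dv m x - dv n x) <= tau n) ->
  (forall x, inI x -> tendsC (fun n => v n x) (u x)) ->
  (forall x, ~~ inI x -> u x = 0) -> C1I u.
Proof.
move=> t0 vd dvc dt vu u0.
have ReIm x : inI x -> tends (fun n => complex.Re (v n x)) (complex.Re (u x)) /\
     tends (fun n => complex.Im (v n x)) (complex.Im (u x)).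
  move=> xI; split=> e e0; have [n0 H] := vu x xI e e0; exists n0 => n nn.
    by rewrite -cReN -cReD; apply: le_trans (normRe _) (H n nn).
  by rewrite -cImN -cImD; apply: le_trans (normIm _) (H n nn).
have [w [dw [wd dwc wu]]] := DerC_uniform_limit t0 vd dvc dt ReIm.
have [] // := DerC_C1I wd dwc (f := u) _ u0.
by move=> x xI; rewrite wu.
Qed.

End complex_limits.

(** * Completeness and the Neumann series *)

Section neumann.
Variables (R : realType) (t : R).
Hypothesis t0 : t != 0.
Local Notation nrm := (norm1 t).

Lemma C1I_sum (u : nat -> R -> R[i]) k : (forall j, C1I (u j)) ->
  C1I (fun x => \sum_(j < k) u j x).
Proof.
move=> uC; elim: k => [|k IH].
  by under eq_fun do rewrite big_ord0; exact: C1I_0.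
by under eq_fun do rewrite big_ord_recr; exact: C1I_add.
Qed.

Lemma norm1_sum_le (u : nat -> R -> R[i]) (b : nat -> R) k : (forall j, C1I (u j)) ->
  (forall j, nrm (u j) <= b j) -> nrm (fun x => \sum_(j < k) u j x) <= \sum_(j < k) b j.
Proof.
move=> uC ub; elim: k => [|k IH].
  under eq_fun do rewrite big_ord0; rewrite big_ord0.
  have := @norm1_le R t (fun=> 0) 0 0 (@C1I_0 R); rewrite mul0r addr0; apply.
    by move=> x _; rewrite Normc.normc0.
  by move=> x y _ _; rewrite subrr Normc.normc0 mul0r.
under eq_fun do rewrite big_ord_recr; rewrite big_ord_recr /=.
apply: le_trans (norm1_add t (C1I_sum _ uC) (uC k)) _.
exact: lerD.
Qed.

(** Values and derivatives are both dominated by geometric series, so the sum is C^1. The norm of a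
    remainder is then estimated through its supremum and its Lipschitz constant, both limits of
    finite sums. *)
Lemma C1I_complete (u : nat -> R -> R[i]) (a : R) : 0 <= a -> (forall j, C1I (u j)) ->
  (forall j, nrm (u j) <= a * 2^-1 ^+ j) ->
  exists2 U, C1I U & forall e, 0 < e -> exists k0, forall k, (k0 <= k)%N ->
    nrm (fun x => U x - \sum_(j < k) u j x) <= e.
Proof.
move=> a0 uC ua.
(* The sum of the terms c 2^-j for j >= k. *)
pose tau c (k : nat) : R := 2 * c * 2^-1 ^+ k.
have tau_tends c : tends (tau c) 0.
  apply/tendsP; rewrite /tau; apply: cvg_geometric.
  by rewrite ger0_norm ?invr_ge0// invf_lt1// ltr1n.
have tailsum c (F : nat -> R[i]) : (forall j, normc (F j) <= c * 2^-1 ^+ j) ->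
    forall m k, (k <= m)%N ->
    normc (\sum_(j < m) F j - \sum_(j < k) F j) <= tau c k - tau c m.
  move=> Fc m k; elim: m => [|m IH]; first by rewrite leqn0 => /eqP ->; rewrite !subrr Normc.normc0.
  rewrite leq_eqVlt => /predU1P[->|]; first by rewrite !subrr Normc.normc0.
  rewrite ltnS => /IH h; rewrite big_ord_recr /= addrAC.
  apply: le_trans (le_normcD _ _) _; have := Fc m; move: h; rewrite /tau exprS; lra.
have tau_ge0 c k : 0 <= c -> 0 <= tau c k.
  by move=> c0; rewrite /tau mulr_ge0 ?exprn_ge0 ?invr_ge0// mulr_ge0.
have uB j x : inI x -> normc (u j x) <= a * 2^-1 ^+ j.
  by move=> xI; have [h _] := norm1_bounds t0 (uC j) xI; apply: le_trans (ua j).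
have tail x m k : inI x -> (k <= m)%N ->
    normc (\sum_(j < m) u j x - \sum_(j < k) u j x) <= tau a k.
  move=> xI km; apply: le_trans (tailsum a _ (fun j => uB j x xI) m k km) _.
  by rewrite gerBl tau_ge0.
pose U x := if inI x then limC (fun k => \sum_(j < k) u j x) else 0.
have Ulim x : inI x -> tendsC (fun k => \sum_(j < k) u j x) (U x).
  move=> xI; rewrite /U xI.
  by have [] := tendsC_cauchy (tau_tends a) (fun m k km => tail x m k xI km).
have /choice[v /choice[dv H]] : forall j, exists v dv, [/\ DerC v dv, cIC dv,
    forall x, inI x -> v x = u j x & forall x, inI x -> dv x = Defs.derivC (u j) x].
  by move=> j; exact: C1I_DerC.
have UC : C1I U.
  apply: (@C1I_uniform_limit R (fun k x => \sum_(j <- iota 0 k) v j x)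
    (fun k x => \sum_(j <- iota 0 k) dv j x) U (tau (`|t| * a)) (tau_tends _)).
  - by move=> k; apply: DerC_sum_in => j _; have [] := H j.
  - by move=> k; apply: cIC_sum_in => j _; have [] := H j.
  - move=> m k x km xI; rewrite !big_iota_ord.
    have dB j : normc (dv j x) <= `|t| * a * 2^-1 ^+ j.
      have [_ _ _ e] := H j; rewrite e//; have [_ h] := norm1_bounds t0 (uC j) xI.
      by apply: le_trans h _; rewrite -mulrA ler_wpM2l.
    have := tailsum _ _ dB m k km.
    by move=> /le_trans; apply; rewrite gerBl tau_ge0// mulr_ge0.
  - move=> x xI; have := Ulim x xI; congr tendsC; apply/funext => k.
    rewrite big_iota_ord; apply: eq_bigr => j _.
    by have [_ _ e _] := H j; rewrite e.
  by move=> x xI; rewrite /U (negbTE xI).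
exists U => // e e0.
have [k0 Hk0] := tau_tends a (e / 2) ltac:(by rewrite divr_gt0).
exists k0 => k kk.
have SC k' := C1I_sum k' uC.
have tk : 2 * tau a k <= e.
  have := Hk0 k kk; rewrite sub0r normrN; have := ler_norm (tau a k); lra.
apply: le_trans tk.
have := @norm1_le R t (fun x => U x - \sum_(j < k) u j x) (tau a k) (`|t| * tau a k)
  (C1I_sub UC (SC k)).
have -> : tau a k + `|t| * tau a k / `|t| = 2 * tau a k.
  by field; rewrite normr_eq0.
apply.
  move=> x xI; apply: (@tendsC_le R (fun m => \sum_(j < m) u j x - \sum_(j < k) u j x) _ _ k).
    apply: tendsCB (Ulim x xI) _ => e' e'0; exists 0%N => n _; rewrite subrr Normc.normc0; exact: ltW.
  by move=> m km; exact: tail.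
move=> x y xI yI.
apply: (@tendsC_le R (fun m => (\sum_(j < m) u j x - \sum_(j < k) u j x)
    - (\sum_(j < m) u j y - \sum_(j < k) u j y)) _ _ k).
  apply: tendsCB; apply: tendsCB; try exact: Ulim.
    by move=> e' e'0; exists 0%N => n _; rewrite subrr Normc.normc0; exact: ltW.
  by move=> e' e'0; exists 0%N => n _; rewrite subrr Normc.normc0; exact: ltW.
move=> m km.
have dB j : normc (u j x - u j y) <= `|t| * a * `|x - y| * 2^-1 ^+ j.
  apply: le_trans (C1I_lipschitz t0 (uC j) xI yI) _.
  rewrite (_ : `|t| * a * `|x - y| * 2^-1 ^+ j = `|t| * (a * 2^-1 ^+ j) * `|x - y|).
    by rewrite ler_wpM2r// ler_wpM2l.
  by ring.
have := tailsum _ _ dB m k km; rewrite !sumrB.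
have -> : \sum_(j < m) u j x - \sum_(j < m) u j y - (\sum_(j < k) u j x - \sum_(j < k) u j y)
  = \sum_(j < m) u j x - \sum_(j < k) u j x - (\sum_(j < m) u j y - \sum_(j < k) u j y) by ring.
move=> /le_trans; apply; apply: (@le_trans _ _ (tau (`|t| * a * `|x - y|) k)).
  by rewrite gerBl tau_ge0// !mulr_ge0.
by rewrite /tau le_eqVlt; apply/orP; left; apply/eqP; ring.
Qed.

(* G = L^m halves the norm, so sum_j G^j f converges to some N f, and
   (1 + L + ... + L^(m-1)) (N f) inverts 1 - L; injectivity of 1 - L makes the
   inverse two-sided. *)
Lemma neumann_inverse (L : (R -> R[i]) -> R -> R[i]) (m : nat) (b : nat -> R) :
  (0 < m)%N ->
  (forall f, C1I f -> C1I (L f)) ->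
  (forall f g, C1I f -> C1I g -> L (fun x => f x - g x) = fun x => L f x - L g x) ->
  (forall n, 0 <= b n) -> (forall n f, C1I f -> nrm (iter n L f) <= b n * nrm f) ->
  (forall f, C1I f -> nrm (iter m L f) <= 2^-1 * nrm f) ->
  exists2 inv : (R -> R[i]) -> R -> R[i],
    inverse_on_C1I (fun f x => f x - L f x) inv &
    forall f, C1I f -> nrm (inv f) <= (\sum_(j < m) b j) * (2 * nrm f).
Proof.
move=> m0 LC Lsub b0 Lb LG.
have LnC n f : C1I f -> C1I (iter n L f) by move=> fC; elim: n => //= n; exact: LC.
have Lnsub n f g : C1I f -> C1I g ->
    iter n L (fun x => f x - g x) = fun x => iter n L f x - iter n L g x.
  by move=> fC gC; elim: n => //= n ->; rewrite Lsub//; exact: LnC.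
have L0 : L (fun=> 0) = fun=> 0.
  have := Lsub _ _ (@C1I_0 R) (@C1I_0 R); rewrite subrr => ->.
  by apply/funext => x; rewrite subrr.
have LnD n f g : C1I f -> C1I g ->
    iter n L (fun x => f x + g x) = fun x => iter n L f x + iter n L g x.
  move=> fC gC; have Lnopp : iter n L (fun x => - g x) = fun x => - iter n L g x.
    have := Lnsub n _ _ (@C1I_0 R) gC; under eq_fun do rewrite sub0r.
    move=> ->; apply/funext => x; have -> : iter n L (fun=> 0) = fun=> 0.
      by elim: n => //= n ->.
    by rewrite sub0r.
  have := Lnsub n _ _ fC (C1I_opp gC); under eq_fun do rewrite opprK.
  by move=> ->; rewrite Lnopp; apply/funext => x; rewrite opprK.
have Lnsum n (u : nat -> R -> R[i]) k : (forall j, C1I (u j)) ->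
    iter n L (fun x => \sum_(j < k) u j x) = fun x => \sum_(j < k) iter n L (u j) x.
  move=> uC; elim: k => [|k IH].
    under eq_fun do rewrite big_ord0; under [RHS]eq_fun do rewrite big_ord0.
    by elim: n => //= n ->.
  under eq_fun do rewrite big_ord_recr /=; rewrite LnD ?IH//; last exact: C1I_sum.
  by apply/funext => x; rewrite big_ord_recr.
have inj f : C1I f -> L f = f -> f = fun=> 0.
  move=> fC Lf; apply: (norm1_eq0 t0 fC).
  have e : iter m L f = f by elim: (m) => //= k ->.
  by have := LG f fC; rewrite e; have := norm1_ge0 t0 fC; lra.
have Gpow j f : C1I f -> nrm (iter (j * m) L f) <= nrm f * 2^-1 ^+ j.
  move=> fC; elim: j => [|j IH]; first by rewrite mul0n expr0 mulr1.
  rewrite mulSn iterD; apply: le_trans (LG _ (LnC _ _ fC)) _.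
  by rewrite exprS mulrCA ler_wpM2l// invr_ge0.
(* With G = L^m and S k the sum of the G^j f for j < k, one has (1 - G) (S k) = f - G^k f. Both N f
   - S k and G^k f tend to 0 in norm, so (1 - G) (N f) = f. *)
have N_ex f : exists Nf, C1I f -> C1I Nf /\ (fun x => Nf x - iter m L Nf x) = f.
  have [fC|nf] := pselect (C1I f); last by exists f.
  have uC j : C1I (iter (j * m) L f) by exact: LnC.
  have [Nf NC HN] := C1I_complete (norm1_ge0 t0 fC) uC (fun j => Gpow j f fC).
  exists Nf => _; split => //.
  pose S k x := \sum_(j < k) iter (j * m) L f x.
  have SC k : C1I (S k) by exact: (@C1I_sum (fun j => iter (j * m) L f)).
  have SE k : (fun x => S k x - iter m L (S k) x) = fun x => f x - iter (k * m) L f x.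
    rewrite /S (Lnsum m (fun j => iter (j * m) L f))//; apply/funext => x.
    elim: k => [|k IH]; first by rewrite !big_ord0 subr0 mul0n subrr.
    rewrite !big_ord_recr /= opprD addrACA IH -iterD -mulSn; ring.
  have dC : C1I (fun x => Nf x - iter m L Nf x - f x).
    by apply: C1I_sub => //; apply: C1I_sub => //; exact: LnC.
  suff h : (fun x => Nf x - iter m L Nf x - f x) = fun=> 0.
    apply/funext => x; apply/eqP; rewrite -subr_eq0; apply/eqP.
    by have := congr1 (fun g => g x) h.
  apply: (norm1_eq0 t0 dC); apply/ler_addgt0Pr => e e0; rewrite add0r.
  have e3 : 0 < e / 3 by rewrite divr_gt0.
  have [k0 Hk] := HN _ e3.
  have [k1 Hk1] := geometric_small (nrm f) (ltac:(by rewrite invr_ge0) : 0 <= 2^-1 :> R)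
    (ltac:(by rewrite invf_lt1// ltr1n)) e3.
  pose k := maxn k0 k1.
  have h1 := Hk k (leq_maxl _ _); have h2 := Hk1 k (leq_maxr _ _).
  pose d x := Nf x - S k x.
  have dkC : C1I d by exact: C1I_sub.
  have -> : (fun x => Nf x - iter m L Nf x - f x) =
      fun x => (d x - iter m L d x) - iter (k * m) L f x.
    rewrite /d Lnsub//; apply/funext => x.
    have := congr1 (fun g => g x) (SE k) => /= e1.
    have -> : f x = S k x - iter m L (S k) x + iter (k * m) L f x by rewrite e1 subrK.
    ring.
  have i1 := norm1_add t (C1I_sub dkC (LnC m _ dkC)) (C1I_opp (LnC (k * m)%N _ fC)).
  have i2 := norm1_opp t (LnC (k * m)%N _ fC).
  have i3 := norm1_add t dkC (C1I_opp (LnC m _ dkC)).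
  have i4 := norm1_opp t (LnC m _ dkC).
  have i5 := LG _ dkC; have i6 := Gpow k f fC.
  have i7 : nrm d <= e / 3 by exact: h1.
  have i8 := norm1_ge0 t0 dkC.
  have j5 : 2^-1 * nrm d <= e / 3.
    by apply: le_trans i7; rewrite ler_piMl// invf_le1// ler1n.
  have j1 := le_trans i3 (lerD i7 (le_trans i4 (le_trans i5 j5))).
  apply: le_trans i1 _; apply: le_trans (lerD j1 (le_trans i2 (le_trans i6 h2))) _.
  by rewrite le_eqVlt; apply/orP; left; apply/eqP; field.
have [N HN] := choice N_ex.
have NC f : C1I f -> C1I (N f) by move=> /HN[].
have NE f : C1I f -> (fun x => N f x - iter m L (N f) x) = f by move=> /HN[].
pose inv f x := \sum_(j < m) iter j L (N f) x.
have invC f : C1I f -> C1I (inv f).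
  by move=> fC; apply: (@C1I_sum (fun j => iter j L (N f))) => j; apply: LnC; exact: NC.
have right f : C1I f -> (fun x => inv f x - L (inv f) x) = f.
  move=> fC; rewrite -[RHS](NE f fC) /inv; have NfC := NC f fC.
  have := Lnsum 1 (fun j => iter j L (N f)) m (fun j => LnC j _ NfC).
  rewrite /= => ->; apply/funext => x; rewrite -sumrB.
  have := telescope_sumr (fun j => - iter j L (N f) x) (leq0n m).
  rewrite big_mkord /= opprK => e; rewrite [RHS]addrC -e.
  by apply: eq_bigr => j _; rewrite opprK addrC.
exists inv; first split => // f fC.
- by apply: C1I_sub => //; exact: LC.
- have AC : C1I (fun x => f x - L f x) by apply: C1I_sub => //; exact: LC.
  have iC := invC _ AC.
  have e := right _ AC.
  suff h : (fun x => inv (fun x => f x - L f x) x - f x) = fun=> 0.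
    apply/funext => x; apply/eqP; rewrite -subr_eq0; apply/eqP.
    by have := congr1 (fun g => g x) h.
  apply: inj; first exact: C1I_sub.
  rewrite Lsub//; apply/funext => x.
  have := congr1 (fun g => g x) e => /= e1.
  rewrite -[L (inv _) x](subKr (inv (fun x => f x - L f x) x)) e1; ring.
move=> f fC; have NfC := NC f fC.
have NfB : nrm (N f) <= 2 * nrm f.
  have e : N f = fun x => f x + iter m L (N f) x.
    by rewrite -{2}(NE f fC); apply/funext => x; rewrite subrK.
  have h := norm1_add t fC (LnC m _ NfC); rewrite -e in h.
  have := LG _ NfC; move: h; move: (nrm (iter m L (N f))) (nrm (N f)) (nrm f) => a1 a2 a3.
  by move=> h1 h2; have := le_trans h1 (lerD (lexx a3) h2); lra.
apply: le_trans (norm1_sum_le (u := fun j => iter j L (N f)) m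
  (fun j => LnC j _ NfC) (fun j => Lb j _ NfC)) _.
rewrite -mulr_suml; apply: ler_wpM2l => //.
exact: sumr_ge0.
Qed.

End neumann.

(** * Infinitely many branches *)

Section full_operator.
Variables (R : realType) (B : branch_system R).
Implicit Types (A : seq nat) (w : seq nat) (n : nat) (x : R).

Local Notation J := (bs_J B).
Local Notation h := (bs_h B).
Local Notation lam := (bs_lam B).
Local Notation rho := (bs_rho B).
Local Notation C := (bs_C B).
Local Notation q := (bs_q B).
Local Notation S1 := (bs_S1 B).
Local Notation M := (bs_M B).
Local Notation gw := (gw h).
Local Notation lw := (lw B).
Local Notation K1 := (K1 B).

Local Notation Lc := (Lc B).
Local Notation wr := (wr B).
Local Notation wc := (wc B).

Local Notation dLc := (dLc B).

Definition letters n : seq nat := [seq i <- iota 0 n | J i].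

(** The transfer operator written with the extended branches; [transfer_Linf] identifies the two. *)
Definition Linf (s : R[i]) (f : R -> R[i]) (x : R) : R[i] :=
  if inI x then limC (fun n => Lc (letters n) s f x) else 0.

Hypothesis letters_alphabet : forall n, alphabet B (letters n).
Variable s : R[i].
Hypotheses (sg1 : `|complex.Re s| <= 1) (sgS : `|complex.Re s| <= S1).

Let wr1 i x : wr (complex.Re s) [:: i] x = expR (- (complex.Re s * rho i x)) * lam i x.
Proof. by rewrite /wr /= addr0 mulr1. Qed.

Let k0 : 0 < K1. Proof. exact: K1_gt0. Qed.
Let allJ1 i : J i -> all J [:: i]. Proof. by move=> /= ->. Qed.

Let sum_wr1 n x : inI x -> \sum_(i <- letters n) wr (complex.Re s) [:: i] x <= M.
Proof.
move=> xI; have [AJ Hs _] := letters_alphabet n; apply: le_trans (Hs x xI).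
rewrite big_seq [leRHS]big_seq; apply: ler_sum => i iA; rewrite wr1.
have Ji := allP AJ i iA; rewrite ler_wpM2r ?(ltW (lam_gt0 Ji xI))// ler_expR -mulNr.
by rewrite ler_wpM2r ?rho_ge0// (le_trans _ sgS)// -normrN ler_norm.
Qed.

Let wr1_le i x : J i -> inI x ->
  wr (complex.Re s) [:: i] x <= expR (2 * K1) * wr (complex.Re s) [:: i] 0.
Proof.
move=> Ji xI; apply: (loglip _ (wrd (complex.Re s) (allJ1 Ji))) => //.
- by rewrite mulr_ge0 ?(ltW k0).
- by move=> y yI; rewrite ltW ?wr_gt0//= Ji.
- by move=> y yI; apply: dwrB => //; exact: allJ1.
exact: inI0.
Qed.

Lemma letters_split (S : zmodType) (F : nat -> S) n m : (n <= m)%N ->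
  \sum_(i <- letters m) F i - \sum_(i <- letters n) F i
  = \sum_(i <- [seq i <- iota n (m - n) | J i]) F i.
Proof.
move=> nm; rewrite /letters -{1}(subnKC nm) iotaD filter_cat big_cat /= add0n.
by rewrite addrAC subrr add0r.
Qed.

(* Log-Lipschitz control transfers the convergence of the series of weights at
   0 to uniform convergence on I. *)
Lemma series_tail : exists2 tau : nat -> R, tends tau 0 &
  forall (F : nat -> R[i]) (c : R), 0 <= c ->
    (forall i, J i -> normc (F i) <= c * wr (complex.Re s) [:: i] 0) ->
    forall m n, (n <= m)%N ->
      normc (\sum_(i <- letters m) F i - \sum_(i <- letters n) F i) <= c * tau n.
Proof.
pose W n := \sum_(i <- letters n) wr (complex.Re s) [:: i] 0.
have w0 i : J i -> 0 <= wr (complex.Re s) [:: i] 0.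
  by move=> Ji; rewrite ltW// wr_gt0 ?inI0 ?allJ1.
have Wle n m : (n <= m)%N -> W n <= W m.
  move=> nm; rewrite -subr_ge0 letters_split// big_seq sumr_ge0// => i.
  by rewrite mem_filter => /andP[/w0].
have Wcv : cvg (W @ \oo).
  apply: nondecreasing_is_cvgn; first by move=> n m; exact: Wle.
  by exists M => _ [n _ <-]; apply: sum_wr1; exact: inI0.
exists (fun n => limn W - W n).
  apply/tendsP; have h : W @ \oo --> limn W by [].
  by have := cvgB (cvg_cst (limn W)) h; rewrite subrr; apply.
move=> F c c0 Fc m n nm; rewrite letters_split//; apply: le_trans (normc_sum _ _) _.
apply: (@le_trans _ _ (c * (W m - W n))); last first.
  by rewrite ler_wpM2l// lerD2r; apply: nondecreasing_cvgn_le => // n' m'; exact: Wle.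
rewrite /W letters_split// mulr_sumr big_seq [leRHS]big_seq; apply: ler_sum => i.
by rewrite mem_filter => /andP[/Fc].
Qed.

Let word1 (F : seq nat -> R[i]) n :
  \sum_(w <- words (letters n) 1) F w = \sum_(i <- letters n) F [:: i].
Proof. by rewrite big_words /= big_seq1. Qed.

Let Lc1 n v x : Lc (letters n) s v x =
  \sum_(i <- letters n) wc s [:: i] x * v (gw [:: i] x).
Proof. by rewrite -[LHS]/(iter 1 (Lc (letters n) s) v x) LcE word1. Qed.

(** One sequence tau serves all f and x, scaled by a bound of f: the truncated operators converge in
    operator norm for the supremum. *)
Lemma Linf_approx : exists2 tau : nat -> R, tends tau 0 &
  forall (f : R -> R[i]) (b : R) x, 0 <= b -> (forall y, inI y -> normc (f y) <= b) -> inI x ->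
    tendsC (fun n => Lc (letters n) s f x) (Linf s f x) /\
    forall n, normc (Linf s f x - Lc (letters n) s f x) <= b * tau n.
Proof.
have [tau t0 Ht] := series_tail.
exists (fun n => 2 * (expR (2 * K1) * tau n)).
  apply/tendsP; rewrite -(mulr0 2) -(mulr0 (expR (2 * K1))).
  by apply: cvgMr; apply: cvgMr; apply/tendsP.
move=> f b x b0 fb xI; have c0 : 0 <= expR (2 * K1) * b by rewrite mulr_ge0 ?expR_ge0.
have Fc i : J i -> normc (wc s [:: i] x * f (gw [:: i] x)) <=
    expR (2 * K1) * b * wr (complex.Re s) [:: i] 0.
  move=> Ji; rewrite (Normc.normcM (wc s [:: i] x)) normc_wc ?allJ1// [leRHS]mulrAC.
  apply: ler_pM; rewrite ?normc_ge0' ?(ltW (wr_gt0 _ (allJ1 Ji) xI))//.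
    exact: wr1_le.
  by apply/fb/gwI => //; exact: allJ1.
have cau := Ht _ _ c0 Fc.
have t0' : tends (fun n => expR (2 * K1) * b * tau n) 0.
  apply/tendsP; rewrite -(mulr0 (expR (2 * K1) * b)); apply: cvgMr; exact/tendsP.
rewrite /Linf xI; under eq_fun do rewrite Lc1.
have [h1 h2] := tendsC_cauchy t0' cau.
by split=> // n; rewrite Lc1; apply: le_trans (h2 n) _; rewrite le_eqVlt; apply/orP; left; apply/eqP; ring.
Qed.

(** The derivatives of the individual terms are also dominated by the weights at 0, with a constant
    depending on s and f, so the differentiated series converges uniformly as well. *)
Lemma Linf_C1 f : C1I f -> C1I (Linf s f).
Proof.
move=> fC; have [v [dv [vd dvc vf dvf]]] := C1I_DerC fC.
have vc := DerC_cIC vd.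
have [tau t0 Ht] := series_tail; have [tau' _ Ha] := Linf_approx.
have n0 : (1 : R) != 0 by rewrite oner_neq0.
pose a := norm1 1 f; have a0 : 0 <= a := norm1_ge0 n0 fC.
have va y : inI y -> normc (v y) <= a.
  by move=> yI; rewrite vf//; have [] := norm1_bounds n0 fC yI.
have dva y : inI y -> normc (dv y) <= a.
  by move=> yI; rewrite dvf//; have [_] := norm1_bounds n0 fC yI; rewrite normr1 mul1r.
have fa y : inI y -> normc (f y) <= a by move=> yI; rewrite -vf// va.
pose Ts : R := normc s + 1.
have Ts0 : 0 <= Ts by rewrite addr_ge0 ?normc_ge0'.
pose c := expR (2 * K1) * (Ts * K1 * a + C * q * a).
have C0 : 0 <= C by rewrite (le_trans ler01) ?C1.
have q0 : 0 <= q by rewrite ltW ?q0.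
have c0 : 0 <= c.
  have h1 : 0 <= Ts * K1 * a by rewrite mulr_ge0// mulr_ge0// ltW.
  have h2 : 0 <= C * q * a by rewrite mulr_ge0// mulr_ge0.
  by rewrite /c mulr_ge0 ?expR_ge0// addr_ge0.
apply: (@C1I_uniform_limit R (fun n => iter 1 (Lc (letters n) s) v)
  (fun n => dLc (letters n) s 1 v dv) _ (fun n => c * tau n)).
- apply/tendsP; rewrite -(mulr0 c); apply: cvgMr; exact/tendsP.
- by move=> n; exact: Lcd (letters_alphabet n) s 1 _ _ vd.
- by move=> n; exact: dLcc (letters_alphabet n) s 1 _ _ vc dvc.
- move=> m n x nm xI; rewrite /dLc !word1; apply: Ht => // i Ji.
  have wJ := allJ1 Ji; have gI := gwI wJ xI; have w0 := wr_gt0 (complex.Re s) wJ xI.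
  apply: le_trans (le_normcD _ _) _.
  rewrite (Normc.normcM (dwc B s [:: i] x)) (Normc.normcM (wc s [:: i] x)).
  rewrite (Normc.normcM (_%:C)) normc_real normrM sw_norm// mul1r.
  rewrite (gtr0_norm (lw_gt0 wJ xI)) normc_wc//.
  have h1 : normc (dwc B s [:: i] x) * normc (v (gw [:: i] x)) <=
      Ts * K1 * wr (complex.Re s) [:: i] x * a.
    by apply: ler_pM; rewrite ?normc_ge0' ?va//; exact: normc_dwc.
  have h2 : lw [:: i] x * normc (dv (gw [:: i] x)) <= C * q * a.
    have := lw_contract wJ xI; rewrite expr1 => h.
    by apply: ler_pM h (dva _ gI); rewrite ?normc_ge0' ?(ltW (lw_gt0 wJ xI)).
  have h3 := ler_wpM2l (ltW w0) h2; have h4 := wr1_le Ji xI.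
  have k : 0 <= Ts * K1 * a + C * q * a.
    by rewrite addr_ge0// mulr_ge0// mulr_ge0// ltW.
  have h5 := ler_wpM2r k h4; rewrite /c; lra.
- move=> x xI; have [h _] := Ha f a x a0 fa xI.
  move: h; congr tendsC; apply/funext => n; rewrite Lc1 LcE word1.
  apply: eq_big_seq => i; rewrite mem_filter => /andP[Ji _].
  by rewrite vf// gwI//; exact: allJ1.
by move=> x xI; rewrite /Linf (negbTE xI).
Qed.

Lemma C1I_bounded (f : R -> R[i]) : C1I f -> exists2 b, 0 <= b & forall y, inI y -> normc (f y) <= b.
Proof.
move=> fC; have n0 : (1 : R) != 0 by rewrite oner_neq0.
exists (norm1 1 f); first exact: norm1_ge0.
by move=> y yI; have [] := norm1_bounds n0 fC yI.
Qed.

Lemma Linf_sub f g : C1I f -> C1I g ->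
  Linf s (fun x => f x - g x) = fun x => Linf s f x - Linf s g x.
Proof.
move=> fC gC; apply/funext => x; have [xI|xI] := boolP (inI x); last first.
  by rewrite /Linf (negbTE xI) subrr.
have [tau t0 Ha] := Linf_approx.
have [b b0 fb] := C1I_bounded fC; have [c c0 gc] := C1I_bounded gC.
have [d d0 fgd] := C1I_bounded (C1I_sub fC gC).
have [h1 _] := Ha f b x b0 fb xI; have [h2 _] := Ha g c x c0 gc xI.
have [h3 _] := Ha (fun x => f x - g x) d x d0 fgd xI.
have e : (fun n => Lc (letters n) s (fun x => f x - g x) x) =
    fun n => Lc (letters n) s f x - Lc (letters n) s g x.
  by apply/funext => n; rewrite /Lc /op -sumrB; apply: eq_bigr => i _; rewrite mulrBr.
by rewrite e in h3; exact: tendsC_uniq h3 (tendsCB h1 h2).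
Qed.

(** For each fixed n all n factors are truncated at the same level m. The error at step n + 1 is
    that of truncating one application of [Linf], plus the previous error amplified by at most M,
    which bounds the sums of weights. *)
Lemma Linf_iter f n : C1I f -> C1I (iter n (Linf s) f) /\
  forall e, 0 < e -> exists m0, forall m x, (m0 <= m)%N -> inI x ->
    normc (iter n (Linf s) f x - iter n (Lc (letters m) s) f x) <= e.
Proof.
move=> fC; elim: n => [|n [nC IH]].
  split => // e e0; exists 0%N => m x _ _.
  by rewrite /= subrr Normc.normc0 ltW.
split=> [|e e0]; first by rewrite iterS; exact: Linf_C1.
have [tau t0 Ha] := Linf_approx.
have [b b0 fb] := C1I_bounded nC.
have M0 : 0 < M by rewrite (lt_le_trans ltr01) ?M1.
have eM : 0 < e / (2 * M) by rewrite divr_gt0// mulr_gt0.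
have eb : 0 < e / (2 * (b + 1)) by rewrite divr_gt0// mulr_gt0// ltr_wpDl.
have [m1 H1] := IH _ eM; have [m2 H2] := t0 _ eb.
exists (maxn m1 m2) => m x; rewrite geq_max => /andP[mm1 mm2] xI.
rewrite !iterS; set g := iter n (Linf s) f in nC fb H1 *.
set gm := iter n _ f in H1 *.
apply: le_trans (normc_trans (Lc (letters m) s g x) _ _) _.
have [_ h] := Ha g b x b0 fb xI.
have i1 : normc (Linf s g x - Lc (letters m) s g x) <= e / 2.
  apply: le_trans (h m) _.
  have := H2 m mm2; rewrite sub0r normrN => h2.
  have h3 : tau m <= e / (2 * (b + 1)) by apply: le_trans (ler_norm _) h2.
  apply: le_trans (ler_wpM2l b0 h3) _.
  have -> : b * (e / (2 * (b + 1))) = (b / (b + 1)) * (e / 2).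
    by field; rewrite lt0r_neq0// ltr_wpDl.
  by rewrite ler_piMl ?divr_ge0 ?(ltW e0)// ler_pdivrMr ?ltr_wpDl// mul1r lerDl.
have i2 : normc (Lc (letters m) s g x - Lc (letters m) s gm x) <= e / 2.
  rewrite !Lc1 -sumrB; apply: le_trans (normc_sum _ _) _.
  apply: (@le_trans _ _ (\sum_(i <- letters m) wr (complex.Re s) [:: i] x * (e / (2 * M)))).
    rewrite big_seq [leRHS]big_seq; apply: ler_sum => i; rewrite mem_filter => /andP[Ji _].
    rewrite -mulrBr (Normc.normcM (wc s [:: i] x)) normc_wc ?allJ1//.
    rewrite ler_wpM2l ?(ltW (wr_gt0 _ (allJ1 Ji) xI))//.
    by apply: H1 => //; apply: gwI => //; exact: allJ1.
  rewrite -mulr_suml; apply: le_trans (ler_wpM2r (ltW eM) (sum_wr1 m xI)) _.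
  by rewrite le_eqVlt; apply/orP; left; apply/eqP; field; rewrite lt0r_neq0.
by apply: le_trans (lerD i1 i2) _; rewrite le_eqVlt; apply/orP; left; apply/eqP; field.
Qed.

Lemma letters_sub A0 : all J A0 -> exists n, {subset A0 <= letters n}.
Proof.
elim: A0 => [|i A0 IH] /=; first by exists 0%N.
case/andP=> Ji /IH[n H]; exists (maxn n i.+1) => j.
rewrite inE mem_filter mem_iota add0n leq0n /= => /predU1P[->|/H].
  by rewrite Ji leq_maxr.
rewrite mem_filter mem_iota add0n leq0n /= => /andP[-> jn].
by rewrite (leq_trans jn) ?leq_maxl.
Qed.

Lemma letters_mono n m : (n <= m)%N -> {subset letters n <= letters m}.
Proof.
move=> nm j; rewrite !mem_filter !mem_iota !add0n !leq0n /= => /andP[-> jn].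
exact: leq_trans nm.
Qed.

Variables (A0 : seq nat) (Cst l e t0 : R) (Mf : R -> nat).
Hypotheses (A0J : all J A0) (ctl : controlled B A0 Cst l e t0 Mf).
Local Notation t := (complex.Im s).
Hypotheses (se : `|complex.Re s| <= e) (st : t0 <= `|t|) (t_neq0 : t != 0).

Let Lc_eq m n f v x : (forall y, inI y -> v y = f y) -> inI x ->
  iter n (Lc (letters m) s) v x = iter n (Lc (letters m) s) f x.
Proof.
move=> vf xI; rewrite !LcE; apply: eq_big_seq => w wA.
by rewrite vf// gwI// (wordsJ (letters_alphabet m) wA).
Qed.

Let transfer_bound n f (a1 a2 : R) m0 : C1I f ->
  (forall m x y, (m0 <= m)%N -> inI x -> inI y ->
     normc (iter n (Lc (letters m) s) f x) <= a1 /\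
     normc (iter n (Lc (letters m) s) f x - iter n (Lc (letters m) s) f y) <= a2 * `|x - y|) ->
  norm1 t (iter n (Linf s) f) <= a1 + a2 / `|t|.
Proof.
move=> fC H; have [nC Hn] := Linf_iter n fC.
have lim x : inI x -> tendsC (fun m => iter n (Lc (letters m) s) f x) (iter n (Linf s) f x).
  by move=> xI e' e0; have [m1 Hm] := Hn e' e0; exists m1 => m mm; exact: Hm.
apply: norm1_le => // [x xI|x y xI yI].
  by apply: tendsC_le (lim x xI) (_ : forall m, (m0 <= m)%N -> _) => m mm; have [] := H m x x mm xI xI.
by apply: tendsC_le (tendsCB (lim x xI) (lim y yI)) (_ : forall m, (m0 <= m)%N -> _) => m mm;
  have [] := H m x y mm xI yI.
Qed.

Lemma Linf_norms f : C1I f ->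
  (forall n, norm1 t (iter n (Linf s) f) <= 2 * Cst * l ^+ n * norm1 t f) /\
  norm1 t (iter (Mf t) (Linf s) f) <= 2^-1 * norm1 t f.
Proof.
move=> fC; have [v [dv [vd dvc vf dvf]]] := C1I_DerC fC.
set a := norm1 t f; have a0 : 0 <= a := norm1_ge0 t_neq0 fC.
have va y : inI y -> normc (v y) <= a.
  by move=> yI; rewrite vf//; have [] := norm1_bounds t_neq0 fC yI.
have dva y : inI y -> normc (dv y) <= `|t| * a.
  by move=> yI; rewrite dvf//; have [] := norm1_bounds t_neq0 fC yI.
have [m0 Hm0] := letters_sub A0J.
have H m (mm : (m0 <= m)%N) := ctl (letters_alphabet m)
  (fun i iA => letters_mono mm (Hm0 i iA)) se st vd dvc a0 va dva.
have tn : `|t| != 0 by rewrite normr_eq0.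
split=> [n|].
  have -> : 2 * Cst * l ^+ n * a = Cst * l ^+ n * a + Cst * l ^+ n * (`|t| * a) / `|t|.
    by field.
  apply: (@transfer_bound n f _ _ m0 fC) => m x y mm xI yI.
  have [h _] := H m mm; have [h1 h2] := h n x y xI yI.
  by rewrite !(Lc_eq m n vf) in h1 h2.
have -> : 2^-1 * a = a / 4 + `|t| * a / 4 / `|t| by field.
apply: (@transfer_bound (Mf t) f _ _ m0 fC) => m x y mm xI yI.
have [_ h] := H m mm; have [h1 h2] := h x y xI yI.
by rewrite !(Lc_eq m (Mf t) vf) in h1 h2.
Qed.

End full_operator.

(** * The branch system of a Markov map *)

Section disjoint_intervals.
Variable R : realType.

Lemma seq_argmax (b : nat -> R) (A : seq nat) : A != [::] ->
  exists2 i, i \in A & forall j, j \in A -> b j <= b i.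
Proof.
elim: A => // i [|k A] IH _.
  by exists i; [rewrite inE|move=> j; rewrite inE => /eqP ->].
have [//|m mA Hm] := IH; have [im|mi] := leP (b i) (b m).
  by exists m; [rewrite inE mA orbT|move=> j; rewrite inE => /predU1P[->|/Hm]].
exists i; first by rewrite inE eqxx.
move=> j; rewrite inE => /predU1P[->//|/Hm h]; exact: le_trans h (ltW mi).
Qed.

(* The interval with the largest right endpoint lies to the right of all the
   others. *)
Lemma sum_disjoint_increments (a b : nat -> R) (G : R -> R) (A : seq nat) (c : R) :
  (forall x y, inI x -> inI y -> x <= y -> G x <= G y) -> inI c -> uniq A ->
  (forall i, i \in A -> [/\ 0 <= a i, a i < b i & b i <= c]) ->
  (forall i j, i \in A -> j \in A -> i != j ->
    forall x, ~ (a i < x < b i /\ a j < x < b j)) ->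
  \sum_(i <- A) (G (b i) - G (a i)) <= G c - G 0.
Proof.
move=> Gm; have [n] := ubnP (size A); elim: n => // n IH in A c *.
rewrite ltnS => An cI1 uA ab dis.
have [->|/(seq_argmax b)[i iA im]] := eqVneq A [::].
  by rewrite big_nil subr_ge0 Gm ?inI0//; case/andP: cI1.
have [ai abi bi] := ab i iA; case/inIP: (cI1) => c0 c1.
have aI : inI (a i) by apply/inIP; lra.
have bI : inI (b i) by apply/inIP; lra.
rewrite (big_rem i)//=.
have : \sum_(j <- rem i A) (G (b j) - G (a j)) <= G (a i) - G 0.
  apply: IH => //; rewrite ?rem_uniq//.
  - have A0 : (0 < size A)%N by rewrite lt0n size_eq0; apply: contraTneq iA => ->.
    by rewrite size_rem// prednK.
  - move=> j; rewrite mem_rem_uniq// inE => /andP[ji jA].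
    have [aj abj bj] := ab j jA; split => //.
    rewrite leNgt; apply/negP => h; have hm := im j jA.
    pose m := Num.max (a i) (a j).
    have mi : a i <= m by rewrite le_max lexx.
    have mj : a j <= m by rewrite le_max lexx orbT.
    have mb : m < b j by rewrite gt_max h abj.
    apply: (dis i j iA jA _ ((m + b j) / 2)); first by rewrite eq_sym.
    by split; apply/andP; split; lra.
  by move=> j k jA kA; apply: dis; [exact: mem_rem jA|exact: mem_rem kA].
have : G (b i) <= G c by apply: Gm.
by lra.
Qed.

End disjoint_intervals.

(** * From the Markov map to a branch system *)

Section markov_map.
Variable R : realType.
Variables (J : set nat) (a b : nat -> R) (T : R -> R) (h : nat -> R -> R) (r : R -> R)
  (K sigma0 : R).
Hypotheses (hT : is_markov_map J a b T h) (hexp : expanding J h) (hK : 0 < K)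
  (hrenyi : renyi J h K) (hr : is_roof J a b h r K sigma0).

Let bounds i : J i -> [/\ 0 <= a i, a i < b i & b i <= 1].
Proof. by case: hT => -[H _ _] _ _ _ _; exact: H. Qed.

Let h_ab i x : J i -> inI x -> a i <= h i x <= b i.
Proof.
move=> Ji xI; have [_ _ H _] := map_branch hT Ji.
by have [] := H x (proj2 (I01E x) xI); rewrite /= in_itv.
Qed.

Let h_inI i x : J i -> inI x -> inI (h i x).
Proof.
move=> Ji xI; have [a0 ab b1] := bounds Ji; have /andP[h1 h2] := h_ab Ji xI.
by apply/inIP; lra.
Qed.

Let h_inj i x y : J i -> inI x -> inI y -> h i x = h i y -> x = y.
Proof.
move=> Ji xI yI e; have [_ _ H _] := map_branch hT Ji.
have [_ <-] := H x (proj2 (I01E x) xI); have [_ <-] := H y (proj2 (I01E y) yI).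
by rewrite e.
Qed.

(* A branch with a critical point would be constant by Renyi's condition. *)
Let branch_sign i : J i -> exists2 e : R, `|e| = 1 & forall x, inI x -> 0 < e * derivI (h i) x.
Proof.
move=> Ji; have [hC1 hC2] := map_branch_C2 hT Ji.
have [H [dH [Hd dHc HE dHE]]] := isC1_Der hC1.
have [L [dL [Ld dLc LE dLE]]] := isC1_Der hC2.
have Lne x : inI x -> L x != 0.
  move=> xI; apply/eqP => L0.
  have fd : Der (fun x => L x * L x) (fun x => 2 * (L x * dL x)).
    by apply: (Der_ext (DerM Ld Ld)) => y _; ring.
  have LB y : inI y -> `|2 * (L y * dL y)| <= 2 * K * (L y * L y).
    move=> yI; rewrite !normrM normr_nat dLE// -mulrA ler_wpM2l//.
    have := hrenyi Ji (proj2 (I01E y) yI); rewrite -LE// => h1.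
    apply: le_trans (ler_wpM2l (normr_ge0 _) h1) _.
    by rewrite mulrCA -normrM ger0_norm// -expr2 sqr_ge0.
  have L0' y : inI y -> L y = 0.
    move=> yI; have k : 0 <= 2 * K by rewrite mulr_ge0// ltW.
    have := loglip k fd (fun z _ => _) LB yI xI; rewrite L0 !mulr0.
    have sq z : 0 <= L z * L z by rewrite -expr2 sqr_ge0.
    move=> /(_ sq) h1; have : L y * L y = 0 by apply/eqP; rewrite eq_le h1 sq.
    by move/eqP; rewrite mulf_eq0 orbb => /eqP.
  have := @Der_lipschitz _ _ _ 0 1 0 Hd.
  have dH0 z : inI z -> `|dH z| <= 0 by move=> zI; rewrite dHE// -LE// L0'// normr0.
  move=> /(_ dH0 (inI1 R) (inI0 R)); rewrite mul0r normr_le0 subr_eq0 => /eqP e.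
  have := h_inj Ji (inI1 R) (inI0 R); rewrite -!HE ?inI0 ?inI1// => /(_ e) /eqP.
  by rewrite oner_eq0.
pose e := Num.sg (L 0); have e1 : `|e| = 1 by rewrite /e normr_sg Lne ?inI0.
exists e => // x xI; rewrite -LE// lt_def; apply/andP; split.
  by rewrite mulf_neq0 ?Lne// -normr_eq0 e1 oner_neq0.
rewrite leNgt; apply/negP => neg; case/inIP: (xI) => x0 x1.
have c : {within `[0, x], continuous (fun y => e * L y)}.
  by apply: cI_within xI; [exact: cIZ (Der_cI Ld)|exact: inI0].
have [|z] := @IVT _ (fun y => e * L y) 0 x 0 x0 c.
  have e0 : 0 <= e * L 0 by rewrite /e -normrEsg.
  by rewrite ge_min le_max (ltW neg) e0 orbT.
rewrite in_itv /= => /andP[z0 zx] /eqP; rewrite mulf_eq0 -normr_eq0 e1 oner_eq0 /=.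
by apply/negP; apply: Lne; apply/inIP; lra.
Qed.

Record branch_data := BranchData {
  bh : R -> R; blam : R -> R; bdlam : R -> R; brho : R -> R; bdrho : R -> R; beps : R }.

Record extends_branch (i : nat) (D : branch_data) : Prop := ExtendsBranch {
  bhE : forall x, inI x -> bh D x = h i x;
  bhd : Der (bh D) (fun x => beps D * blam D x);
  beps1 : `|beps D| = 1;
  blamE : forall x, inI x -> blam D x = `|derivI (h i) x|;
  blam_gt0 : forall x, inI x -> 0 < blam D x;
  blamd : Der (blam D) (bdlam D);
  bdlamc : cI (bdlam D);
  bdlamB : forall x, inI x -> `|bdlam D x| <= K * blam D x;
  brhod : Der (brho D) (bdrho D);
  bdrhoc : cI (bdrho D);
  brhoE : forall x, inI x -> brho D x = compI r (h i) x;
  bhoo : forall x, 0 < x -> x < 1 -> a i < bh D x < b i;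
  brhoE' : forall x, 0 < x -> x < 1 -> brho D x = r (h i x) }.

Lemma extends_branch_exists i : J i -> exists D, extends_branch i D.
Proof.
move=> Ji; have [e e1 epos] := branch_sign Ji.
have [hC1 hC2] := map_branch_C2 hT Ji.
have [H [dH [Hd dHc HE dHE]]] := isC1_Der hC1.
have [L [dL [Ld dLc LE dLE]]] := isC1_Der hC2.
have [P [dP [Pd dPc PE dPE]]] := isC1_Der (roof_comp_C1 hr Ji).
have ee : e * e = 1 by rewrite -expr2 -real_normK ?num_real// e1 expr1n.
have Hd' : Der H (fun x => e * (e * L x)).
  by apply: (Der_ext Hd) => x xI; rewrite mulrA ee mul1r dHE// LE.
have L0 x : inI x -> 0 < e * L x by move=> xI; rewrite LE// epos.
have Hoo x : 0 < x -> x < 1 -> a i < H x < b i.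
  move=> x0 x1; have xI : inI x by apply/inIP; rewrite !ltW.
  have mono y z : inI y -> inI z -> y < z -> 0 < e * (H z - H y).
    move=> yI zI yz; have [c [cI1 _ _ ->]] := Der_MVT Hd' yI zI (ltW yz).
    by rewrite !mulrA ee mul1r mulr_gt0 ?subr_gt0 ?L0.
  have h1 := mono _ _ (inI0 R) xI x0; have h2 := mono _ _ xI (inI1 R) x1.
  have /andP[a0 b0] := h_ab Ji (inI0 R); have /andP[a1 b1] := h_ab Ji (inI1 R).
  move: a0 b0 a1 b1; rewrite -!HE ?inI0 ?inI1// => a0 b0 a1 b1.
  have : (e == 1) || (e == -1) by move/eqP: e1; rewrite eqr_norml ler01 andbT.
  by case/orP=> /eqP E; rewrite E in h1 h2; apply/andP; split; lra.
have Hoo' x : 0 < x -> x < 1 -> `]a i, b i[%classic (H x).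
  by move=> x0 x1; rewrite /= in_itv /= Hoo.
have PE' x : 0 < x -> x < 1 -> P x = r (h i x).
  move=> x0 x1; have xI : inI x by apply/inIP; rewrite !ltW.
  rewrite PE// -HE//; apply: (@compI_eq _ _ _ (r \o H)) => //.
    apply: continuous_comp; first exact: (Der_cI Hd xI).
    have [rd _] := roof_C1 hr Ji (Hoo' x x0 x1).
    by apply: differentiable_continuous; apply/derivable1_diffP.
  by move=> y y0 y1; rewrite /= HE//; apply/inIP; rewrite !ltW.
have n1 (z : R) : `|e * z| = `|z| by rewrite normrM e1 mul1r.
exists (BranchData H (fun x => e * L x) (fun x => e * dL x) P dP e); split => //=.
- by move=> x xI; rewrite -LE// -n1 gtr0_norm// L0.
- exact: DerZ.
- exact: cIZ.
move=> x xI; rewrite -[e * L x]gtr0_norm ?L0// !n1 dLE// LE//.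
exact: (hrenyi Ji (proj2 (I01E x) xI)).
Qed.

(* On ]0, 1[ the extension of r \o h is r \o h itself, so that roof_deriv_le
   bounds its derivative. *)
Lemma extension_roof i D x : J i -> extends_branch i D -> 0 < x -> x < 1 ->
  0 <= brho D x /\ `|bdrho D x| <= K.
Proof.
move=> Ji eD x0 x1; have xI : inI x by apply/inIP; rewrite !ltW.
split; first by rewrite (brhoE' eD)// (roof_ge0 hr)//; apply/I01E/h_inI.
have xab : `]a i, b i[%classic (bh D x) by rewrite /= in_itv /= (bhoo eD).
have [rd _] := roof_C1 hr Ji xab.
have rD : is_derive (bh D x) 1 r (derive1 r (bh D x)).
  by rewrite derive1E; apply/derivableP.
have cD := is_derive1_comp rD (bhd eD xI).
have : is_derive x 1 (r \o bh D) (bdrho D x).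
  have := brhod eD xI; apply: near_eq_is_derive.
  near=> y; have y0 : 0 < y by near: y; exact: lt_nbhsr.
  have y1 : y < 1 by near: y; exact: lt_nbhsl.
  by rewrite (brhoE' eD)//= (bhE eD)//; apply/inIP; rewrite !ltW.
move=> d1; have := @derive_val _ _ _ _ _ _ _ d1; rewrite (@derive_val _ _ _ _ _ _ _ cD) => <-.
rewrite /GRing.scale /= !normrM (beps1 eD) mul1r (blamE eD)// normr_id (bhE eD)//.
by rewrite (roof_deriv_le hr Ji)// /= in_itv /= x0.
Unshelve. all: by end_near. Qed.

Lemma cI_ge0_oo (f : R -> R) : cI f -> (forall x, 0 < x -> x < 1 -> 0 <= f x) ->
  forall x, inI x -> 0 <= f x.
Proof.
move=> fc f0 x xI; rewrite leNgt; apply/negP => fx.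
have : \forall y \near x, f y < 0 by apply: (fc x xI [set z | z < 0]); exact: lt_nbhsl.
move=> N; have PF := nbhs_I01oo xI.
have W : within `]0, 1[%classic (nbhs x) [set y | `]0, 1[%classic y /\ f y < 0].
  by rewrite /within /=; apply: filterS N => y fy yI; split.
have [y [y1 y2]] := filter_ex W.
by move: y1 y2; rewrite /= in_itv /= => /andP[y0 y1]; rewrite ltNge f0.
Qed.

(** The rate in [expanding] is only known to be less than 1. If J is nonempty it is positive, since
    branches are injective; if J is empty only the empty word is left, and 1/2 serves. *)
Lemma gw_contraction : exists C q, [/\ 1 <= C, 0 < q, q < 1 &
  forall w x y, (forall i, i \in w -> J i) -> inI x -> inI y ->
    `|gw h w x - gw h w y| <= C * q ^+ size w * `|x - y|].
Proof.
have [C [q [C1 q1 H]]] := hexp.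
have C0 : 0 < C := lt_le_trans ltr01 C1.
have gwE w x : foldr (fun i g => h i \o g) id w x = gw h w x by elim: w => //= i w ->.
have qpos i : J i -> 0 < q.
  move=> Ji; have := H 1%N (foldr (fun i g => h i \o g) id [:: i]) 1 0 isT.
  rewrite !I01E inI0 inI1 => /(_ _ isT isT) h1.
  have : `|h i 1 - h i 0| <= C * q.
    rewrite subr0 normr1 mulr1 expr1 /= in h1; apply: h1; exists [:: i] => //.
    by split=> // j; rewrite inE => /eqP ->.
  rewrite -(pmulr_rgt0 _ C0); apply: lt_le_trans; rewrite normr_gt0 subr_eq0.
  apply/eqP => /(h_inj Ji (inI1 R) (inI0 R)) /eqP; by rewrite oner_eq0.
exists C, (if 0 < q then q else 2^-1); split => //.
- by case: ifP => // _; rewrite invr_gt0.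
- by case: ifP => // _; rewrite invf_lt1// ltr1n.
move=> [|i w] x y wJ xI yI; first by rewrite expr0 mulr1 ler_peMl.
have -> : 0 < q by apply: (qpos i); apply: wJ; rewrite inE eqxx.
have := H (size (i :: w)) (foldr (fun i g => h i \o g) id (i :: w)) x y isT.
by rewrite !gwE !I01E => h1; apply: h1 => //; exists (i :: w).
Qed.

(** The parameter sigma0 / 2 lies strictly between sigma0 and 0: the weights are still summable
    there, and its opposite is a positive exponent, the [S1] of the branch system. *)
Lemma weight_sums : exists2 M, 1 <= M & forall n x, inI x ->
  \sum_(i <- iota 0 n | i \in J) weight r (h i) (sigma0 / 2) x <= M.
Proof.
have s0 := roof_sigma0 hr.
have := @roof_summable _ _ _ _ _ _ _ _ hr (sigma0 / 2) ltac:(lra).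
pose u i := ereal_sup [set (weight r (h i) (sigma0 / 2) x)%:E | x in I01].
set S := (X in (X < _)%E) => Sfin.
have w0 i x : 0 <= weight r (h i) (sigma0 / 2) x.
  by rewrite mulr_ge0 ?expR_ge0.
have wu i x : inI x -> ((weight r (h i) (sigma0 / 2) x)%:E <= u i)%E.
  by move=> xI; apply: ereal_sup_ubound; exists x => //; exact/I01E.
have u0 i : (0 <= u i)%E by apply: le_trans (wu i 0 (inI0 R)); rewrite lee_fin.
have S0 : (0 <= S)%E by apply: nneseries_ge0 => i _ _; exact: u0.
have SE : (fine S)%:E = S by rewrite fineK// ge0_fin_numE.
exists (Num.max 1 (fine S)) => [|n x xI]; first by rewrite le_max lexx.
rewrite le_max; apply/orP; right; rewrite -lee_fin SE -sumEFin.
apply: le_trans (@nneseries_lim_ge R u (fun i => i \in J) 0 n (fun i _ _ => u0 i)).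
rewrite /index_iota subn0; apply: lee_sum => i _; exact: wu.
Qed.

Lemma branch_increments n (G : R -> R) : (forall x y, inI x -> inI y -> x <= y -> G x <= G y) ->
  \sum_(i <- iota 0 n | i \in J) `|G (h i 1) - G (h i 0)| <= G 1 - G 0.
Proof.
move=> Gm; rewrite -big_filter; set A := [seq i <- _ | _].
have AJ i : i \in A -> J i by rewrite mem_filter => /andP[/set_mem].
have := @sum_disjoint_increments R a b G A 1 Gm (inI1 R).
rewrite filter_uniq ?iota_uniq// => /(_ isT (fun i iA => bounds (AJ i iA))) H.
apply: le_trans (H _) => [|i j iA jA ij x [xi xj]]; last first.
  move/eqP: ij; apply; apply: (part_disjoint (map_partition hT) (AJ i iA) (AJ j jA)).
  by exists x; split; rewrite /= in_itv.
rewrite big_seq [leRHS]big_seq; apply: ler_sum => i iA; have Ji := AJ i iA.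
have [a0 ab b1] := bounds Ji.
have aI : inI (a i) by apply/inIP; lra.
have bI : inI (b i) by apply/inIP; lra.
have Gh x : inI x -> G (a i) <= G (h i x) <= G (b i).
  by move=> xI; have /andP[h1 h2] := h_ab Ji xI; rewrite !Gm// h_inI.
have /andP[l0 u0] := Gh 0 (inI0 R); have /andP[l1 u1] := Gh 1 (inI1 R).
by rewrite ler_norml; apply/andP; split; lra.
Qed.

Lemma branch_system_exists : exists B : branch_system R,
  [/\ bs_J B = (fun i => i \in J), bs_S1 B = - (sigma0 / 2),
      forall i x, J i -> inI x -> [/\ bs_h B i x = h i x,
        bs_lam B i x = `|derivI (h i) x| & bs_rho B i x = compI r (h i) x],
      forall i x, J i -> 0 < x -> x < 1 -> a i < h i x < b i /\ bs_rho B i x = r (h i x) &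
      forall n, alphabet B (letters B n)].
Proof.
have ex i : exists D, J i -> extends_branch i D.
  have [Ji|nJ] := pselect (J i).
    by have [D eD] := extends_branch_exists Ji; exists D.
  (* Arbitrary data for the indices outside J. *)
  by exists (BranchData id id id id id 0).
have [D DE0] := choice ex.
have DE i : i \in J -> extends_branch i (D i) by move=> /set_mem; exact: DE0.
have [C [q [C1 q0 q1 Hq]]] := gw_contraction.
have [M M1 HM] := weight_sums.
have S10 : 0 < - (sigma0 / 2) by have := roof_sigma0 hr; lra.
have hI i x : i \in J -> inI x -> inI (bh (D i) x).
  by move=> iJ xI; rewrite (bhE (DE i iJ))// h_inI//; exact: set_mem.
have gwE w x : all (fun i => i \in J) w -> inI x -> gw (fun i => bh (D i)) w x = gw h w x /\ inI (gw h w x).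
  elim: w => //= i w IH /andP[iJ wJ] xI; have [-> gI] := IH wJ xI.
  by split; [rewrite (bhE (DE i iJ))|apply: h_inI => //; exact: set_mem].
have contr w x y : all (fun i => i \in J) w -> inI x -> inI y ->
    `|gw (fun i => bh (D i)) w x - gw (fun i => bh (D i)) w y| <= C * q ^+ size w * `|x - y|.
  move=> wJ xI yI; have [-> _] := gwE w x wJ xI; have [-> _] := gwE w y wJ yI.
  by apply: Hq => // i iw; apply/set_mem/(allP wJ).
have rho0 i x : i \in J -> inI x -> 0 <= brho (D i) x.
  move=> iJ; apply: cI_ge0_oo; first exact: (Der_cI (brhod (DE i iJ))).
  by move=> y y0 y1; have [] := extension_roof (set_mem iJ) (DE i iJ) y0 y1.
have drhoB i x : i \in J -> inI x -> `|bdrho (D i) x| <= K.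
  move=> iJ xI; rewrite -subr_ge0.
  apply: (@cI_ge0_oo (fun x => K - `|bdrho (D i) x|)) xI; last first.
    by move=> y y0 y1; rewrite subr_ge0; have [] := extension_roof (set_mem iJ) (DE i iJ) y0 y1.
  apply: cIB; first exact: cI_cst.
  by apply: cI_compT (bdrhoc (DE i iJ)) => y; exact: norm_continuous.
pose B := @BranchSystem R (fun i => i \in J) (fun i => bh (D i)) (fun i => blam (D i))
  (fun i => bdlam (D i)) (fun i => brho (D i)) (fun i => bdrho (D i)) (fun i => beps (D i))
  K C q (- (sigma0 / 2)) M hI (fun i iJ => bhd (DE i iJ)) (fun i iJ => beps1 (DE i iJ))
  (fun i x iJ => @blam_gt0 _ _ (DE i iJ) x) (fun i iJ => blamd (DE i iJ))
  (fun i iJ => bdlamc (DE i iJ)) (fun i x iJ => @bdlamB _ _ (DE i iJ) x)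
  (fun i iJ => brhod (DE i iJ)) (fun i iJ => bdrhoc (DE i iJ)) drhoB rho0
  hK C1 q0 q1 S10 M1 contr.
exists B; split => //.
- move=> i x /mem_set iJ xI; have eD := DE i iJ.
  by rewrite /= (bhE eD)// (blamE eD)// (brhoE eD).
- move=> i x /mem_set iJ x0 x1; have eD := DE i iJ.
  rewrite /= -(bhE eD); last by apply/inIP; rewrite !ltW.
  by rewrite (bhoo eD)// (brhoE' eD)// -(bhE eD)//; apply/inIP; rewrite !ltW.
move=> n; split; first exact: filter_all.
  move=> x xI; apply: le_trans (HM n x xI); rewrite big_filter /=.
  rewrite le_eqVlt; apply/orP; left; apply/eqP; apply: eq_bigr => i iJ.
  by rewrite (blamE (DE i iJ))// (brhoE (DE i iJ))// /weight mulNr.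
move=> G Gm; apply: le_trans (branch_increments n Gm); rewrite big_filter /=.
rewrite le_eqVlt; apply/orP; left; apply/eqP; apply: eq_bigr => i iJ.
by rewrite !(bhE (DE i iJ)) ?inI0 ?inI1.
Qed.

Section the_branch_system.
Variable B : branch_system R.
Hypotheses (BJ : bs_J B = (fun i => i \in J))
  (BE : forall i x, J i -> inI x -> [/\ bs_h B i x = h i x,
    bs_lam B i x = `|derivI (h i) x| & bs_rho B i x = compI r (h i) x])
  (Boo : forall i x, J i -> 0 < x -> x < 1 ->
    a i < h i x < b i /\ bs_rho B i x = r (h i x)).

(** [h i] inverts the continuous extension of T, which agrees with T at interior points of the
    subinterval. *)
Let T_h i z : J i -> 0 < z -> z < 1 -> T (h i z) = z.
Proof.
move=> Ji z0 z1; have [hab _] := Boo Ji z0 z1.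
have zI : inI z by apply/inIP; rewrite !ltW.
have hz : `]a i, b i[%classic (h i z) by rewrite /= in_itv.
have [Td _ _] := map_C2 hT Ji hz.
have [_ _ H _] := map_branch hT Ji; have [_ e] := H z (proj2 (I01E z) zI).
rewrite -[RHS]e; apply/esym; apply: (@ext_eq _ _ T T) => //.
  by apply: Build_ProperFilter_ex => P /nbhs_singleton /(_ hz) Ph; exists (h i z).
by apply: differentiable_continuous; apply/derivable1_diffP.
Qed.

(** Branches send interior points of I to interior points of the subintervals, so each application
    of T removes the head of the word and the values of T and r at the cut points never enter. The
    endpoints of I are recovered by continuity through [compI]. *)
Let birkhoff_rw w y : (forall i, i \in w -> J i) -> 0 < y -> y < 1 ->
  let z := foldr (fun i g => h i \o g) id w y in
  [/\ 0 < z, z < 1, gw (bs_h B) w y = z & birkhoff T r (size w) z = rw B w y].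
Proof.
move=> + y0 y1; elim: w => [|i w IH] wJ /=; first by split; rewrite // /birkhoff big_ord0.
have Ji : J i by apply: wJ; rewrite inE eqxx.
have [j jw|z0 z1 gz bz] := IH; first by apply: wJ; rewrite inE jw orbT.
move: z0 z1 gz bz; set z := foldr _ _ _ _ => z0 z1 gz bz.
have zI : inI z by apply/inIP; rewrite !ltW.
have [/andP[h1 h2] rz] := Boo Ji z0 z1; have [a0 ab b1] := bounds Ji.
have [hE _ _] := BE Ji zI; rewrite gz hE; split => //.
- exact: le_lt_trans h1.
- exact: lt_le_trans b1.
rewrite /birkhoff big_ord_recl /= rz -bz; congr (_ + _).
by apply: eq_bigr => k _; rewrite -/(iter k.+1 T (h i z)) iterSr T_h.
Qed.

Lemma UNI_uniform_phase : UNI J h T r -> uniform_phase B.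
Proof.
move=> [D [n0 [D0 _ H]]]; exists D, n0; split => // n /H[g [k [[w [wn wJ] <-] [v [vn vJ] <-] Dle]]].
have allJ u : (forall i, i \in u -> J i) -> all (bs_J B) u.
  by move=> uJ; apply/allP => i /uJ; rewrite BJ => /mem_set.
exists w, v; split; rewrite ?allJ// => x xI.
have E u y : (forall i, i \in u -> J i) -> size u = n -> inI y ->
    compI (birkhoff T r n) (foldr (fun i g => h i \o g) id u) y = rw B u y.
  move=> uJ <- yI; apply: compI_eq => //; first exact: (rwc (allJ u uJ) yI).
  by move=> z z0 z1; have [_ _ _ ->] := birkhoff_rw uJ z0 z1.
have d := DerB (rwd (allJ w wJ)) (rwd (allJ v vJ)).
have psiE y : inI y -> psi T r n (foldr (fun i g => h i \o g) id w)
    (foldr (fun i g => h i \o g) id v) y = rw B w y - rw B v y.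
  by move=> yI; rewrite /psi (E w)// (E v).
have [_ <-] := derivI_eq d psiE xI.
apply: le_trans Dle _; apply: ge_inf; first by exists 0 => _ [y _ <-].
by exists x => //; exact/I01E.
Qed.

Lemma transfer_Linf s f : transfer J h r s f = Linf B s f.
Proof.
apply/funext => x; rewrite /transfer /Linf.
have [xI|xI] := boolP (inI x); last first.
  by rewrite memNset// => /I01E; exact/negP.
rewrite mem_set; last exact/I01E.
congr limC; apply/funext => n; rewrite /Lc /op /letters big_filter BJ.
pose F i := expc (- (s * (compI r (h i) x)%:C)) * (`|derivI (h i) x|)%:C * f (h i x).
rewrite -(big_mkord (fun i => i \in J) F) /index_iota subn0.
by apply: eq_bigr => i /set_mem Ji; have [-> -> ->] := BE Ji xI.
Qed.

End the_branch_system.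

End markov_map.

Unset Implicit Arguments.

Theorem corollary1p2 (R : realType) (J : set nat) (a b : nat -> R)
    (T : R -> R) (h : nat -> R -> R) (r : R -> R) (K sigma0 : R)
    (hT : is_markov_map J a b T h)
    (hexp : expanding J h)
    (hK : 0 < K)
    (hrenyi : renyi J h K)
    (hr : is_roof J a b h r K sigma0)
    (hUNI : UNI J h T r)
    (alpha : R) (halpha0 : 0 < alpha) (halpha1 : alpha < 1) :
  exists t0 epsilon : R, [/\ 0 < t0, 0 < epsilon &
    forall t sigma : R, t0 < `|t| -> `|sigma| < epsilon ->
      exists2 inv : (R -> R[i]) -> (R -> R[i]),
        inverse_on_C1I
          (fun f x => f x - transfer J h r (sigma +i* t) f x) inv &
        (opnorm1 t inv <= (`|t| `^ alpha)%:E)%E].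
Proof.
have [B [BJ BS BE Boo Balph]] := branch_system_exists hT hexp hK hrenyi hr.
have [A0 [Cst [l [e [t0 [Mf [Cst1 l1 e0 t01 [A0J ctl HM]]]]]]]] :=
  uniform_control halpha0 (UNI_uniform_phase hT BJ BE Boo hUNI).
have S10 : 0 < - (sigma0 / 2) by have := roof_sigma0 hr; lra.
(* Besides e, the bound 1 on |sigma| is needed for the distortion of the real weights, and - sigma0
   / 2 for the sums of the weights to stay below M. *)
exists t0, (Num.min e (Num.min 1 (- (sigma0 / 2)))); split.
- exact: lt_le_trans t01.
- by rewrite !lt_min e0 ltr01.
move=> t sigma t0t; rewrite !lt_min => /and3P[se s1 sS].
have tn : t != 0 by rewrite -normr_gt0 (lt_trans _ t0t)// (lt_le_trans ltr01).
have [M0 HMt] := HM t (ltW t0t).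
pose s := sigma +i* t; pose L := Linf B s.
have ls1 : `|complex.Re s| <= 1 := ltW s1.
have lsS : `|complex.Re s| <= bs_S1 B by rewrite BS; exact: ltW.
have norms f := @Linf_norms R B Balph s ls1 lsS A0 Cst l e t0 Mf A0J ctl (ltW se) (ltW t0t) tn f.
have b0 n : 0 <= 2 * Cst * l ^+ n.
  apply: mulr_ge0; first by apply: mulr_ge0 => //; exact: le_trans ler01 Cst1.
  by apply: exprn_ge0; exact: le_trans ler01 l1.
have [inv invI invB] := @neumann_inverse R t tn L (Mf t) (fun n => 2 * Cst * l ^+ n) M0
  (@Linf_C1 R B Balph s ls1 lsS) (@Linf_sub R B Balph s ls1 lsS) b0
  (fun n f fC => proj1 (norms f fC) n) (fun f fC => proj2 (norms f fC)).
exists inv.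
  move: invI; congr inverse_on_C1I; apply/funext => f; apply/funext => x.
  by rewrite (transfer_Linf BJ BE).
apply: ge_ereal_sup => _ [f [fC f1] <-]; rewrite lee_fin.
apply: le_trans (invB f fC) (le_trans _ HMt).
have sum : \sum_(j < Mf t) 2 * Cst * l ^+ j <= (Mf t)%:R * (2 * Cst * l ^+ Mf t).
  have -> : (Mf t)%:R * (2 * Cst * l ^+ Mf t) = \sum_(j < Mf t) 2 * Cst * l ^+ Mf t.
    by rewrite sumr_const card_ord mulr_natl.
  apply: ler_sum => j _.
  rewrite ler_wpM2l ?ler_weXn2l 1?ltnW//.
  by apply: mulr_ge0 => //; exact: le_trans ler01 Cst1.
(* The inverse is a sum of [Mf t] iterates, bounded by the largest growth factor, applied to a
   function whose norm is at most 2. *)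
have -> : 4 * Cst * (Mf t)%:R * l ^+ Mf t = (Mf t)%:R * (2 * Cst * l ^+ Mf t) * (2 * 1).
  by ring.
apply: ler_pM => //; first by apply: sumr_ge0.
  by rewrite mulr_ge0// norm1_ge0.
by rewrite ler_wpM2l.
Qed.
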